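(* Consider the filtering model $$X_k=f(X_{k-1})+\zeta_k,\qquad Y_k=h(X_k)+\varepsilon_k,$$ with state noise depending on the previous state, as described in the context, and assume: (E1) $f$ is $a$-Lipschitz, $h$ is uniformly continuous and surjective, and there are constants $b_0,b$ such that $|x_1-x_2|\le b_0+b|h(x_1)-h(x_2)|$ for all $x_1,x_2\in\mathsf X$; (E2) the density $\upsilon$ of $\varepsilon_k$ is bounded, $\lim_{|u|\to\infty}\upsilon(u)=0$, and $\inf_{y\in K}\upsilon(y)>0$ for every compact set $K\subset\mathsf Y$; (G) for every $k$, $\zeta_k$ is independent of $\varepsilon_k$ and $\mathbb P(\zeta_k\in A\mid X_{k-1}=x)=\int_Aq(x,u)\,du$ for all $A\in\mathcal X$, and there are a positive probability density $\psi$ on $\mathsf X$ and constants $\mu^-,\mu^+>0$ with $\mu^-\psi(u)\le q(x,u)\le\mu^+\psi(u)$ for all $x,u\in\mathsf X$. Let $\{Y_k^*\}_{k\ge0}$ be generated by the state-space model $$X_k^*=f^*(X_{k-1}^* )+\zeta_k^*,\qquad Y_k^*=h^*(X_k^* )+\varepsilon_k^*$$ described in the context, where $\zeta_k^*=g^*(X_{k-1}^*,A_k^* )$ with $g^*$ measurable and $\{A_k^*\}_{k\ge0}$ i.i.d. uniform on $(0,1)$, and suppose: (O1) $\|f-f^*\|_\infty<\infty$ and $\|h-h^*\|_\infty<\infty$; (O3) there is a measurable function $g_+^*$ such that $|g^*(x,u)|\le g_+^*(u)$ for all $x\in\mathsf X$ and $u\in(0,1)$; (O4) for all $\Delta>0$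 there exists $\tau>0$ such that the log-moment generating function $\lambda\mapsto\log\mathbb E[e^{\lambda Z_1^{*\Delta}}]$ is finite on $[0,\tau)$, where $$Z_k^{*\Delta}=-\log q^-\big[c+d\Delta+\kappa+2a^*b^*+a^*b^*|\varepsilon_{k-1}^*|+b^*|\varepsilon_k^*|+g_+^*(A_k^* )\big],\qquad k\ge1 .$$ Let $\nu,\nu'$ be probability measures on $(\mathsf X,\mathcal X)$ and $\Delta>0$ be such that, for some $\lambda>0$, $$\mathbb E_\star\Big\{\exp\big(\lambda[\log\nu g(\cdot,Y_0^* )Q\mathbf 1_{\mathsf C(Y_1^*,\Delta)}]_-\big)\Big\}<\infty,\qquad\mathbb E_\star\Big\{\exp\big(\lambda[\log\nu' g(\cdot,Y_0^* )Q\mathbf 1_{\mathsf C(Y_1^*,\Delta)}]_-\big)\Big\}<\infty .$$ Then $$\limsup_{n\to\infty}n^{-1}\log\mathbb E_\star\Big[\big\|\phi_{\nu,n}[Y^*_{0:n}]-\phi_{\nu',n}[Y^*_{0:n}]\big\|_{\mathrm{TV}}\Big]<0 .$$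
   Context: Filtering model. $\mathsf X=\mathbb R^N$, $\mathsf Y=\mathbb R^p$ with $p\le N$, with Borel $\sigma$-fields $\mathcal X,\mathcal Y$; $f:\mathsf X\to\mathsf X$, $h:\mathsf X\to\mathsf Y$ are measurable; $\{\varepsilon_k\}_{k\ge0}$ is i.i.d. with positive density $\upsilon$ with respect to Lebesgue measure on $\mathsf Y$. The filter is computed with the kernel $Q(x,A)=\int_Aq(x,x'-f(x))\,dx'$ and the likelihood $g(x,y)=\upsilon(y-h(x))$: $$\phi_{\nu,n}[y_{0:n}](A)=\frac{\int\nu(dx_0)g(x_0,y_0)\prod_{i=1}^nQ(x_{i-1},dx_i)g(x_i,y_i)\mathbf 1_A(x_n)}{\int\nu(dx_0)g(x_0,y_0)\prod_{i=1}^nQ(x_{i-1},dx_i)g(x_i,y_i)} .$$ $\nu g(\cdot,y)Q\mathbf 1_A=\int\nu(dx)g(x,y)Q(x,A)$; $[t]_-=\max(-t,0)$; $\|\cdot\|_{\mathrm{TV}}$ is the total variation norm; $\mathsf C(y,\Delta)=\{x\in\mathsf X:|h(x)-y|\le\Delta\}$. Set $c=(a+1)b_0$, $d=(a+1)b$, $q^-(r)=\mu^-\inf_{|v|\le r}\psi(v)$ and $q^+(r)=\mu^+\sup_{|v|\le r}\psi(v)$; it is understood that $0<q^-(r)\le q^+(r)<\infty$ for all $r$ (so that $y\mapsto\mathsf C(y,\Delta)$ is a local Doeblin set function, i.e. for all $y,y'$ there are constants in $(0,\infty)$ bounding $Q(x,A\cap\mathsf C(y',\Delta))$ below and above by multiples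 of the Lebesgue measure of $A\cap\mathsf C(y',\Delta)$, uniformly in $x\in\mathsf C(y,\Delta)$ and $A\in\mathcal X$). Observation process (law $\mathbb P_\star$, expectation $\mathbb E_\star$), not necessarily produced by the filtering model. $\{\varepsilon_k^*\}_{k\ge0}$ is i.i.d. and independent of $\{A_k^*\}_{k\ge0}$; $f^*:\mathsf X\to\mathsf X$ is $a^*$-Lipschitz; $h^*:\mathsf X\to\mathsf Y$ is measurable and surjective and, for some positive constants $b_0^*,b^*$, $|x_1-x_2|\le b_0^*+b^*|h^*(x_1)-h^*(x_2)|$ for all $x_1,x_2\in\mathsf X$. For all $k\ge1$, $\zeta_k^*$ is independent of $\varepsilon_k^*$ and $\mathbb P(\zeta_k^*\in A\mid X_{k-1}^*=x)=\int_Aq^*(x,u)\,du$; there are a probability density $\psi^*$ on $\mathsf X$ and constants $\mu^*_-,\mu^*_+>0$ with $\mu_-^*\psi^*(u)\le q^*(x,u)\le\mu_+^*\psi^*(u)$ for all $x,u\in\mathsf X$. With $\|\cdot\|_\infty$ the supremum norm, $\kappa=\|f-f^*\|_\infty+(b_0+b\|h^*-h\|_\infty)(1+a^* )$. *)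

(* Defs.v *)
From HB Require Import structures.
From mathcomp Require Import all_boot all_order all_algebra.
From mathcomp Require Import lra.
From mathcomp Require Import all_classical all_reals all_analysis.
From mathcomp Require Import measurable_realfun.

Set Implicit Arguments.
Unset Strict Implicit.
Unset Printing Implicit Defensive.
Import Order.TTheory GRing.Theory Num.Theory.
Import numFieldNormedType.Exports.

Local Open Scope classical_set_scope.
Local Open Scope ring_scope.

(* 'rV[R]_n carries its Borel sigma-algebra (generated by the open sets) and
   the Lebesgue measure of R^n on it. *)
Section borel_rV.
Context (R : realType) (n : nat).

Let G := @open 'rV[R]_n.

HB.instance Definition _ := @isMeasurable.Build (sigma_display G)
  'rV[R]_n <<s G >> (@sigma_algebra0 _ setT G) (@sigma_algebraC 'rV[R]_n G)
  (@sigma_algebra_bigcup _ setT G).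

Lemma open_measurable_rV (U : set 'rV[R]_n) : open U -> measurable U.
Proof. by move=> oU; exact: sub_sigma_algebra. Qed.

Lemma measurable_coord (i : 'I_n) :
  measurable_fun [set: 'rV[R]_n] (fun x => x 0 i).
Proof.
apply: (measurability _ (measurable_realfun.RGenOpens.measurableE R)) => _ [_ [a [b ->] <-]].
rewrite setTI; apply: open_measurable_rV.
apply: open_comp; last exact: interval_open.
by move=> x _; exact: coord_continuous.
Qed.

Lemma measurable_fun_rVP d (T : measurableType d) (F : T -> 'rV[R]_n) :
  measurable_fun setT F <-> forall i, measurable_fun setT (fun t => F t 0 i).
Proof.
split=> [mF i|mF].
  apply: (measurableT_comp (f := fun x : 'rV[R]_n => x 0 i) (g := F)) => //.
  exact: measurable_coord.
apply: (measurability _ (erefl : measurable = <<s G >>)) => _ [U oU <-].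
rewrite setTI.
pose box (c : 'rV[rat]_n * nat) : set 'rV[R]_n :=
  [set x | forall i, ball (ratr (c.1 0 i) : R) (c.2.+1%:R^-1) (x 0 i)].
have -> : F @^-1` U = \bigcup_(c : 'rV[rat]_n * nat)
    (if `[< box c `<=` U >] then F @^-1` (box c) else set0).
  apply/seteqP; split => [t Ut|t [c _]]; last by case: asboolP => // + Fc; exact.
  have : nbhs (F t) U by exact: open_nbhs_nbhs.
  rewrite -nbhs_ballE => -[e /= e0 eU].
  have [m me] : exists m : nat, m.+1%:R^-1 < e / 2 :> R.
    have e20 : 0 < e / 2 by rewrite divr_gt0.
    have [m _ /(_ m (leqnn m))] := near_infty_natSinv_lt (PosNum e20).
    by exists m.
  have /choice[q qF] : forall i, exists q : rat,
      ball (ratr q : R) m.+1%:R^-1 (F t 0 i).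
    move=> i; have m0 : (0:R) < m.+1%:R^-1 by rewrite invr_gt0.
    move: (m.+1%:R^-1) m0 => r r0.
    have lt : F t 0 i - r < F t 0 i + r by lra.
    have [q] := rat_in_itvoo lt.
    rewrite in_itv/= => /andP[q1 q2]; exists q.
    by rewrite /ball /= ltr_norml; apply/andP; split; lra.
  exists (\row_i q i, m) => //=.
  case: asboolP => [_|]; first by move=> i /=; rewrite mxE.
  case=> x /= bx; apply: eU; split => // i j.
  rewrite ord1 (splitr e).
  apply: (@ball_triangle _ _ (ratr (q j) : R)).
    by apply: ball_sym; apply: le_ball (qF j); exact: ltW.
  by have /= := bx j; rewrite mxE; apply: le_ball; exact: ltW.
apply: countable_bigcupT_measurable => // c; case: asboolP => // _.
rewrite (_ : F @^-1` _ = \bigcap_(i in [set: 'I_n])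
   ((fun t => F t 0 i) @^-1` ball (ratr (c.1 0 i) : R) (c.2.+1%:R^-1))); last first.
  by apply/seteqP; split=> [t /= h i _|t /= h i]; exact: h.
apply: fin_bigcap_measurable => // i _.
rewrite -[X in measurable X]setTI; apply: mF => //.
by apply: open_measurable; exact: ball_open.
Qed.

End borel_rV.

Section lebesgue_rV.
Context (R : realType).

Definition rV_cons n (tv : R * 'rV[R]_n) : 'rV[R]_n.+1 :=
  \row_i oapp (tv.2 0) tv.1 (unlift ord0 i).

Lemma measurable_rV_cons n : measurable_fun setT (@rV_cons n).
Proof.
apply/measurable_fun_rVP => i.
case: (unliftP ord0 i) => [j ->|->].
- rewrite (_ : (fun _ => _) = (fun v : 'rV[R]_n => v 0 j) \o snd); last first.
    by apply/funext => tv; rewrite mxE liftK.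
  by apply: measurableT_comp => //; exact: measurable_coord.
- rewrite (_ : (fun _ => _) = fst) //.
  by apply/funext => tv; rewrite mxE unlift_none.
Qed.

HB.instance Definition _ n := isMeasurableFun.Build _ _ _ _ (@rV_cons n)
  (@measurable_rV_cons n).

Definition rV_uncons n (x : 'rV[R]_n.+1) : R * 'rV[R]_n :=
  (x 0 ord0, \row_i x 0 (lift ord0 i)).

Lemma rV_consK n : cancel (@rV_cons n) (@rV_uncons n).
Proof.
case=> t v; congr pair; first by rewrite mxE unlift_none.
by apply/rowP => i; rewrite !mxE liftK.
Qed.

Lemma rV_unconsK n : cancel (@rV_uncons n) (@rV_cons n).
Proof.
move=> x; apply/rowP => i; rewrite mxE.
by case: unliftP => [j ->|->] /=; rewrite ?mxE.
Qed.

Lemma measurable_rV_uncons n : measurable_fun setT (@rV_uncons n).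
Proof.
apply/measurable_fun_pairP; split; first exact: measurable_coord.
by apply/measurable_fun_rVP => i; under eq_fun do rewrite mxE; exact: measurable_coord.
Qed.

Section step.
Context (n : nat) (m : {sigma_finite_measure set 'rV[R]_n -> \bar R}).

(* Image of the product of the one-dimensional Lebesgue measure and m under
   (t, (v_0, ..., v_(n-1))) |-> (t, v_0, ..., v_(n-1)). *)
Definition lebesgue_step : set 'rV[R]_n.+1 -> \bar R :=
  pushforward (lebesgue_measure \x m)%E (@rV_cons n).

HB.instance Definition _ := Measure.copy lebesgue_step
  (measure_function_pushforward__canonical__measure_function_Measure
    (lebesgue_measure \x m)%E (@measurable_rV_cons n)).

Let lebesgue_step_sigma_finite : sigma_finite setT lebesgue_step.
Proof.
have /sigma_finiteP[F [FT ndF Foo]] := sigma_finiteT (@lebesgue_measure R).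
have /sigma_finiteP[G [GT ndG Goo]] := sigma_finiteT m.
exists (fun k => @rV_uncons n @^-1` (F k `*` G k)).
  rewrite -preimage_bigcup; apply/esym; rewrite -subTset => x _.
  have : [set: R] (rV_uncons x).1 by [].
  have : [set: 'rV[R]_n] (rV_uncons x).2 by [].
  rewrite FT GT => -[k _ Gk] [j _ Fj]; exists (maxn j k) => //; split.
    by move: Fj; exact/subsetPset/ndF/leq_maxl.
  by move: Gk; exact/subsetPset/ndG/leq_maxr.
move=> k; have [mF Fk] := Foo k; have [mG Gk] := Goo k; split.
  rewrite -[X in measurable X]setTI; apply: measurable_rV_uncons => //.
  exact: measurableX.
rewrite /lebesgue_step /pushforward -comp_preimage.
rewrite (_ : @rV_uncons n \o @rV_cons n = id); last first.
  by apply/funext => x; exact: rV_consK.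
by rewrite preimage_id product_measure1E// lte_mul_pinfty// ge0_fin_numE.
Qed.

HB.instance Definition _ := Measure_isSigmaFinite.Build _ _ _ lebesgue_step
  lebesgue_step_sigma_finite.

End step.

Fixpoint lebesgue_rV n : {sigma_finite_measure set 'rV[R]_n -> \bar R} :=
  if n is k.+1 then lebesgue_step (lebesgue_rV k)
  else @dirac _ 'rV[R]_0 0 R.

Lemma lebesgue_rV_box n (A : 'I_n -> set R) : (forall i, measurable (A i)) ->
  (lebesgue_rV n [set x | forall i, A i (x 0%R i)] =
   \prod_(i < n) lebesgue_measure (A i))%E.
Proof.
elim: n A => [|n IH] A mA.
  by rewrite big_ord0 /= diracE mem_set // => -[].
rewrite big_ord_recl -IH; last by move=> i; exact: mA.
have mB : measurable [set x : 'rV[R]_n | forall i, A (lift ord0 i) (x 0 i)].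
  rewrite (_ : [set _ | _] = \bigcap_(i in [set: 'I_n])
      ((fun x : 'rV[R]_n => x 0 i) @^-1` A (lift ord0 i))); last first.
    by apply/seteqP; split=> [x /= h i _|x /= h i]; exact: h.
  apply: fin_bigcap_measurable => // i _; rewrite -[X in measurable X]setTI.
  exact: measurable_coord.
rewrite -[RHS]product_measure1E//=; last exact: mA.
rewrite /lebesgue_step /pushforward.
congr (product_measure1 _ _ _); apply/seteqP.
split=> [[t v] /= Atv|[t v] /= [At Av] i].
  split=> [|i]; first by have := Atv ord0; rewrite mxE unlift_none.
  by have := Atv (lift ord0 i); rewrite mxE liftK.
by rewrite mxE; case: unliftP => [j ->|->] //=.
Qed.

End lebesgue_rV.

Section euclidean.
Context (R : realType).

Definition enorm n (x : 'rV[R]_n) : R := Num.sqrt (\sum_(i < n) x 0 i ^+ 2).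

Definition supnorm (T : Type) n (u : T -> 'rV[R]_n) : \bar R :=
  ereal_sup [set (enorm (u x))%:E | x in [set: T]].

Definition prob_density n (p : 'rV[R]_n -> R) : Prop :=
  [/\ measurable_fun setT p, forall u, 0 <= p u &
      (\int[lebesgue_rV R n]_u (p u)%:E = 1)%E].

End euclidean.

Section probability.
Context d (T : measurableType d) (R : realType) (P : probability T R).

Definition has_density n (Z : T -> 'rV[R]_n) (p : 'rV[R]_n -> R) : Prop :=
  forall A, measurable A ->
    (P (Z @^-1` A) = \int[lebesgue_rV R n]_(u in A) (p u)%:E)%E.

Definition independent_rv d1 d2 (T1 : measurableType d1)
    (T2 : measurableType d2) (U : T -> T1) (V : T -> T2) : Prop :=
  forall A B, measurable A -> measurable B ->
    (P (U @^-1` A `&` V @^-1` B) = P (U @^-1` A) * P (V @^-1` B))%E.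

(* [cond_law U V K] : K is a version of the conditional law of V given U, that
   is, P(V \in B | U = x) = K x B. *)
Definition cond_law d1 d2 (T1 : measurableType d1) (T2 : measurableType d2)
    (U : T -> T1) (V : T -> T2) (K : T1 -> set T2 -> \bar R) : Prop :=
  forall A B, measurable A -> measurable B ->
    (P (U @^-1` A `&` V @^-1` B) = \int[P]_(w in U @^-1` A) K (U w) B)%E.

Definition mutually_independent d1 (T1 : measurableType d1)
    (U : nat -> T -> T1) : Prop :=
  forall (s : seq nat) (A : nat -> set T1), uniq s ->
    (forall k, measurable (A k)) ->
    (P (\bigcap_(k in [set` s]) (U k @^-1` A k)) =
     \prod_(k <- s) P (U k @^-1` A k))%E.

Definition iid d1 (T1 : measurableType d1) (U : nat -> T -> T1) : Prop :=
  mutually_independent U /\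
  forall k A, measurable A -> P (U k @^-1` A) = P (U 0%N @^-1` A).

Definition sigma_process d1 (T1 : measurableType d1) (U : nat -> T -> T1) :
  set (set T) := <<s \bigcup_k preimage_set_system setT (U k) measurable >>.

Definition independent_processes d1 d2 (T1 : measurableType d1)
    (T2 : measurableType d2) (U : nat -> T -> T1) (V : nat -> T -> T2) : Prop :=
  forall E F, sigma_process U E -> sigma_process V F ->
    (P (E `&` F) = P E * P F)%E.

End probability.

(* Total variation norm of a finite signed measure, the supremum of
   \sum_i |xi (F_i)| over the finite measurable partitions (F_i). *)
Definition tv_norm d (T : measurableType d) (R : realType) (xi : set T -> R) :
    \bar R :=
  ereal_sup [set r | exists n (F : 'I_n -> set T),
    [/\ forall i, measurable (F i), trivIset setT F,
        \bigcup_i F i = setT & r = (\sum_(i < n) `|xi (F i)|)%:E]].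

Section filtering.
Context (R : realType) (N p : nat).
Local Notation X := 'rV[R]_N.
Local Notation Y := 'rV[R]_p.

Definition likelihood (h : X -> Y) (upsilon : Y -> R) (x : X) (y : Y) : R :=
  upsilon (y - h x).

(* \int \prod_(k < i <= k + n) Q(x_(i-1), dx_i) g(x_i, y_i) 1_A(x_(k + n)),
   as a function of x_k = x. *)
Fixpoint future_integral (Q : R.-pker X ~> X) (g : X -> Y -> R) (y : nat -> Y)
    (A : set X) (n k : nat) (x : X) : \bar R :=
  if n is m.+1 then
    (\int[Q x]_x' ((g x' (y k.+1))%:E * future_integral Q g y A m k.+1 x'))%E
  else (\1_A x)%:E.

Definition unnormalized_filter (nu : probability X R) (Q : R.-pker X ~> X)
    (g : X -> Y -> R) (y : nat -> Y) (n : nat) (A : set X) : \bar R :=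
  (\int[nu]_x ((g x (y 0%N))%:E * future_integral Q g y A n 0 x))%E.

(* phi_(nu,n)[y_(0:n)](A); only the first n + 1 terms of y are used.  When g is
   positive and bounded, both integrals are finite and the one on [setT] is
   positive. *)
Definition filter_law (nu : probability X R) (Q : R.-pker X ~> X)
    (g : X -> Y -> R) (y : nat -> Y) (n : nat) (A : set X) : R :=
  fine (unnormalized_filter nu Q g y n A) /
  fine (unnormalized_filter nu Q g y n setT).

(* nu g(., y) Q 1_A *)
Definition one_step (nu : probability X R) (Q : R.-pker X ~> X)
    (g : X -> Y -> R) (y : Y) (A : set X) : \bar R :=
  (\int[nu]_x ((g x y)%:E * Q x A))%E.

Definition neg_part (t : \bar R) : \bar R := maxe (- t)%E 0%E.

Definition near_fiber (h : X -> Y) (y : Y) (Delta : R) : set X :=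
  [set x | enorm (h x - y) <= Delta].

(* The bounds take values in \bar R so that an unbounded psi has an infinite
   supremum. *)
Definition q_minus (mum : R) (psi : X -> R) (r : R) : \bar R :=
  (mum%:E * ereal_inf [set (psi v)%:E | v in [set v | (enorm v <= r)%R]])%E.

Definition q_plus (mup : R) (psi : X -> R) (r : R) : \bar R :=
  (mup%:E * ereal_sup [set (psi v)%:E | v in [set v | (enorm v <= r)%R]])%E.

Record filtering_model d (T : measurableType d) (P : probability T R)
    (f : X -> X) (h : X -> Y) (upsilon : Y -> R) (q : X -> X -> R)
    (Xp zeta : nat -> {RV P >-> X}) (eps Yp : nat -> {RV P >-> Y}) : Prop := {
  model_state : forall k w, Xp k.+1 w = f (Xp k w) + zeta k.+1 w ;
  model_obs : forall k w, Yp k w = h (Xp k w) + eps k w ;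
  model_eps_iid : iid P eps ;
  model_eps_density : forall k, has_density P (eps k) upsilon ;
  model_zeta_eps : forall k, independent_rv P (zeta k.+1) (eps k.+1) ;
  model_zeta_law : forall k, cond_law P (Xp k) (zeta k.+1)
    (fun x A => (\int[lebesgue_rV R N]_(u in A) (q x u)%:E)%E)
}.

Record observation_process d (T : measurableType d) (P : probability T R)
    (fstar : X -> X) (hstar : X -> Y) (gstar : X -> R -> X)
    (qstar : X -> X -> R) (Xstar zetastar : nat -> {RV P >-> X})
    (epsstar Ystar : nat -> {RV P >-> Y}) (Astar : nat -> {RV P >-> R}) :
    Prop := {
  obs_state : forall k w, Xstar k.+1 w = fstar (Xstar k w) + zetastar k.+1 w ;
  obs_obs : forall k w, Ystar k w = hstar (Xstar k w) + epsstar k w ;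
  obs_noise : forall k w, zetastar k.+1 w = gstar (Xstar k w) (Astar k.+1 w) ;
  obs_eps_iid : iid P epsstar ;
  obs_A_iid : iid P Astar ;
  obs_A_uniform : forall k B, measurable B ->
    P (Astar k @^-1` B) = uniform_prob (@ltr01 R) B ;
  obs_eps_A : independent_processes P epsstar Astar ;
  obs_zeta_eps : forall k, independent_rv P (zetastar k.+1) (epsstar k.+1) ;
  obs_zeta_law : forall k, cond_law P (Xstar k) (zetastar k.+1)
    (fun x A => (\int[lebesgue_rV R N]_(u in A) (qstar x u)%:E)%E)
}.

(* kappa; the suprema are assumed finite wherever this is used. *)
Definition mismatch (f fstar : X -> X) (h hstar : X -> Y) (b0 b astar : R) : R :=
  fine (supnorm (fun x => f x - fstar x)) +
  (b0 + b * fine (supnorm (fun x => hstar x - h x))) * (1 + astar).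

(* Z_k for k >= 1, with qm = q^-. *)
Definition Zstar (T : Type) (qm : R -> \bar R) (c d Delta kappa astar bstar : R)
    (gplus : R -> R) (epsstar : nat -> T -> Y) (Astar : nat -> T -> R)
    (k : nat) (w : T) : \bar R :=
  (- lne (qm (c + d * Delta + kappa + 2 * astar * bstar
              + astar * bstar * enorm (epsstar k.-1 w)
              + bstar * enorm (epsstar k w) + gplus (Astar k w))%R))%E.

End filtering.

(* Main.v *)
Require Import Defs.
From HB Require Import structures.
From mathcomp Require Import all_boot all_order all_algebra.
From mathcomp Require Import all_classical all_reals all_analysis.
From mathcomp Require Import measurable_realfun ring lra zify.

Import Order.TTheory GRing.Theory Num.Theory.
Import numFieldNormedType.Exports.

Local Open Scope classical_set_scope.
Local Open Scope ring_scope.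

(** Write F_A(x) for the integral of the future likelihoods and the indicator
    of A over the paths started at x.  The difference of the two filters at A is
    the integral of the cross product F_A(x) F_T(x') - F_A(x') F_T(x), T the
    whole space, against nu x nu' and the initial likelihoods, divided by the
    two normalising constants.  The proof bounds the cross product and the
    normalising constants separately, for a fixed path of observations, and
    then takes expectations of the resulting products of independent factors.

    Cross product ([cross_contraction], [pair_contraction], [filter_distance]).
    Call a step good when the observation noises at both ends and the state
    noise are at most L.  By the geometry of the fibres ([transition_radius]),
    at a good step the kernels started from two points of the fibre
    C(Y_k, D) are both comparable to Lebesgue measure on C(Y_(k+1), D), so
    their ratio there is at least some t > 0 ([kernel_ratio]).  Exchanging the
    two end points then changes the measure by a ratio of at least t^2, and the
    antisymmetry of the cross product makes it shrink by the factor
    rho = 1 - t^2.  A point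
    outside the fibre gains nothing, but its likelihood is at most e^(-H) times
    the bound M of upsilon.  Accepting s exits gives, up to powers of M, the bound
      rho^(good steps - 1 - 2 s) + e^(- H s) / (Z Z').

    Normalising constants ([filter_mass_expR]).  Keeping only the paths that
    stay in the fibres of the given width Delta bounds Z below by the initial
    weight nu g Q 1_C, a geometric factor, and exp(- sum of penalties), the
    penalty of a step being [- log q^-] at the radius that the noises of
    that step allow.

    Expectations ([pathwise], [expectation_bound]).  As the distance is at most
    2, the second error term may be raised to a small power lam
    ([tv_filter_path]).  Its factors are separated by the inequality of the
    means; penalties of even and odd steps are treated apart, so that each
    product runs over independent blocks of noises and its expectation is a
    power of one exponential moment, which (O4) makes finite.  Bad steps in the
    first term are charged a weight rho^(-4) whose mean is close to 1.

    Rates ([exponential_decay]).  With s about n / 8, a large H lets the s exits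
    pay for the geometric growth of the second term.  Then D, L and t are
    chosen in this order: L makes bad steps rare, with a probability that does
    not depend on t, and the gain rho^(3 n / 4) beats the mean weight of the
    bad steps for every small t.  The radius in (O4) is not literally the one
    obtained from the geometry, and the difference is absorbed by enlarging the
    width at which (O4) is used. *)

(** * Comparison of integrals *)

Section prob_of.
Context d (T : measurableType d) (R : realType) (mu : {measure set T -> \bar R}).

(** The values [Q x] of a probability kernel and the products of probabilities are
    only known as measures; this attaches to them the structure of a probability. *)
Definition prob_of (h : mu setT = 1%E) : set T -> \bar R := mu.

Variable h : mu setT = 1%E.
HB.instance Definition _ := Measure.copy (prob_of h) mu.
HB.instance Definition _ := Measure_isProbability.Build _ _ _ (prob_of h) h.

End prob_of.

Section comparison.
Context d (T : measurableType d) (R : realType).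
Import HBNNSimple.

(** The integral of a nonnegative function is the supremum over the simple
    functions below it, so that monotonicity needs no measurability.  This is
    what allows total variation norms to be integrated. *)
Lemma ge0_le_integral_lower (mu : {measure set T -> \bar R}) (f g : T -> \bar R) :
  (forall x, 0 <= f x)%E -> (forall x, f x <= g x)%E ->
  (\int[mu]_x f x <= \int[mu]_x g x)%E.
Proof.
move=> f0 fg; rewrite !ge0_integralTE//; last by move=> x; exact: le_trans (fg x).
apply: ereal_sup_le => _ [k /= kf <-]; exists k => //= x.
exact: le_trans (kf x) (fg x).
Qed.

(** Since f vanishes off E, only the restrictions of the two measures to E
    contribute. *)
Lemma integral_le_of_minor (E : set T) (t : R)
    (m1 m2 : {measure set T -> \bar R}) (f : T -> \bar R) :
  measurable E -> 0 <= t -> measurable_fun setT f ->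
  (forall x, 0 <= f x)%E -> (forall x, ~ E x -> f x = 0%E) ->
  (forall A, measurable A -> (t%:E * m1 (A `&` E) <= m2 (A `&` E))%E) ->
  (t%:E * \int[m1]_x f x <= \int[m2]_x f x)%E.
Proof.
move=> mE t0 mf f0 fE m12.
have H (m : {measure set T -> \bar R}) : (\int[m]_x f x = \int[m]_(x in E) f x)%E.
  rewrite [RHS]integral_mkcond; apply: eq_integral => x _.
  by rewrite patchE; case: ifPn => // /negP; rewrite inE; exact: fE.
have Hr (m : {measure set T -> \bar R}) :
    (\int[mrestr m mE]_(x in E) f x = \int[m]_(x in E) f x)%E.
  by apply: eq_measure_integral => A mA AE /=; rewrite /mrestr setIidl.
rewrite !H -(Hr m1) -(Hr m2) -(ge0_integral_mscale _ mE (NngNum t0))//.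
  by apply: ge0_le_measure_integral => // S mS; exact: m12.
exact: measurable_funTS.
Qed.

Lemma integral_bounded_fin (mu : probability T R) (a : T -> R) K :
  measurable_fun setT a -> (forall x, 0 <= a x) -> (forall x, a x <= K) ->
  (\int[mu]_x (a x)%:E = (fine (\int[mu]_x (a x)%:E))%:E)%E /\
  0 <= fine (\int[mu]_x (a x)%:E)%E <= K.
Proof.
move=> ma a0 aK.
have i0 : (0 <= \int[mu]_x (a x)%:E)%E by apply: integral_ge0 => z _; rewrite lee_fin.
have iK : (\int[mu]_x (a x)%:E <= K%:E)%E.
  apply: (@le_trans _ _ (\int[mu]_x (cst K%:E x))%E).
    apply: ge0_le_integral => //; try (by move=> z _; rewrite lee_fin).
    exact/measurable_EFinP.
  by rewrite integral_cst// [X in (_ * X)%E]probability_setT mule1.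
have fin : (\int[mu]_x (a x)%:E)%E \is a fin_num.
  by rewrite ge0_fin_numE// (le_lt_trans iK) ?ltry.
by rewrite fineK// fine_ge0//= -lee_fin fineK.
Qed.

End comparison.

Section exchange.
Context d (T : measurableType d) (R : realType).
Implicit Types mu : probability T R.

Lemma integral_prod_swap mu mu' (phi : T * T -> \bar R) :
  measurable_fun setT phi -> (forall z, 0 <= phi z)%E ->
  (\int[mu \x mu']_z phi (z.2, z.1) = \int[mu' \x mu]_z phi z)%E.
Proof.
move=> mphi phi0; rewrite fubini_tonelli1//; last first.
  exact: (measurableT_comp mphi (@measurable_swap _ _ T T)).
by rewrite fubini_tonelli2.
Qed.

(** The two coordinates are exchanged one after the other, mu' for mu in the
    first and mu for mu' in the second, at the price of a factor t each. *)
Lemma minor_prod mu mu' (E : set T) (t : R) (phi : T * T -> \bar R) :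
  measurable E -> 0 <= t ->
  (forall A, measurable A -> (t%:E * mu' (A `&` E) <= mu (A `&` E))%E) ->
  (forall A, measurable A -> (t%:E * mu (A `&` E) <= mu' (A `&` E))%E) ->
  measurable_fun setT phi -> (forall z, 0 <= phi z)%E ->
  (forall z, ~ (E z.1 /\ E z.2) -> phi z = 0%E) ->
  ((t ^+ 2)%:E * \int[mu' \x mu]_z phi z <= \int[mu \x mu']_z phi z)%E.
Proof.
move=> mE t0 h1 h2 mphi phi0 phiE.
rewrite !fubini_tonelli1// /fubini_F.
have mF (m : probability T R) : measurable_fun setT (fun x => \int[m]_y phi (x, y))%E.
  exact: measurable_fun_fubini_tonelli_F.
have F0 (m : probability T R) x : (0 <= \int[m]_y phi (x, y))%E.
  by apply: integral_ge0 => y _.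
have FE (m : probability T R) x : ~ E x -> (\int[m]_y phi (x, y))%E = 0%E.
  by move=> nE; apply: integral0_eq => y _; apply: phiE => -[].
rewrite expr2 EFinM -muleA.
apply: (@le_trans _ _ (t%:E * \int[mu]_x (\int[mu]_y phi (x, y)))%E).
  apply: lee_wpmul2l; first by rewrite lee_fin.
  by apply: (@integral_le_of_minor _ _ _ E t mu' mu (fun x => \int[mu]_y phi (x, y))%E) => //; exact: FE.
rewrite -ge0_integralZl//.
apply: ge0_le_integral => //.
- by move=> x _; rewrite mule_ge0// ?lee_fin//; exact: F0.
- by apply: measurable_funeM; exact: mF.
- exact: mF.
- move=> x _; apply: (@integral_le_of_minor _ _ _ E t mu mu' (fun y => phi (x, y))) => //.
  + by apply: measurableT_comp => //; exact: pair1_measurable.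
  + by move=> y nE; apply: phiE => -[].
Qed.

End exchange.

(** * Contraction of cross products of integrals *)

Lemma normr_maxD (R : realType) (c : R) : `|c| = Num.max c 0 + Num.max (- c) 0.
Proof.
have [c0|c0] := boolP (0 <= c).
  by rewrite ger0_norm// max_l// max_r ?oppr_le0// addr0.
rewrite -ltNge in c0.
by rewrite ltr0_norm// max_r ?(ltW c0)// max_l ?oppr_ge0 ?(ltW c0)// add0r.
Qed.

Lemma maxB (R : realType) (c : R) : Num.max c 0 - Num.max (- c) 0 = c.
Proof.
have [c0|c0] := boolP (0 <= c).
  by rewrite max_l// max_r ?oppr_le0// subr0.
rewrite -ltNge in c0.
by rewrite max_r ?(ltW c0)// max_l ?oppr_ge0 ?(ltW c0)// sub0r opprK.
Qed.

Section contraction.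
Context d (T : measurableType d) (R : realType).
Variables (mu mu' : probability T R) (a b : T -> R) (E : set T) (t K : R).
Hypotheses (mE : measurable E) (t0 : 0 <= t) (t1 : t <= 1).
Hypotheses (ma : measurable_fun setT a) (mb : measurable_fun setT b).
Hypotheses (a0 : forall x, 0 <= a x) (b0 : forall x, 0 <= b x).
Hypotheses (aK : forall x, a x <= K) (bK : forall x, b x <= K).
Hypothesis minor : forall A, measurable A -> (t%:E * mu' (A `&` E) <= mu (A `&` E))%E.
Hypothesis minor' : forall A, measurable A -> (t%:E * mu (A `&` E) <= mu' (A `&` E))%E.

Let P12 := (mu \x mu')%E.
Let in2 (z : T * T) : R := \1_E z.1 * \1_E z.2.
Let cross (z : T * T) : R := a z.1 * b z.2 - a z.2 * b z.1.
Let pos (z : T * T) : R := Num.max (cross z) 0.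
Let neg (z : T * T) : R := Num.max (- cross z) 0.

Let m1 (f : T -> R) : measurable_fun setT f -> measurable_fun setT (fun z : T * T => f z.1).
Proof. by move=> mf; exact: measurableT_comp. Qed.
Let m2 (f : T -> R) : measurable_fun setT f -> measurable_fun setT (fun z : T * T => f z.2).
Proof. by move=> mf; exact: measurableT_comp. Qed.

Let mcross : measurable_fun setT cross.
Proof. by apply: measurable_funB; apply: measurable_funM; auto. Qed.

Let min2 : measurable_fun setT in2.
Proof. by apply: measurable_funM; [apply: m1|apply: m2]; exact: measurable_indic. Qed.

Let mpos : measurable_fun setT pos.
Proof. by apply: measurable_maxr => //; exact: measurable_cst. Qed.

Let mneg : measurable_fun setT neg.
Proof. by apply: measurable_maxr => //; exact: measurableT_comp. Qed.

Let K0 : 0 <= K. Proof. exact: le_trans (a0 point) (aK point). Qed.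

Let in2_01 z : in2 z = 0 \/ in2 z = 1.
Proof. by rewrite /in2 !indicE; do 2!case: (_ \in _) => /=; rewrite ?(mulr0, mul0r, mulr1); auto. Qed.

Let pos0 z : 0 <= pos z. Proof. by rewrite /pos le_max lexx orbT. Qed.
Let neg0 z : 0 <= neg z. Proof. by rewrite /neg le_max lexx orbT. Qed.

Let prod_le x y : 0 <= a x * b y <= K ^+ 2.
Proof. by rewrite mulr_ge0//= expr2 ler_pM. Qed.

Let posK z : pos z <= K ^+ 2.
Proof.
rewrite /pos ge_max exprn_ge0// andbT /cross.
have /andP[] := prod_le z.1 z.2; have /andP[] := prod_le z.2 z.1; lra.
Qed.
Let negK z : neg z <= K ^+ 2.
Proof.
rewrite /neg ge_max exprn_ge0// andbT /cross.
have /andP[] := prod_le z.1 z.2; have /andP[] := prod_le z.2 z.1; lra.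
Qed.

Let P12T : P12 setT = 1%E.
Proof.
transitivity (mu setT * mu' setT)%E; last by rewrite !probability_setT mule1.
by rewrite -product_measure1E// setXTT.
Qed.

Let fin_int (f : T * T -> R) C : measurable_fun setT f -> (forall z, 0 <= f z <= C) ->
  exists2 r, 0 <= r & (\int[P12]_z (f z)%:E = r%:E)%E.
Proof.
move=> mf fC; have f0 z : 0 <= f z by have /andP[] := fC z.
have fK z : f z <= C by have /andP[] := fC z.
have [rE /andP[r0 _]] := integral_bounded_fin _ _ _ (prob_of _ _ _ _ P12T) f C mf f0 fK.
by exists (fine (\int[P12]_z (f z)%:E)%E).
Qed.

Let addP (f g : T * T -> R) : measurable_fun setT f -> measurable_fun setT g ->
  (forall z, 0 <= f z) -> (forall z, 0 <= g z) ->
  (\int[P12]_z (f z + g z)%:E = \int[P12]_z (f z)%:E + \int[P12]_z (g z)%:E)%E.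
Proof.
move=> mf mg f0 g0; under eq_integral do rewrite EFinD.
by rewrite ge0_integralD//; try (by move=> z _; rewrite lee_fin); exact/measurable_EFinP.
Qed.

Let prodE (f g : T -> R) : measurable_fun setT f -> measurable_fun setT g ->
  (forall z, 0 <= f z) -> (forall z, 0 <= g z) ->
  (\int[P12]_z (f z.1 * g z.2)%:E = \int[mu]_x (f x)%:E * \int[mu']_x (g x)%:E)%E.
Proof.
move=> mf mg f0 g0; rewrite fubini_tonelli1//=; last 2 first.
- by apply/measurable_EFinP; apply: measurable_funM; auto.
- by move=> z; rewrite lee_fin mulr_ge0.
rewrite /fubini_F /=; under eq_integral => x _.
  under eq_integral do rewrite EFinM.
  rewrite ge0_integralZl//; first over.
  - exact/measurable_EFinP.
  - by move=> y _; rewrite lee_fin.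
  - by rewrite lee_fin.
rewrite ge0_integralZr//.
- exact/measurable_EFinP.
- by move=> y _; rewrite lee_fin.
- by apply: integral_ge0 => y _; rewrite lee_fin.
Qed.

Let pos_swap z : pos (z.2, z.1) = neg z.
Proof. by rewrite /pos /neg /cross /= opprB. Qed.
Let neg_swap z : neg (z.2, z.1) = pos z.
Proof. by rewrite /pos /neg /cross /= opprB. Qed.

Let bd (f : T * T -> R) C : (forall z, 0 <= f z) -> (forall z, f z <= C) ->
  forall z, 0 <= f z * in2 z <= C.
Proof.
move=> f0 fC z; have [->|->] := in2_01 z; rewrite ?mulr0 ?mulr1 ?f0 ?fC// lexx /=.
exact: le_trans (f0 z) (fC z).
Qed.
Let bd' (f : T * T -> R) C : (forall z, 0 <= f z) -> (forall z, f z <= C) ->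
  forall z, 0 <= f z * (1 - in2 z) <= C.
Proof.
move=> f0 fC z; have [->|->] := in2_01 z; rewrite ?subr0 ?subrr ?mulr0 ?mulr1 ?f0 ?fC// lexx /=.
exact: le_trans (f0 z) (fC z).
Qed.

Let minorJ (f g : T * T -> R) : measurable_fun setT f -> (forall z, 0 <= f z) ->
  (forall z, f (z.2, z.1) = g z) ->
  ((t ^+ 2)%:E * \int[P12]_z (g z * in2 z)%:E <= \int[P12]_z (f z * in2 z)%:E)%E.
Proof.
move=> mf f0 fg.
have mfi : measurable_fun setT (fun z => (f z * in2 z)%:E).
  by apply/measurable_EFinP; exact: measurable_funM.
have fi0 z : (0 <= (f z * in2 z)%:E)%E.
  by rewrite lee_fin mulr_ge0//; have [->|->] := in2_01 z.
have := @integral_prod_swap _ _ _ mu mu' _ mfi fi0.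
rewrite (_ : (fun z => _) = (fun z => (g z * in2 z)%:E)); last first.
  by apply/funext => z; rewrite fg /in2 /= mulrC [in RHS]mulrC [X in X * _]mulrC.
move=> ->; apply: (@minor_prod _ _ _ mu mu' E t (fun z => (f z * in2 z)%:E)) => // z nE.
rewrite /in2 !indicE; have [e1|e1] := boolP (z.1 \in E); last by rewrite mul0r mulr0.
have [e2|e2] := boolP (z.2 \in E); last by rewrite !mulr0.
by exfalso; apply: nE; rewrite !inE in e1 e2.
Qed.

(** The left-hand side is the integral of the antisymmetric function
    a(u) b(v) - a(v) b(u) against mu x mu'.  Its positive and negative parts are
    exchanged by (u, v) |-> (v, u), and on E x E this exchange changes the
    integral by a ratio of at least t^2 in both directions.  Hence the two parts
    cancel on E x E up to the factor 1 - t^2; off E x E nothing is gained.  The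
    bound K makes all integrals finite. *)
Lemma cross_contraction :
  (`| fine (\int[mu]_x (a x)%:E) * fine (\int[mu']_x (b x)%:E)
    - fine (\int[mu']_x (a x)%:E) * fine (\int[mu]_x (b x)%:E) |%:E
   <= \int[mu \x mu']_z
       (`|a z.1 * b z.2 - a z.2 * b z.1| * (1 - t ^+ 2 * (\1_E z.1 * \1_E z.2)))%:E)%E.
Proof.
have K20 : 0 <= K ^+ 2 by rewrite exprn_ge0.
have mou : measurable_fun setT (fun z => 1 - in2 z) by exact: measurable_funB.
have mM (f g : T * T -> R) : measurable_fun setT f -> measurable_fun setT g ->
  measurable_fun setT (fun z => f z * g z) by exact: measurable_funM.
have [pin pin0 pinE] := fin_int _ _ (mM _ _ mpos min2) (bd _ _ pos0 posK).
have [nin nin0 ninE] := fin_int _ _ (mM _ _ mneg min2) (bd _ _ neg0 negK).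
have [pou pou0 pouE] := fin_int _ _ (mM _ _ mpos mou) (bd' _ _ pos0 posK).
have [nou nou0 nouE] := fin_int _ _ (mM _ _ mneg mou) (bd' _ _ neg0 negK).
have t2 : 0 <= 1 - t ^+ 2 by rewrite subr_ge0 exprn_ile1.
have h1 : t ^+ 2 * nin <= pin.
  by have := minorJ _ _ mpos pos0 pos_swap; rewrite pinE ninE -EFinM lee_fin.
have h2 : t ^+ 2 * pin <= nin.
  by have := minorJ _ _ mneg neg0 neg_swap; rewrite pinE ninE -EFinM lee_fin.
have fn (f : T -> R) (m : probability T R) : measurable_fun setT f -> (forall x, 0 <= f x) ->
    (forall x, f x <= K) -> exists r, (\int[m]_x (f x)%:E = r%:E)%E.
  move=> mf f0 fK; exists (fine (\int[m]_x (f x)%:E)%E).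
  by have [] := integral_bounded_fin _ _ _ m f K mf f0 fK.
have [A AE] := fn a mu ma a0 aK; have [A' A'E] := fn a mu' ma a0 aK.
have [B BE] := fn b mu mb b0 bK; have [B' B'E] := fn b mu' mb b0 bK.
have posE : (\int[P12]_z (pos z)%:E = (pin + pou)%:E)%E.
  rewrite EFinD -pinE -pouE -addP; last 4 first.
  - exact: measurable_funM.
  - exact: measurable_funM.
  - by move=> z; have /andP[] := bd _ _ pos0 posK z.
  - by move=> z; have /andP[] := bd' _ _ pos0 posK z.
  by apply: eq_integral => z _; rewrite -mulrDr addrC subrK mulr1.
have negE : (\int[P12]_z (neg z)%:E = (nin + nou)%:E)%E.
  rewrite EFinD -ninE -nouE -addP; last 4 first.
  - exact: measurable_funM.
  - exact: measurable_funM.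
  - by move=> z; have /andP[] := bd _ _ neg0 negK z.
  - by move=> z; have /andP[] := bd' _ _ neg0 negK z.
  by apply: eq_integral => z _; rewrite -mulrDr addrC subrK mulr1.
have mab : measurable_fun setT (fun z : T * T => a z.1 * b z.2) by apply: measurable_funM; auto.
have mba : measurable_fun setT (fun z : T * T => b z.1 * a z.2) by apply: measurable_funM; auto.
(* the cross product is the difference of its positive and negative parts *)
have balance : A * B' + (nin + nou) = B * A' + (pin + pou).
  suff : (A%:E * B'%:E + (nin + nou)%:E = B%:E * A'%:E + (pin + pou)%:E)%E.
    by rewrite -!EFinM -!EFinD => -[].
  rewrite -negE -posE -AE -B'E -BE -A'E.
  rewrite -!prodE// -!addP//; try (by move=> z; rewrite mulr_ge0).
  apply: eq_integral => z _; congr EFin; rewrite /neg /pos /cross.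
  set c := a z.1 * b z.2 - a z.2 * b z.1.
  have : Num.max c 0 - Num.max (- c) 0 = c by exact: maxB.
  by rewrite /c; lra.
rewrite AE A'E BE B'E /=.
have -> : (\int[P12]_z (`|a z.1 * b z.2 - a z.2 * b z.1| * (1 - t ^+ 2 * in2 z))%:E =
   (pou + nou + (1 - t ^+ 2) * (pin + nin))%:E)%E.
  have i0 z : 0 <= in2 z by have [->|->] := in2_01 z.
  have o0 z : 0 <= 1 - in2 z by have [->|->] := in2_01 z; rewrite ?subr0 ?subrr.
  have mpn : measurable_fun setT (fun z => pos z + neg z) by exact: measurable_funD.
  have pn0 z : 0 <= pos z + neg z by rewrite addr_ge0.
  transitivity (\int[P12]_z ((pos z * (1 - in2 z) + neg z * (1 - in2 z))
      + (1 - t ^+ 2) * (pos z * in2 z + neg z * in2 z))%:E)%E.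
    apply: eq_integral => z _; congr EFin.
    rewrite -!mulrDl (_ : `|_| = pos z + neg z); first by ring.
    rewrite /pos /neg /cross.
    exact: normr_maxD.
  rewrite !addP//; first last.
  - by move=> z; rewrite mulr_ge0// addr_ge0// mulr_ge0.
  - by move=> z; rewrite addr_ge0// mulr_ge0.
  - by apply: measurable_funM => //; apply: measurable_funD; exact: measurable_funM.
  - by apply: measurable_funD; exact: measurable_funM.
  - by move=> z; rewrite mulr_ge0.
  - by move=> z; rewrite mulr_ge0.
  - exact: measurable_funM.
  - exact: measurable_funM.
  have -> : (\int[P12]_z ((1 - t ^+ 2) * (pos z * in2 z + neg z * in2 z))%:E
      = (1 - t ^+ 2)%:E * \int[P12]_z (pos z * in2 z + neg z * in2 z)%:E)%E.
    rewrite -ge0_integralZl//.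
    - by apply/measurable_EFinP; apply: measurable_funD; exact: measurable_funM.
    - by move=> z _; rewrite lee_fin addr_ge0// mulr_ge0.
  rewrite addP//; first last.
  - by move=> z; rewrite mulr_ge0.
  - by move=> z; rewrite mulr_ge0.
  - exact: measurable_funM.
  - exact: measurable_funM.
  by rewrite pinE ninE pouE nouE.
have h3 : t ^+ 2 * nin <= nin by rewrite ler_piMl// exprn_ile1.
have h4 : t ^+ 2 * pin <= pin by rewrite ler_piMl// exprn_ile1.
rewrite lee_fin ler_norml mulrBl mul1r mulrDr.
by apply/andP; split; lra.
Qed.
End contraction.

(** * Forgetting along a path of observations *)

Section step.
Context d (T : measurableType d) (R : realType).

(** Bounds of the form c1 b(u) b(v) + c0 are stable under integration against
    mu x mu', which makes them suitable for an induction on the number of steps. *)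
Lemma cross_step (mu mu' : probability T R) (a b : T -> R) (E : set T) (t K c1 c0 : R) :
  measurable E -> 0 <= t -> t <= 1 ->
  measurable_fun setT a -> measurable_fun setT b ->
  (forall x, 0 <= a x) -> (forall x, 0 <= b x) ->
  (forall x, a x <= K) -> (forall x, b x <= K) ->
  (forall A, measurable A -> (t%:E * mu' (A `&` E) <= mu (A `&` E))%E) ->
  (forall A, measurable A -> (t%:E * mu (A `&` E) <= mu' (A `&` E))%E) ->
  0 <= c1 -> 0 <= c0 ->
  (forall u v, `|a u * b v - a v * b u| * (1 - t ^+ 2 * (\1_E u * \1_E v))
     <= c1 * (b u * b v) + c0) ->
  `| fine (\int[mu]_x (a x)%:E) * fine (\int[mu']_x (b x)%:E)
    - fine (\int[mu']_x (a x)%:E) * fine (\int[mu]_x (b x)%:E) |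
  <= c1 * (fine (\int[mu]_x (b x)%:E) * fine (\int[mu']_x (b x)%:E)) + c0.
Proof.
move=> mE t0 t1 ma mb a0 b0 aK bK minor minor' c10 c00 H.
rewrite -lee_fin.
apply: (le_trans (@cross_contraction _ _ _ mu mu' a b E t K _ _ _ _ _ _ _ _ _ _ _)) => //.
have mf (f : T -> R) : measurable_fun setT f -> measurable_fun setT (fun z : T * T => f z.1).
  by move=> ?; exact: measurableT_comp.
have ms (f : T -> R) : measurable_fun setT f -> measurable_fun setT (fun z : T * T => f z.2).
  by move=> ?; exact: measurableT_comp.
have mi : measurable_fun setT (\1_E : T -> R) by exact: measurable_indic.
have mbb : measurable_fun setT (fun z : T * T => b z.1 * b z.2).
  by apply: measurable_funM; [exact: mf|exact: ms].
have i01 u v : 0 <= (\1_E u : R) * \1_E v <= 1.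
  by rewrite !indicE; do 2!case: (_ \in _); rewrite ?mulr1 ?mulr0 ?lexx ?ler01.
apply: (@le_trans _ _ (\int[(mu \x mu')%E]_z (c1 * (b z.1 * b z.2) + c0)%:E)%E).
  apply: ge0_le_integral => //.
  - move=> z _; rewrite lee_fin mulr_ge0// subr_ge0.
    have /andP[h1 h2] := i01 z.1 z.2.
    by rewrite mulr_ile1// ?exprn_ge0// exprn_ile1.
  - apply/measurable_EFinP; apply: measurable_funM.
      apply: measurableT_comp => //; apply: measurable_funB; apply: measurable_funM;
        by [exact: mf|exact: ms].
    apply: measurable_funB => //; apply: measurable_funM => //.
    by apply: measurable_funM; [exact: mf|exact: ms].
  - by apply/measurable_EFinP; apply: measurable_funD => //; exact: measurable_funM.
  - by move=> z _; rewrite lee_fin.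
have [BE /andP[B0 _]] := integral_bounded_fin _ _ _ mu b K mb b0 bK.
have [BE' /andP[B0' _]] := integral_bounded_fin _ _ _ mu' b K mb b0 bK.
under eq_integral do rewrite EFinD EFinM.
have mbbE : measurable_fun setT (fun z : T * T => (b z.1 * b z.2)%:E) by exact/measurable_EFinP.
have bb0 (z : T * T) : (0 <= (b z.1 * b z.2)%:E)%E by rewrite lee_fin mulr_ge0.
rewrite ge0_integralD//; try solve [exact: measurable_funeM | by move=> z _; rewrite -EFinM lee_fin !mulr_ge0 | by move=> z _; rewrite lee_fin].
rewrite ge0_integralZl//.
rewrite integral_cst// [X in (c0%:E * X)%E](_ : _ = 1%E); last first.
  transitivity (mu setT * mu' setT)%E; last by rewrite !probability_setT mule1.
  by rewrite -product_measure1E// setXTT.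
rewrite mule1 EFinD 2!EFinM -BE -BE'.
rewrite leeD2r// lee_wpmul2l ?lee_fin//.
rewrite fubini_tonelli1//=.
rewrite /fubini_F /=; under eq_integral => x _.
  under eq_integral do rewrite EFinM.
  rewrite ge0_integralZl//; first over.
  - exact/measurable_EFinP.
  - by move=> y _; rewrite lee_fin.
  - by rewrite lee_fin.
rewrite ge0_integralZr//.
- exact/measurable_EFinP.
- by move=> y _; rewrite lee_fin.
- by apply: integral_ge0 => y _; rewrite lee_fin.
Qed.

End step.

(** In both lemmas [gk] tells whether step k is good, [b] whether both points lie
    in the set at time k, and [G] counts the good steps after k. *)
Lemma exponent_inside (gk b : bool) (G s : nat) :
  (gk + G - ~~ b - s.*2 <= (gk && b) + (G - s.*2))%N.
Proof. by case: gk; case: b => /=; lia. Qed.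

Lemma exponent_outside (gk b : bool) (G s : nat) :
  (gk + G - ~~ b - s.+1.*2 <= G - 1 - s.*2)%N.
Proof. by case: gk; case: b => /=; lia. Qed.

Definition both_in T (C : nat -> set T) k x x' := (x \in C k) && (x' \in C k).

Section filter_bounds.
Context (R : realType) (N p : nat).
Local Notation X := 'rV[R]_N.
Local Notation Y := 'rV[R]_p.
Variables (Q : R.-pker X ~> X) (g : X -> Y -> R) (y : nat -> Y) (M : R).
Hypothesis mg : forall k, measurable_fun setT (fun x => g x (y k)).
Hypothesis g0 : forall x k, 0 <= g x (y k).
Hypothesis gM : forall x k, g x (y k) <= M.

Let M0 : 0 <= M. Proof. exact: le_trans (g0 0 0%N) (gM 0 0%N). Qed.

Local Notation F := (future_integral Q g y).

Lemma future_integral_bounds A n k : measurable A ->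
  [/\ measurable_fun setT (F A n k), forall x, (0 <= F A n k x)%E &
      forall x, (F A n k x <= (M ^+ n)%:E)%E].
Proof.
move=> mA; elim: n k => [|n IH] k /=.
  split.
  - by apply/measurable_EFinP; exact: measurable_indic.
  - by move=> x; rewrite lee_fin.
  - by move=> x; rewrite lee_fin indicE; case: (_ \in _).
have [mF F0 FM] := IH k.+1.
have mgF : measurable_fun setT (fun x => (g x (y k.+1))%:E * F A n k.+1 x)%E.
  by apply: emeasurable_funM => //; exact/measurable_EFinP.
have gF0 x : (0 <= (g x (y k.+1))%:E * F A n k.+1 x)%E.
  by rewrite mule_ge0// lee_fin.
split.
- by apply: (measurable_fun_integral_kernel (measurable_kernel Q)).
- by move=> x; apply: integral_ge0.
- move=> x; apply: (@le_trans _ _ (\int[Q x]_x' (cst (M ^+ n.+1)%:E x'))%E).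
    apply: ge0_le_integral => //.
    by move=> x' _; rewrite exprS EFinM lee_pmul// lee_fin.
  by rewrite integral_cst//= prob_kernel mule1.
Qed.

Definition future_value A n k x : R := fine (F A n k x).

Lemma future_valueE A n k x : measurable A -> F A n k x = (future_value A n k x)%:E.
Proof.
move=> mA; have [_ F0 FM] := future_integral_bounds A n k mA.
by rewrite fineK// ge0_fin_numE// (le_lt_trans (FM x)) ?ltry.
Qed.

Lemma future_value_bounds A n k : measurable A ->
  [/\ measurable_fun setT (future_value A n k), forall x, 0 <= future_value A n k x &
      forall x, future_value A n k x <= M ^+ n].
Proof.
move=> mA; have [mF F0 FM] := future_integral_bounds A n k mA; split.
- by apply: measurableT_comp => //.
- by move=> x; rewrite -lee_fin -future_valueE.
- by move=> x; rewrite -lee_fin -future_valueE.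
Qed.

Lemma future_valueS A n k x : measurable A ->
  future_value A n.+1 k x = fine (\int[Q x]_x' (g x' (y k.+1) * future_value A n k.+1 x')%:E)%E.
Proof.
move=> mA; rewrite /future_value /=; congr fine; apply: eq_integral => x' _.
by rewrite future_valueE// EFinM.
Qed.

Variables (C : nat -> set X) (good : pred nat) (t r : R).
Hypothesis mC : forall k, measurable (C k).
Hypotheses (t0 : 0 <= t) (t1 : t <= 1) (r0 : 0 <= r) (r1 : r <= 1).
Hypothesis out : forall k x, ~ C k x -> g x (y k) <= r * M.
Hypothesis minor : forall k x x', good k -> C k x -> C k x' ->
  forall A, measurable A -> (t%:E * Q x' (A `&` C k.+1) <= Q x (A `&` C k.+1))%E.

Local Notation rho := (1 - t ^+ 2).
Local Notation G n k := (count good (iota k n)).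
Local Notation both := (both_in _ C).

(** Induction on the number of steps.  A good step between pairs of points in
    the sets [C] gains a factor rho.  A pair that is not in [C] spoils at most
    the steps before and after it, which costs two powers of rho, but its
    likelihood carries the factor r.  With s such exits accepted, the contribution of
    the pairs with fewer exits is at most rho^(G - 2 s), and that of the
    others is at most r^s. *)
Lemma pair_contraction A n k s x x' : measurable A ->
  `|future_value A n k x * future_value setT n k x'
    - future_value A n k x' * future_value setT n k x|
  <= rho ^+ (G n k - ~~ both k x x' - s.*2)
       * (future_value setT n k x * future_value setT n k x')
     + (M ^+ 2) ^+ n * r ^+ s.
Proof.
move=> mA.
have rho0 : 0 <= rho by rewrite subr_ge0 exprn_ile1.
have rho1 : rho <= 1 by rewrite gerBl exprn_ge0.
have ile e e' : (e' <= e)%N -> rho ^+ e <= rho ^+ e' by exact: ler_wiXn2l.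
have M20 : 0 <= M ^+ 2 by rewrite exprn_ge0.
elim: n k s x x' => [|n IH] k s x x'.
  rewrite /future_value /= !indicE !in_setT /= !mulr1 !sub0n expr0 mul1r.
  have : 0 <= r ^+ s by rewrite exprn_ge0.
  by do 2!case: (_ \in _); rewrite ?subrr ?subr0 ?sub0r ?normrN ?normr1 ?normr0; lra.
have [mF F0 FM] := future_value_bounds A n k.+1 mA.
have [mT T0 TM] := future_value_bounds setT n k.+1 measurableT.
pose a u := g u (y k.+1) * future_value A n k.+1 u.
pose b u := g u (y k.+1) * future_value setT n k.+1 u.
pose coupled := good k && both k x x'.
(* outside the good situation the step is carried out with ratio 0 *)
pose tau := if coupled then t else 0.
pose e := (G n.+1 k - ~~ both k x x' - s.*2)%N.
have tau0 : 0 <= tau by rewrite /tau; case: ifP.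
have tau1 : tau <= 1 by rewrite /tau; case: ifP.
have minor2 z z' : both k x x' = both k z z' ->
    forall B, measurable B -> (tau%:E * Q z' (B `&` C k.+1) <= Q z (B `&` C k.+1))%E.
  move=> zz' B mB; rewrite /tau; case: ifP => [|_]; last by rewrite mul0e.
  by rewrite /coupled zz' => /and3P[gk]; rewrite !inE => ? ?; exact: minor.
have bothC z z' : both k z z' = both k z' z by rewrite /both_in andbC.
have gM2 u v : 0 <= g u (y k.+1) * g v (y k.+1) <= M ^+ 2.
  by rewrite mulr_ge0//= expr2 ler_pM.
rewrite !future_valueS//.
apply: (@cross_step _ _ _ (prob_of _ _ _ _ (prob_kernel x)) (prob_of _ _ _ _ (prob_kernel x'))
  a b (C k.+1) tau (M ^+ n.+1)) => //.
- exact: measurable_funM.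
- exact: measurable_funM.
- by move=> u; rewrite mulr_ge0.
- by move=> u; rewrite mulr_ge0.
- by move=> u; rewrite exprS ler_pM.
- by move=> u; rewrite exprS ler_pM.
- exact: minor2.
- by apply: minor2; exact: bothC.
- by rewrite exprn_ge0.
- by rewrite mulr_ge0// exprn_ge0.
move=> u v; rewrite -/e.
have -> : a u * b v - a v * b u = (g u (y k.+1) * g v (y k.+1)) *
   (future_value A n k.+1 u * future_value setT n k.+1 v -
    future_value A n k.+1 v * future_value setT n k.+1 u) by rewrite /a /b; ring.
have -> : b u * b v = (g u (y k.+1) * g v (y k.+1)) *
   (future_value setT n k.+1 u * future_value setT n k.+1 v) by rewrite /b; ring.
have TT0 : 0 <= future_value setT n k.+1 u * future_value setT n k.+1 v by rewrite mulr_ge0.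
move: (gM2 u v) => /andP[gg0 ggM].
rewrite normrM (ger0_norm gg0).
set gg := g u _ * _ in gg0 ggM *.
set TT := future_value setT n k.+1 u * _ in TT0 *.
set D := `|_|.
have D0 : 0 <= D by exact: normr_ge0.
have rs0 i : 0 <= r ^+ i by rewrite exprn_ge0.
have Mn0 i : 0 <= (M ^+ 2) ^+ i by rewrite exprn_ge0.
have GS : G n.+1 k = (good k + G n k.+1)%N by [].
have [uv|uv] := boolP (both k.+1 u v).
  move: (uv); rewrite /both_in => /andP[uC vC].
  have -> : \1_(C k.+1) u * \1_(C k.+1) v = 1 :> R by rewrite !indicE uC vC mulr1.
  rewrite mulr1.
  have := IH k.+1 s u v; rewrite -/D -/TT uv subn0 => IHuv.
  have w0 : 0 <= 1 - tau ^+ 2 by rewrite subr_ge0 exprn_ile1.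
  have w1 : 1 - tau ^+ 2 <= 1 by rewrite gerBl exprn_ge0.
  have key : (1 - tau ^+ 2) * rho ^+ (G n k.+1 - s.*2) <= rho ^+ e.
    have -> : 1 - tau ^+ 2 = rho ^+ coupled.
      by rewrite /tau; case: ifP => _; rewrite ?expr0 ?expr1// expr0n subr0.
    by rewrite -exprD; apply: ile; rewrite /e GS; exact: exponent_inside.
  apply: (@le_trans _ _ (gg * (rho ^+ (G n k.+1 - s.*2) * TT + (M ^+ 2) ^+ n * r ^+ s) * (1 - tau ^+ 2))).
    by rewrite ler_wpM2r// ler_wpM2l.
  have -> : gg * (rho ^+ (G n k.+1 - s.*2) * TT + (M ^+ 2) ^+ n * r ^+ s) * (1 - tau ^+ 2) =
    ((1 - tau ^+ 2) * rho ^+ (G n k.+1 - s.*2)) * (gg * TT) +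
     (1 - tau ^+ 2) * gg * ((M ^+ 2) ^+ n * r ^+ s) by ring.
  apply: lerD; first by rewrite ler_wpM2r// mulr_ge0.
  have -> : (M ^+ 2) ^+ n.+1 * r ^+ s = M ^+ 2 * ((M ^+ 2) ^+ n * r ^+ s).
    by rewrite [_ ^+ n.+1]exprS mulrA.
  rewrite ler_wpM2r ?mulr_ge0//.
  by rewrite -[leRHS]mul1r ler_pM.
have in0 : \1_(C k.+1) u * \1_(C k.+1) v = 0 :> R.
  move: uv; rewrite /both_in !indicE negb_and.
  by case: (u \in _); case: (v \in _) => //=; rewrite ?mulr0 ?mul0r.
rewrite in0 mulr0 subr0 mulr1.
(* an exit: r pays for one of the accepted exits, if any is left *)
case: s @e => [|s] e.
  rewrite expr0 mulr1.
  apply: (@le_trans _ _ ((M ^+ 2) ^+ n.+1)); last first.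
    by rewrite lerDr !mulr_ge0// exprn_ge0.
  rewrite exprS ler_pM// /D.
  have FT a1 b1 : 0 <= future_value A n k.+1 a1 * future_value setT n k.+1 b1 <= (M ^+ 2) ^+ n.
    rewrite mulr_ge0//= -exprM mulnC exprM expr2 ler_pM//.
  rewrite ler_norml; have /andP[] := FT u v; have /andP[] := FT v u; lra.
have := IH k.+1 s u v; rewrite -/D -/TT uv => IHuv.
have ggr : gg <= r * M ^+ 2.
  move: uv; rewrite /both_in negb_and => /orP[]; rewrite notin_setE => /out h.
    by rewrite expr2 mulrA ler_pM.
  by rewrite expr2 mulrCA ler_pM.
apply: (@le_trans _ _ (gg * (rho ^+ (G n k.+1 - ~~ false - s.*2) * TT + (M ^+ 2) ^+ n * r ^+ s))).
  by rewrite ler_wpM2l.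
rewrite mulrDr; apply: lerD.
  rewrite mulrCA ler_wpM2r ?mulr_ge0//; apply: ile.
  by rewrite /e GS; exact: exponent_outside.
have -> : (M ^+ 2) ^+ n.+1 * r ^+ s.+1 = (r * M ^+ 2) * ((M ^+ 2) ^+ n * r ^+ s).
  by rewrite !exprS; ring.
by rewrite ler_wpM2r// mulr_ge0.
Qed.

End filter_bounds.

(** * Distance between filters and normalising constants *)

Section total_variation.
Context d (T : measurableType d) (R : realType) (xi : set T -> R).
Hypothesis xi0 : xi set0 = 0.
Hypothesis xiU : forall A B, measurable A -> measurable B -> A `&` B = set0 ->
  xi (A `|` B) = xi A + xi B.

Lemma additive_bigsetU n (F : 'I_n -> set T) (P : pred 'I_n) :
  (forall i, measurable (F i)) -> trivIset setT F ->
  xi (\big[setU/set0]_(i < n | P i) F i) = \sum_(i < n | P i) xi (F i).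
Proof.
move=> mF tF; rewrite -!(big_filter (index_enum _)).
have := filter_uniq (fun i => P i) (index_enum_uniq 'I_n).
elim: [seq i <- _ | P i] => [|i s IH]; first by rewrite !big_nil.
rewrite cons_uniq => /andP[iNs us]; rewrite !big_cons xiU//; last 2 first.
- exact: bigsetU_measurable.
- rewrite big_distrr /= big1_seq// => j /= js.
  have ij : i != j by apply: contraNneq iNs => ->.
  by move/trivIsetP : tF => /(_ i j Logic.I Logic.I ij).
by rewrite IH.
Qed.

(** The blocks of a partition on which xi is nonnegative have a union A with
    xi A at most B, and likewise for the others. *)
Lemma tv_norm_le B : (forall A, measurable A -> `|xi A| <= B) ->
  (tv_norm xi <= (2 * B)%:E)%E.
Proof.
move=> xiB; apply: ge_ereal_sup => _ [n [F [mF tF _ ->]]].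
rewrite lee_fin (bigID (fun i => 0 <= xi (F i)))/=.
rewrite (eq_bigr (fun i => xi (F i))); last by move=> i /ger0_norm.
rewrite [X in _ + X](eq_bigr (fun i => - xi (F i))); last first.
  by move=> i; rewrite -ltNge => /ltW/ler0_norm.
rewrite sumrN -!additive_bigsetU// mulr_natl mulr2n lerD//.
- by apply: le_trans (xiB _ _); [exact: ler_norm|exact: bigsetU_measurable].
- by apply: le_trans (xiB _ _); [rewrite -normrN; exact: ler_norm|exact: bigsetU_measurable].
Qed.

End total_variation.

Section filter_distance.
Context (R : realType) (N p : nat).
Local Notation X := 'rV[R]_N.
Local Notation Y := 'rV[R]_p.
Variables (Q : R.-pker X ~> X) (g : X -> Y -> R) (y : nat -> Y) (M : R).
Hypothesis mg : forall k, measurable_fun setT (fun x => g x (y k)).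
Hypothesis g0 : forall x k, 0 <= g x (y k).
Hypothesis gM : forall x k, g x (y k) <= M.

Let M0 : 0 <= M. Proof. exact: le_trans (g0 0 0%N) (gM 0 0%N). Qed.

Local Notation F := (future_value _ _ _ Q g y).

Lemma future_valueU A B n k x : measurable A -> measurable B -> A `&` B = set0 ->
  F (A `|` B) n k x = F A n k x + F B n k x.
Proof.
move=> mA mB AB; elim: n k x => [|n IH] k x.
  rewrite /future_value /= indicE in_setU !indicE.
  have [xA|] := boolP (x \in A); have [xB|] := boolP (x \in B) => //=;
    rewrite ?addr0 ?add0r//.
  by rewrite !inE in xA xB; have : (A `&` B) x by []; rewrite AB.
have mAB : measurable (A `|` B) by exact: measurableU.
rewrite !(future_valueS _ _ _ Q g y M mg g0 gM)//.
have [mFA FA0 FAM] := future_value_bounds _ _ _ Q g y M mg g0 gM A n k.+1 mA.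
have [mFB FB0 FBM] := future_value_bounds _ _ _ Q g y M mg g0 gM B n k.+1 mB.
have bnd (H : X -> R) :  measurable_fun setT H -> (forall x, 0 <= H x) ->
    (forall x, H x <= M ^+ n) ->
    (\int[Q x]_u (g u (y k.+1) * H u)%:E)%E \is a fin_num.
  move=> mH H0 HM.
  have gHM u : g u (y k.+1) * H u <= M ^+ n.+1 by rewrite exprS ler_pM.
  have gH0 u : 0 <= g u (y k.+1) * H u by rewrite mulr_ge0.
  have mgH : measurable_fun setT (fun u => g u (y k.+1) * H u) by exact: measurable_funM.
  by have [-> _] := @integral_bounded_fin _ _ _ (prob_of _ _ _ (Q x) (prob_kernel x)) (fun u => g u (y k.+1) * H u) (M ^+ n.+1) mgH gH0 gHM.
rewrite -fineD ?bnd//; congr fine.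
rewrite -ge0_integralD//; try solve [by move=> z _; rewrite lee_fin mulr_ge0
  | by apply/measurable_EFinP; apply: measurable_funM].
by apply: eq_integral => u _; rewrite IH mulrDr EFinD.
Qed.

Definition filter_mass (nu : probability X R) n A : R :=
  fine (unnormalized_filter nu Q g y n A).

Lemma filter_massE nu n A : measurable A ->
  filter_mass nu n A = fine (\int[nu]_x (g x (y 0%N) * F A n 0 x)%:E)%E.
Proof.
move=> mA; rewrite /filter_mass /unnormalized_filter; congr fine.
apply: eq_integral => x _; rewrite EFinM.
by rewrite (future_valueE _ _ _ Q g y M mg g0 gM).
Qed.

Lemma start_bounds n A : measurable A ->
  [/\ measurable_fun setT (fun x => g x (y 0%N) * F A n 0 x),
      forall x, 0 <= g x (y 0%N) * F A n 0 x &
      forall x, g x (y 0%N) * F A n 0 x <= M ^+ n.+1].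
Proof.
move=> mA; have [mF F0 FM] := future_value_bounds _ _ _ Q g y M mg g0 gM A n 0 mA.
split; [exact: measurable_funM|by move=> x; rewrite mulr_ge0|].
by move=> x; rewrite exprS ler_pM.
Qed.

Lemma filter_mass_fin nu n A : measurable A ->
  unnormalized_filter nu Q g y n A = (filter_mass nu n A)%:E /\ 0 <= filter_mass nu n A.
Proof.
move=> mA; have [mF F0 FM] := start_bounds n A mA.
have [h1 /andP[h2 _]] := @integral_bounded_fin _ _ _ nu _ _ mF F0 FM.
rewrite filter_massE// -h1; split=> //.
apply: eq_integral => x _; rewrite EFinM.
by rewrite (future_valueE _ _ _ Q g y M mg g0 gM).
Qed.

Lemma filter_massU nu n A B : measurable A -> measurable B -> A `&` B = set0 ->
  filter_mass nu n (A `|` B) = filter_mass nu n A + filter_mass nu n B.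
Proof.
move=> mA mB AB; rewrite !filter_massE//; last exact: measurableU.
have [mFA FA0 FAM] := start_bounds n A mA.
have [mFB FB0 FBM] := start_bounds n B mB.
rewrite -fineD; last 2 first.
- by have [-> _] := @integral_bounded_fin _ _ _ nu _ _ mFA FA0 FAM.
- by have [-> _] := @integral_bounded_fin _ _ _ nu _ _ mFB FB0 FBM.
congr fine.
rewrite -ge0_integralD//; try solve [by move=> z _; rewrite lee_fin
  | by apply/measurable_EFinP].
by apply: eq_integral => u _; rewrite future_valueU// mulrDr EFinD.
Qed.

Lemma filter_mass_subset nu n A : measurable A ->
  filter_mass nu n A <= filter_mass nu n setT.
Proof.
move=> mA; have mC := measurableC mA.
rewrite -[X in _ <= filter_mass nu n X](setUCr A) filter_massU ?setICr// lerDl.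
by have [] := filter_mass_fin nu n (~` A) mC.
Qed.

Lemma filter_law01 nu n A : measurable A -> 0 <= filter_law nu Q g y n A <= 1.
Proof.
move=> mA; rewrite /filter_law -/(filter_mass nu n A) -/(filter_mass nu n setT).
have [_ A0] := filter_mass_fin nu n A mA.
have [_ T0] := filter_mass_fin nu n setT measurableT.
rewrite divr_ge0//=.
have [->|TN0] := eqVneq (filter_mass nu n setT) 0; first by rewrite invr0 mulr0 ler01.
by rewrite ler_pdivrMr ?mul1r ?filter_mass_subset// lt_neqAle eq_sym TN0.
Qed.

Lemma filter_lawU nu n A B : measurable A -> measurable B -> A `&` B = set0 ->
  filter_law nu Q g y n (A `|` B) = filter_law nu Q g y n A + filter_law nu Q g y n B.
Proof.
move=> mA mB AB; rewrite /filter_law -mulrDl.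
by congr (_ / _); exact: filter_massU.
Qed.

Lemma tv_filter_le nu nu' n b :
  (forall A, measurable A -> `|filter_law nu Q g y n A - filter_law nu' Q g y n A| <= b) ->
  (tv_norm (fun A => (filter_law nu Q g y n A - filter_law nu' Q g y n A)%R)
     <= (2 * b)%:E)%E.
Proof.
move=> H; apply: tv_norm_le => //.
  have E (m : probability X R) : filter_law m Q g y n set0 = 0.
    have := filter_lawU m n set0 set0 measurable0 measurable0 (set0I _).
    by rewrite set0U => /eqP; rewrite -subr_eq subrr eq_sym => /eqP.
  by rewrite !E subrr.
by move=> A B mA mB AB; rewrite !filter_lawU//; ring.
Qed.

Lemma tv_filter_le2 nu nu' n :
  (tv_norm (fun A => (filter_law nu Q g y n A - filter_law nu' Q g y n A)%R)
     <= (2 * 1)%:E)%E.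
Proof.
apply: tv_filter_le => A mA.
have /andP[a0 a1] := filter_law01 nu n A mA.
have /andP[b0 b1] := filter_law01 nu' n A mA.
by rewrite ler_norml; apply/andP; split; lra.
Qed.

Variables (C : nat -> set X) (good : pred nat) (t r : R).
Hypothesis mC : forall k, measurable (C k).
Hypotheses (t0 : 0 <= t) (t1 : t <= 1) (r0 : 0 <= r) (r1 : r <= 1).
Hypothesis out : forall k x, ~ C k x -> g x (y k) <= r * M.
Hypothesis minor : forall k x x', good k -> C k x -> C k x' ->
  forall A, measurable A -> (t%:E * Q x' (A `&` C k.+1) <= Q x (A `&` C k.+1))%E.

(** The initial distributions are arbitrary, so the initial integration brings
    no gain (ratio 0) and the starting pair may lie outside [C 0], which costs
    one power of rho. *)
Lemma filter_distance nu nu' n s A : measurable A ->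
  0 < filter_mass nu n setT -> 0 < filter_mass nu' n setT ->
  `|filter_law nu Q g y n A - filter_law nu' Q g y n A|
  <= (1 - t ^+ 2) ^+ (count good (iota 0 n) - 1 - s.*2)
     + (M ^+ 2) ^+ n.+1 * r ^+ s / (filter_mass nu n setT * filter_mass nu' n setT).
Proof.
move=> mA Z0 Z0'.
set rho := 1 - t ^+ 2; set G := count good (iota 0 n).
have rho0 : 0 <= rho by rewrite subr_ge0 exprn_ile1.
have rho1 : rho <= 1 by rewrite gerBl exprn_ge0.
have [mFA FA0 FAM] := start_bounds n A mA.
have [mFT FT0 FTM] := start_bounds n setT measurableT.
have cross : `| filter_mass nu n A * filter_mass nu' n setT -
     filter_mass nu' n A * filter_mass nu n setT | <=
   rho ^+ (G - 1 - s.*2) * (filter_mass nu n setT * filter_mass nu' n setT)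
   + (M ^+ 2) ^+ n.+1 * r ^+ s.
  rewrite !filter_massE//.
  apply: (@cross_step _ _ _ nu nu' _ _ setT 0 (M ^+ n.+1)) => //.
  - by move=> B mB; rewrite mul0e.
  - by move=> B mB; rewrite mul0e.
  - exact: exprn_ge0.
  - by rewrite mulr_ge0// !exprn_ge0.
  move=> u v; rewrite expr0n mul0r subr0 mulr1.
  have H := pair_contraction _ _ _ Q g y M mg g0 gM C good t r mC t0 t1 r0 out minor A n 0 s u v mA.
  have gg : 0 <= g u (y 0%N) * g v (y 0%N) <= M ^+ 2.
    by rewrite mulr_ge0//= expr2 ler_pM.
  have [_ T0 _] := future_value_bounds _ _ _ Q g y M mg g0 gM setT n 0 measurableT.
  rewrite (_ : _ - _ = (g u (y 0%N) * g v (y 0%N)) *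
    (F A n 0 u * F setT n 0 v - F A n 0 v * F setT n 0 u)); last by ring.
  move/andP: gg => [gg0 ggM].
  rewrite normrM (ger0_norm gg0).
  apply: le_trans (ler_wpM2l gg0 H) _.
  rewrite mulrDr; apply: lerD.
    rewrite (_ : g u (y 0%N) * F setT n 0 u * _ =
      (g u (y 0%N) * g v (y 0%N)) * (F setT n 0 u * F setT n 0 v)); last by ring.
    rewrite mulrCA ler_wpM2r ?mulr_ge0//; apply: ler_wiXn2l => //.
    by rewrite leq_sub2r// leq_sub2l//; case: both_in.
  by rewrite [_ ^+ n.+1]exprS -mulrA ler_wpM2r// mulr_ge0 ?exprn_ge0// exprn_ge0.
rewrite /filter_law -!/(filter_mass _ _ _).
have ZZ : 0 < filter_mass nu n setT * filter_mass nu' n setT by rewrite mulr_gt0.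
rewrite -(ler_pM2r ZZ) [leRHS]mulrDl mulfVK ?gt_eqF//.
apply: le_trans cross.
rewrite -[X in _ * X <= _](gtr0_norm ZZ) -normrM le_eqVlt; apply/orP; left; apply/eqP; congr (`|_|).
by field; rewrite !gt_eqF.
Qed.

Variables (B : nat -> set X) (beta : nat -> R) (gam : R).
Hypothesis mB : forall k, measurable (B k).
Hypothesis beta0 : forall k, 0 <= beta k.
Hypothesis gam0 : 0 <= gam.
Hypothesis g_low : forall k x, B k x -> gam <= g x (y k).

(** Only the paths that stay in the sets [B] are kept. *)
Lemma future_integral_lower n k x : 
  (forall j x, (k <= j)%N -> B j x -> ((beta j)%:E <= Q x (B j.+1))%E) -> B k x ->
  ((\prod_(j <- iota k n) (beta j * gam))%:E <= future_integral Q g y setT n k x)%E.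
Proof.
elim: n k x => [|n IH] k x Qlow Bx.
  by rewrite big_nil /= indicE in_setT.
have [mF F0 FM] := future_integral_bounds _ _ _ Q g y M mg g0 gM setT n k.+1 measurableT.
have mgF : measurable_fun setT (fun x => (g x (y k.+1))%:E * future_integral Q g y setT n k.+1 x)%E.
  by apply: emeasurable_funM => //; exact/measurable_EFinP.
have gF0 u : (0 <= (g u (y k.+1))%:E * future_integral Q g y setT n k.+1 u)%E.
  by rewrite mule_ge0// lee_fin.
rewrite /= big_cons.
set P := \prod_(j <- _) _.
have P0 : 0 <= P by apply: prodr_ge0 => j _; rewrite mulr_ge0.
apply: (@le_trans _ _ (\int[Q x]_(u in B k.+1) (cst (gam * P)%:E u))%E).
  rewrite integral_cst// -mulrA mulrC EFinM lee_wpmul2l ?lee_fin ?mulr_ge0//.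
  exact: Qlow.
apply: (@le_trans _ _ (\int[Q x]_(u in B k.+1) ((g u (y k.+1))%:E * future_integral Q g y setT n k.+1 u))%E).
  apply: ge0_le_integral => //.
  - by move=> u _; rewrite lee_fin mulr_ge0.
  - exact: measurable_funTS.
  - move=> u Bu; rewrite EFinM lee_pmul ?lee_fin//; first exact: g_low.
    by apply: IH => // j z kj; apply: Qlow; exact: ltnW.
by apply: ge0_subset_integral.
Qed.

(** The first transition is left as [one_step], since nu may put little mass on
    [B 0]. *)
Lemma filter_mass_lower nu n :
  (forall j x, (1 <= j)%N -> B j x -> ((beta j)%:E <= Q x (B j.+1))%E) ->
  ((gam * \prod_(j <- iota 1 n) (beta j * gam))%:E * one_step nu Q g (y 0%N) (B 1%N)
   <= (filter_mass nu n.+1 setT)%:E)%E.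
Proof.
move=> Qlow.
have [<- _] := filter_mass_fin nu n.+1 setT measurableT.
have [mF F0 FM] := future_integral_bounds _ _ _ Q g y M mg g0 gM setT n.+1 0 measurableT.
set P := gam * _.
have P0 : 0 <= P by rewrite mulr_ge0// prodr_ge0// => j _; rewrite mulr_ge0.
have mQ : measurable_fun setT (fun x => (g x (y 0%N))%:E * Q x (B 1%N))%E.
  apply: emeasurable_funM; [exact/measurable_EFinP|].
  exact: (measurable_kernel Q).
have gQ0 x : (0 <= (g x (y 0%N))%:E * Q x (B 1%N))%E by rewrite mule_ge0// lee_fin.
rewrite /one_step -ge0_integralZl//.
apply: ge0_le_integral => //.
- by move=> x _; rewrite mule_ge0// lee_fin.
- exact: measurable_funeM.
- by apply: emeasurable_funM => //; exact/measurable_EFinP.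
move=> x _; rewrite muleCA lee_wpmul2l ?lee_fin//=.
have [mF1 F10 F1M] := future_integral_bounds _ _ _ Q g y M mg g0 gM setT n 1 measurableT.
apply: (@le_trans _ _ (\int[Q x]_(u in B 1%N) (cst P%:E u))%E).
  by rewrite integral_cst.
have mgF : measurable_fun setT (fun x => (g x (y 1%N))%:E * future_integral Q g y setT n 1 x)%E.
  by apply: emeasurable_funM => //; exact/measurable_EFinP.
apply: (@le_trans _ _ (\int[Q x]_(u in B 1%N) ((g u (y 1%N))%:E * future_integral Q g y setT n 1 u))%E).
  apply: ge0_le_integral => //.
  - exact: measurable_funTS.
  - move=> u Bu; rewrite EFinM lee_pmul ?lee_fin//.
    + by rewrite prodr_ge0// => j _; rewrite mulr_ge0.
    + exact: g_low.
    + exact: future_integral_lower.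
by apply: ge0_subset_integral => // u _; rewrite mule_ge0// lee_fin.
Qed.

End filter_distance.

(** * Expectations of products of independent variables *)

Section independence.
Context d (T : measurableType d) (R : realType) (P : probability T R).
Context d1 (T1 : measurableType d1).

Section weighted.
Variables (S : T -> R) (V : T -> T1).
Hypothesis mS : measurable_fun setT S.
Hypothesis S0 : forall w, 0 <= S w.
Hypothesis mV : measurable_fun setT V.

Let mpre B : measurable B -> measurable (V @^-1` B).
Proof. by move=> mB; rewrite -[X in measurable X]setTI; exact: mV. Qed.

(** The law of V under the density S.  The proofs are arguments so that a
    measure structure can be attached to it. *)
Definition weighted_law of measurable_fun setT S & (forall w, 0 <= S w)
   & measurable_fun setT V : set T1 -> \bar R :=
  fun B => (\int[P]_(w in V @^-1` B) (S w)%:E)%E.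

Let mu := weighted_law mS S0 mV.

Let mu0 : mu set0 = 0%E.
Proof. by rewrite /mu /weighted_law preimage_set0 integral_set0. Qed.

Let mu_ge0 B : (0 <= mu B)%E.
Proof. by apply: integral_ge0 => w _; rewrite lee_fin. Qed.

Let mu_sigma : semi_sigma_additive mu.
Proof.
move=> F mF tF mUF; rewrite /mu /weighted_law preimage_bigcup; apply: cvg_toP.
  apply: ereal_nondecreasing_is_cvgn => m n mn.
  by apply: lee_sum_nneg_natr => // k _ _; exact: mu_ge0.
rewrite ge0_integral_bigcup//=.
- by move=> k; exact: mpre.
- apply: measurable_funTS; exact/measurable_EFinP.
- by move=> w _; rewrite lee_fin.
- move=> i j _ _ [w [Fi Fj]]; apply: tF => //; exists (V w).
  by split.
Qed.

HB.instance Definition _ := isMeasure.Build _ _ _ (weighted_law mS S0 mV) mu0 mu_ge0 mu_sigma.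

End weighted.

Import HBNNSimple.

(** An equality of measures, between the law of V under S and c times the law of
    W, passes from sets to simple functions and then to nonnegative functions by
    monotone convergence. *)
Lemma integral_of_law (S : T -> R) (V W : T -> T1) (c : R) (phi : T1 -> R) :
  measurable_fun setT S -> (forall w, 0 <= S w) -> 0 <= c ->
  measurable_fun setT V -> measurable_fun setT W ->
  measurable_fun setT phi -> (forall v, 0 <= phi v) ->
  (forall B, measurable B -> (\int[P]_(w in V @^-1` B) (S w)%:E = c%:E * P (W @^-1` B))%E) ->
  (\int[P]_w (phi (V w) * S w)%:E = c%:E * \int[P]_w (phi (W w))%:E)%E.
Proof.
move=> mS S0 c0 mV mW mphi phi0 H.
have mphiE : measurable_fun setT (EFin \o phi) by exact/measurable_EFinP.
pose f_ := nnsfun_approx measurableT mphiE.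
have mpre (U : T -> T1) B : measurable_fun setT U -> measurable B -> measurable (U @^-1` B).
  by move=> mU mB; rewrite -[X in measurable X]setTI; exact: mU.
have f_cvg v : EFin \o f_ ^~ v @ \oo --> (phi v)%:E.
  by apply: (@cvg_nnsfun_approx _ _ _ _ measurableT _ mphiE) => // x _; rewrite lee_fin.
have f_nd v : nondecreasing_seq (f_ ^~ v).
  by move=> m n mn; exact/lefP/nd_nnsfun_approx.
have mfV n (U : T -> T1) : measurable_fun setT U -> measurable_fun setT (fun w => f_ n (U w)).
  by move=> mU; apply: (measurableT_comp (f := f_ n)).
have simple (h : {nnsfun T1 >-> R}) :
  (\int[P]_w (h (V w) * S w)%:E = c%:E * \int[P]_w (h (W w))%:E)%E.
  have mh1 r (U : T -> T1) : measurable_fun setT U ->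
      measurable_fun setT (fun w => \1_(h @^-1` [set r]) (U w) : R).
    by move=> mU; apply: (measurableT_comp (f := \1_(h @^-1` [set r]) : T1 -> R)).
  transitivity (\sum_(r \in range h) (r%:E * \int[P]_w (\1_(h @^-1` [set r]) (V w) * S w)%:E))%E.
    rewrite -[RHS]/(\sum_(r \in range h) _)%E.
    transitivity (\int[P]_w \sum_(r \in range h) (r * (\1_(h @^-1` [set r]) (V w) * S w))%:E)%E.
      apply: eq_integral => w _; rewrite [h (V w)]fimfunE fsumEFin//.
      congr EFin; rewrite (fsbig_finite _ _ (fimfunP h))/= (fsbig_finite _ _ (fimfunP h))/=.
      by rewrite mulr_suml; apply: eq_bigr => r _; rewrite mulrA.
    rewrite ge0_integral_fsum//; last 2 first.
    - move=> r; apply/measurable_EFinP; apply: measurable_funM => //.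
      by apply: measurable_funM => //; exact: mh1.
    - move=> r w _; rewrite mulrA lee_fin mulr_ge0//.
      by rewrite -lee_fin EFinM; exact: nnfun_muleindic_ge0.
    apply: eq_fsbigr => r /[!inE] -[x _ <-].
    under eq_integral do rewrite EFinM.
    rewrite ge0_integralZl//.
    - by apply/measurable_EFinP; apply: measurable_funM => //; exact: mh1.
    - by move=> w _; rewrite lee_fin mulr_ge0.
    - by rewrite lee_fin.
  transitivity (\sum_(r \in range h) (r%:E * (c%:E * P (W @^-1` (h @^-1` [set r])))))%E.
    apply: eq_fsbigr => r _; congr (_ * _)%E; rewrite -H//.
    rewrite [RHS]integral_mkcond; apply: eq_integral => w _.
    rewrite patchE (_ : (w \in _) = (V w \in h @^-1` [set r])); last first.
      by apply/idP/idP; rewrite !inE.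
    by rewrite indicE; case: (_ \in _); rewrite ?mul1r ?mul0r.
  rewrite (eq_fsbigr (fun r => c%:E * (r%:E * P (W @^-1` (h @^-1` [set r])))))%E; last first.
    by move=> r _; rewrite muleCA.
  have pushE : (\int[P]_w (h (W w))%:E = \sum_(r \in range h) (r%:E * P (W @^-1` (h @^-1` [set r]))))%E.
    transitivity (\int[P]_w \sum_(r \in range h) (r * \1_(h @^-1` [set r]) (W w))%:E)%E.
      by apply: eq_integral => w _; rewrite [h (W w)]fimfunE fsumEFin.
    rewrite ge0_integral_fsum//; last 2 first.
    - by move=> r; apply/measurable_EFinP; apply: measurable_funM => //; exact: mh1.
    - by move=> r w _; rewrite EFinM; exact: nnfun_muleindic_ge0.
    apply: eq_fsbigr => r /[!inE] -[x _ <-].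
    under eq_integral do rewrite EFinM.
    rewrite ge0_integralZl ?lee_fin//.
    - congr (_ * _)%E; rewrite -[in RHS](setIT (W @^-1` _)) -integral_indic//.
      exact: mpre.
    - by apply/measurable_EFinP; exact: mh1.
  rewrite pushE ge0_mule_fsumr//.
  by move=> r; case: (ltP r 0) => r0; [rewrite preimage_nnfun0// preimage_set0 measure0 mule0 | rewrite mule_ge0].
transitivity (limn (fun n => \int[P]_w (f_ n (V w) * S w)%:E)%E).
  rewrite -monotone_convergence//.
  - apply: eq_integral => w _; apply/esym/cvg_lim => //.
    under eq_fun do rewrite EFinM.
    by rewrite EFinM; apply: cvgeZr => //; exact: f_cvg.
  - by move=> n; apply/measurable_EFinP; apply: measurable_funM => //; exact: mfV.
  - by move=> n w _; rewrite lee_fin mulr_ge0.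
  - by move=> w _ m n mn; rewrite lee_fin ler_wpM2r//; exact: f_nd.
under eq_fun do rewrite simple.
have -> : (\int[P]_w (phi (W w))%:E = limn (fun n => \int[P]_w (f_ n (W w))%:E))%E.
  rewrite -monotone_convergence//.
  - by apply: eq_integral => w _; apply/esym/cvg_lim => //; exact: f_cvg.
  - by move=> n; apply/measurable_EFinP; exact: mfV.
  - by move=> n w _; rewrite lee_fin.
  - by move=> w _ m n mn; rewrite lee_fin; exact: f_nd.
rewrite limeMl//.
apply: ereal_nondecreasing_is_cvgn => m n mn.
apply: ge0_le_integral => //.
- by move=> w _; rewrite lee_fin.
- by apply/measurable_EFinP; exact: mfV.
- by apply/measurable_EFinP; exact: mfV.
- by move=> w _; rewrite lee_fin; exact: f_nd.
Qed.

End independence.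

Section product.
Context d (T : measurableType d) (R : realType) (P : probability T R).
Context d1 (T1 : measurableType d1) (Gs : set (set T1)).
Variables (V : nat -> T -> T1) (W : T -> T1) (n : nat).
Hypothesis mGs : @measurable _ T1 = <<s Gs >>.
Hypothesis GsI : setI_closed Gs.
Hypothesis GsT : Gs setT.
Hypothesis mV : forall j, measurable_fun setT (V j).
Hypothesis mW : measurable_fun setT W.
Hypothesis indep : forall B : nat -> set T1, (forall j, Gs (B j)) ->
  P [set w | forall j, (j < n)%N -> B j (V j w)] = (\prod_(j < n) P (W @^-1` B j))%E.

Let ev (f : T1 -> R) := fine (\int[P]_w (f (W w))%:E)%E.

Let evE f : (\int[P]_w (f (W w))%:E < +oo)%E -> (forall v, 0 <= f v) ->
  (\int[P]_w (f (W w))%:E = (ev f)%:E)%E.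
Proof.
move=> foo f0; rewrite fineK// ge0_fin_numE//.
by apply: integral_ge0 => w _; rewrite lee_fin.
Qed.

Let ev_ge0 f : (forall v, 0 <= f v) -> 0 <= ev f.
Proof. by move=> f0; apply: fine_ge0; apply: integral_ge0 => w _; rewrite lee_fin. Qed.

Let mpre (U : T -> T1) B : measurable_fun setT U -> measurable B -> measurable (U @^-1` B).
Proof. by move=> mU mB; rewrite -[X in measurable X]setTI; exact: mU. Qed.

Let GsM B : Gs B -> measurable B.
Proof. by move=> GB; rewrite mGs; exact: sub_sigma_algebra. Qed.

Let int_indic B : measurable B -> (\int[P]_w (\1_B (W w))%:E = P (W @^-1` B))%E.
Proof.
move=> mB; rewrite -[in RHS](setIT (W @^-1` B)) -integral_indic//.
exact: mpre.
Qed.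

(** Indicators of a generating pi-system are replaced by arbitrary functions one
    factor at a time.  For the factor of index m, the other factors define a
    density [S], and two finite measures on [T1] that agree on the pi-system are
    equal. *)
Lemma expectation_prod (f : nat -> T1 -> R) :
  (forall j, measurable_fun setT (f j)) -> (forall j v, 0 <= f j v) ->
  (forall j, \int[P]_w (f j (W w))%:E < +oo)%E ->
  (\int[P]_w (\prod_(j < n) f j (V j w))%:E
    = (\prod_(j < n) fine (\int[P]_w (f j (W w))%:E))%:E)%E.
Proof.
move=> mf f0 foo.
(* the factors of index below m are arbitrary, the others are indicators *)
suff H m : forall f : nat -> T1 -> R,
  (forall j, measurable_fun setT (f j)) -> (forall j v, 0 <= f j v) ->
  (forall j, \int[P]_w (f j (W w))%:E < +oo)%E ->
  (forall j, (m <= j)%N -> (j < n)%N -> exists2 B, Gs B & f j = \1_B) ->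
  (\int[P]_w (\prod_(j < n) f j (V j w))%:E = (\prod_(j < n) ev (f j))%:E)%E.
  by apply: (H n) => // j nj jn; move: (leq_trans jn nj); rewrite ltnn.
move=> {f mf f0 foo}.
elim: m => [|m IH] f mf f0 foo fB.
  have [B BP] : {B : nat -> set T1 & forall j, Gs (B j) /\ ((j < n)%N -> f j = \1_(B j))}.
    apply: (@choice _ _ (fun j B => Gs B /\ ((j < n)%N -> f j = \1_B))) => j.
    have [jn|] := boolP (j < n)%N; last by exists setT.
    by have [B GB fE] := fB j isT jn; exists B.
  have BG j : Gs (B j) by have [] := BP j.
  have BE (j : 'I_n) : f j = \1_(B j) by have [_] := BP j; apply.
  have -> : (\prod_(j < n) ev (f j))%:E = (\prod_(j < n) P (W @^-1` B j))%E.
    rewrite -prodEFin; apply: eq_bigr => j _.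
    by rewrite -evE// BE int_indic//; exact: GsM.
  rewrite -indep//; set E := [set w | _].
  have mE : measurable E.
    have -> : E = \bigcap_(j in `I_n) (V j @^-1` B j) by apply/seteqP; split.
    apply: bigcap_measurableType => j jn; apply: mpre => //; exact: GsM.
  rewrite -[in RHS](setIT E) -integral_indic//.
  apply: eq_integral => w _; congr EFin; rewrite indicE.
  have [|] := boolP (w \in E).
    rewrite inE => wE; apply: big1 => j _.
    by rewrite BE indicE mem_set//; exact: wE.
  rewrite notin_setE => wE.
  have [j jn Bj] : exists2 j, (j < n)%N & ~ B j (V j w).
    apply: contrapT => h; apply: wE => j jn; apply: contrapT => nB.
    by apply: h; exists j.
  have fj : f j = \1_(B j) by have [_] := BP j; apply.
  by rewrite (bigD1 (Ordinal jn))//= fj indicE memNset// mul0r.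
have [mn|nm] := ltnP m n; last first.
  by apply: IH => // j mj jn; move: (leq_trans jn nm); rewrite ltnNge mj.
pose om := Ordinal mn.
pose S w := \prod_(j < n | j != om) f j (V j w).
pose c := \prod_(j < n | j != om) ev (f j).
have c0 : 0 <= c by apply: prodr_ge0 => j _; exact: ev_ge0.
have S0 w : 0 <= S w by apply: prodr_ge0 => j _; exact: f0.
have mS : measurable_fun setT S.
  rewrite (_ : S = fun w => \prod_(j < n) (if j != om then f j (V j w) else 1)); last first.
    by apply/funext => w; rewrite /S; exact: big_mkcond.
  apply: measurable_prod => j _; case: (j != om); last exact: measurable_cst.
  exact: measurableT_comp.
have law B : measurable B -> (\int[P]_(w in V m @^-1` B) (S w)%:E = c%:E * P (W @^-1` B))%E.
  move=> mB; have cW B' : measurable B' -> (c%:E * P (W @^-1` B') =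
      weighted_law _ _ _ P _ _ (cst c) W (measurable_cst _) (fun=> c0) mW B')%E.
    by move=> mB'; rewrite /weighted_law -integral_cst//; exact: mpre.
  rewrite cW//.
  rewrite -[LHS]/(weighted_law _ _ _ P _ _ S (V m) mS S0 (mV m) B).
  have agree A : Gs A -> (\int[P]_(w in V m @^-1` A) (S w)%:E = c%:E * P (W @^-1` A))%E.
    move=> GA.
    pose f' j := if j == m then \1_A : T1 -> R else f j.
    have mA := GsM _ GA.
    have mf' j : measurable_fun setT (f' j) by rewrite /f'; case: ifP => // _; exact: measurable_indic.
    have f'0 j v : 0 <= f' j v by rewrite /f'; case: ifP.
    have f'oo j : (\int[P]_w (f' j (W w))%:E < +oo)%E.
      rewrite /f'; case: ifP => // _; rewrite int_indic//.
      by rewrite (le_lt_trans (probability_le1 _ _)) ?ltry//; exact: mpre.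
    have f'B j : (m <= j)%N -> (j < n)%N -> exists2 B, Gs B & f' j = \1_B.
      rewrite leq_eqVlt => /predU1P[<- _|mj jn]; first by exists A => //; rewrite /f' eqxx.
      by rewrite /f' gtn_eqF//; exact: fB.
    have := IH f' mf' f'0 f'oo f'B.
    have f'm : f' m = \1_A by rewrite /f' eqxx.
    have f'j (j : 'I_n) : j != om -> f' j = f j.
      by move=> jm; rewrite /f' ifF//; apply: contraNF jm => /eqP jm; exact/eqP/val_inj.
    rewrite [X in _ = X%:E -> _](bigD1 om)//= f'm.
    rewrite [X in _ = (_ * X)%:E -> _](eq_bigr (fun j : 'I_n => ev (f j))); last first.
      by move=> j /f'j ->.
    rewrite EFinM -evE//; last first.
      by rewrite int_indic// (le_lt_trans (probability_le1 _ _)) ?ltry//; exact: mpre.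
    rewrite int_indic// muleC => <-.
    rewrite [LHS]integral_mkcond; apply: eq_integral => w _.
    rewrite (bigD1 om)//= f'm patchE (_ : (w \in _) = (V m w \in A)); last first.
      by apply/idP/idP; rewrite !inE.
    rewrite indicE; case: ifP => _; rewrite ?mul0r// mul1r; congr EFin.
    by apply: eq_bigr => j /f'j ->.
  apply: (measure_unique Gs (fun=> setT)) => //.
  - by rewrite bigcup_const.
  - by move=> A GA; have := agree A GA; rewrite (cW A (GsM _ GA)).
  - move=> _; rewrite [X in (X < _)%E](agree _ GsT) preimage_setT.
    by rewrite probability_setT mule1 ltry.
rewrite (_ : (\prod_(j < n) ev (f j))%:E = (c%:E * \int[P]_w (f m (W w))%:E)%E); last first.
  by rewrite (bigD1 om)//= EFinM muleC -evE.
rewrite -(integral_of_law _ _ _ P _ _ S (V m) W c)//.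
by apply: eq_integral => w _; rewrite (bigD1 om).
Qed.
End product.

Section iid_products.
Context d (T : measurableType d) (R : realType) (P : probability T R).

Lemma measurable_generates d1 (T1 : measurableType d1) :
  @measurable _ T1 = <<s @measurable _ T1 >>.
Proof. by rewrite (smallest_id (@sigma_algebra_measurable _ T1)). Qed.

Lemma mutually_independent_iota d1 (T1 : measurableType d1) (U : nat -> T -> T1)
    (B : nat -> set T1) o n :
  iid P U -> (forall j, measurable (B j)) ->
  P [set w | forall k, (o <= k)%N -> (k < o + n)%N -> B k (U k w)]
   = (\prod_(k <- iota o n) P (U 0%N @^-1` B k))%E.
Proof.
move=> [ind same] mB.
rewrite (eq_bigr (fun k => P (U k @^-1` B k))); last by move=> k _; rewrite [RHS]same.
rewrite -ind ?iota_uniq//; congr (P _); apply/seteqP; split => w /= h k /=.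
  by rewrite mem_iota => /andP[]; exact: h.
by move=> ok kn; apply: h; rewrite /= mem_iota ok.
Qed.

Lemma expectation_prod_iid d1 (T1 : measurableType d1) (U : nat -> {mfun T >-> T1})
    (f : T1 -> R) n :
  iid P U -> measurable_fun setT f -> (forall v, 0 <= f v) ->
  (\int[P]_w (f (U 0%N w))%:E < +oo)%E ->
  (\int[P]_w (\prod_(j < n) f (U j w))%:E
    = (fine (\int[P]_w (f (U 0%N w))%:E) ^+ n)%:E)%E.
Proof.
move=> iidU mf f0 foo.
rewrite (expectation_prod _ T R P _ T1 measurable U (U 0%N) n _ _ _ _ _ _ (fun=> f))//.
- by rewrite prodr_const card_ord.
- exact: measurable_generates.
- exact: measurableI.
- move=> B mB; have := mutually_independent_iota _ _ U B 0%N n iidU mB.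
  rewrite -[in X in _ = X -> _](subn0 n) -/(index_iota 0 n) big_mkord => <-.
  by congr (P _); apply/seteqP; split => w /= h k; [move=> _; exact: h|exact: h].
Qed.

End iid_products.

Section blocks.
Context d (T : measurableType d) (R : realType) (P : probability T R).
Context d1 (T1 : measurableType d1) d2 (T2 : measurableType d2).
Variables (U : nat -> {mfun T >-> T1}) (A : nat -> {mfun T >-> T2}).
Hypotheses (iidU : iid P U) (iidA : iid P A) (indUA : independent_processes P U A).

Lemma sigma_process_cylinder d3 (T3 : measurableType d3) (V : nat -> T -> T3)
    (B : nat -> set T3) (s : pred nat) n : (forall j, measurable (B j)) ->
  sigma_process V [set w | forall k, (k < n)%N -> s k -> B k (V k w)].
Proof.
move=> mB.
pose Gn := \bigcup_k preimage_set_system setT (V k) measurable.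
rewrite /sigma_process -/Gn.
have : @measurable _ (g_sigma_algebraType Gn)
     (\bigcap_(k in `I_n) (if s k then V k @^-1` B k else setT)).
  apply: bigcap_measurableType => k kn; case: ifP => _ //.
  apply: sub_sigma_algebra; exists k => //; exists (B k) => //.
  by rewrite setTI.
congr (_ _); apply/seteqP; split=> w /= h k kn.
  by have := h k kn; case: ifP.
by case: ifP => // sk; apply: h.
Qed.

Lemma prod_iota_pairs o n (F : nat -> \bar R) :
  (\prod_(k <- iota o n.*2) F k
    = \prod_(j < n) (F (o + j.*2)%N * F (o + j.*2).+1))%E.
Proof.
elim: n => [|n IH]; first by rewrite big_nil big_ord0.
rewrite doubleS -addn2 iotaD big_cat/= IH big_ord_recr/=; congr (_ * _)%E.
by rewrite !big_cons big_nil mule1.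
Qed.

(** The event is the intersection of a cylinder for U and one for A: even
    positions of U carry [B1], odd ones [B2], and A is constrained at the odd
    positions only. *)
Lemma block_prob o n (B1 B2 : nat -> set T1) (B3 : nat -> set T2) :
  (forall j, measurable (B1 j)) -> (forall j, measurable (B2 j)) ->
  (forall j, measurable (B3 j)) ->
  P [set w | forall j, (j < n)%N -> [/\ B1 j (U (o + j.*2)%N w),
     B2 j (U (o + j.*2).+1 w) & B3 j (A (o + j.*2).+1 w)]]
  = (\prod_(j < n) (P (U 0%N @^-1` B1 j) * P (U 0%N @^-1` B2 j)
      * P (A 0%N @^-1` B3 j)))%E.
Proof.
move=> m1 m2 m3.
pose C k := if odd (k - o) then B2 (k - o)./2 else B1 (k - o)./2.
have mC k : measurable (C k) by rewrite /C; case: ifP.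
pose D k := if odd (k - o) then B3 (k - o)./2 else setT.
have mD k : measurable (D k) by rewrite /D; case: ifP.
have sub0 j : (o + j.*2 - o = j.*2)%N by rewrite addKn.
have sub1 j : ((o + j.*2).+1 - o = j.*2.+1)%N by rewrite -addnS addKn.
have C0 j : C (o + j.*2)%N = B1 j by rewrite /C sub0 odd_double doubleK.
have C1 j : C (o + j.*2).+1 = B2 j by rewrite /C sub1 /= odd_double uphalf_double.
have D1 j : D (o + j.*2).+1 = B3 j by rewrite /D sub1 /= odd_double uphalf_double.
have D0 j : D (o + j.*2)%N = setT by rewrite /D sub0 odd_double.
pose E := [set w | forall k, (o <= k)%N -> (k < o + n.*2)%N -> C k (U k w)].
pose F := [set w | forall k, (o <= k)%N -> (k < o + n.*2)%N -> D k (A k w)].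
have -> : [set w | forall j, (j < n)%N -> [/\ B1 j (U (o + j.*2)%N w),
     B2 j (U (o + j.*2).+1 w) & B3 j (A (o + j.*2).+1 w)]] = E `&` F.
  apply/seteqP; split=> w /=.
    move=> h; split=> k ok kn; have ko : k = (o + odd (k - o) + (k - o)./2.*2)%N.
    - by rewrite -addnA odd_double_half subnKC.
    - have jn : ((k - o)./2 < n)%N by rewrite -(ltn_double); lia.
      have [h1 h2 _] := h _ jn; rewrite ko; case: (odd _) => /=.
        by rewrite addn1 addSn C1.
      by rewrite addn0 C0.
    - by rewrite -addnA odd_double_half subnKC.
    - have jn : ((k - o)./2 < n)%N by rewrite -(ltn_double); lia.
      have [_ _ h3] := h _ jn; rewrite ko; case: (odd _) => /=.
        by rewrite addn1 addSn D1.
      by rewrite addn0 D0.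
  move=> [hE hF] j jn; rewrite -C0 -C1 -D1; split.
  - by apply: hE; lia.
  - by apply: hE; lia.
  - by apply: hF; lia.
have sE : sigma_process U E.
  have := @sigma_process_cylinder _ _ U C (fun k => (o <= k)%N) (o + n.*2) mC.
  congr (sigma_process _ _); apply/seteqP; split=> w /= h k a b; exact: h.
have sF : sigma_process A F.
  have := @sigma_process_cylinder _ _ A D (fun k => (o <= k)%N) (o + n.*2) mD.
  congr (sigma_process _ _); apply/seteqP; split=> w /= h k a b; exact: h.
rewrite indUA// (mutually_independent_iota _ _ _ P _ _ U C o n.*2 iidU mC).
rewrite (mutually_independent_iota _ _ _ P _ _ A D o n.*2 iidA mD) !prod_iota_pairs.
rewrite -big_split/=; apply: eq_bigr => j _.
by rewrite C0 C1 D0 D1 preimage_setT probability_setT mul1e.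
Qed.

(** For a fixed offset o, blocks of different index j share no variable; the
    offsets 0 and 1 together cover all steps (k, k + 1). *)
Definition block o j (w : T) : T1 * T1 * T2 :=
  (U (o + j.*2)%N w, U (o + j.*2).+1 w, A (o + j.*2).+1 w).

Let rect : set (set (T1 * T1 * T2)) :=
  [set B | exists B1 B2 B3, [/\ measurable B1, measurable B2, measurable B3 &
     B = (B1 `*` B2) `*` B3]].

Let rect_generates : @measurable _ (T1 * T1 * T2)%type = <<s rect >>.
Proof.
apply/seteqP; split.
  pose I3 (x : g_sigma_algebraType rect) : T1 * T1 * T2 := x.
  have mI3 : measurable_fun setT I3.
    apply/measurable_fun_pairP; split; first (apply/measurable_fun_pairP; split).
    - move=> _ B mB; rewrite setTI; apply: sub_sigma_algebra.
      exists B, setT, setT; split => //.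
      by apply/seteqP; split => -[[x1 x2] x3] //= -[[]].
    - move=> _ B mB; rewrite setTI; apply: sub_sigma_algebra.
      exists setT, B, setT; split => //.
      by apply/seteqP; split => -[[x1 x2] x3] //= -[[]].
    - move=> _ B mB; rewrite setTI; apply: sub_sigma_algebra.
      exists setT, setT, B; split => //.
      by apply/seteqP; split => -[[x1 x2] x3] //= -[[]].
  by move=> B mB; have := mI3 measurableT B mB; rewrite setTI.
apply: smallest_sub; first exact: sigma_algebra_measurable.
by move=> _ [B1 [B2 [B3 [m1 m2 m3 ->]]]]; apply: measurableX => //; exact: measurableX.
Qed.

Lemma measurable_block o j : measurable_fun setT (block o j).
Proof. by apply/measurable_fun_pairP; split => //; apply/measurable_fun_pairP; split. Qed.

Lemma expectation_prod_blocks (f : T1 * T1 * T2 -> R) o n :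
  measurable_fun setT f -> (forall v, 0 <= f v) ->
  (\int[P]_w (f (block 0 0 w))%:E < +oo)%E ->
  (\int[P]_w (\prod_(j < n) f (block o j w))%:E
    = (fine (\int[P]_w (f (block 0 0 w))%:E) ^+ n)%:E)%E.
Proof.
move=> mf f0 foo.
rewrite (expectation_prod _ T R P _ _ rect (block o) (block 0 0) n _ _ _ _ _ _ (fun=> f))//.
- by rewrite prodr_const card_ord.
- move=> _ _ [B1 [B2 [B3 [m1 m2 m3 ->]]]] [B1' [B2' [B3' [m1' m2' m3' ->]]]].
  exists (B1 `&` B1'), (B2 `&` B2'), (B3 `&` B3'); split; try exact: measurableI.
  by rewrite -!setXI.
- by exists setT, setT, setT; split => //; rewrite !setXTT.
- exact: measurable_block.
- exact: measurable_block.
- move=> B GB.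
  have [B1 /choice[B2 /choice[B3 BE]]] := choice GB.
  rewrite (_ : [set w | _] = [set w | forall j, (j < n)%N -> [/\ B1 j (U (o + j.*2)%N w),
     B2 j (U (o + j.*2).+1 w) & B3 j (A (o + j.*2).+1 w)]]); last first.
    apply/seteqP; split => w /= h j jn; have [_ _ _ bE] := BE j.
      by have := h j jn; rewrite bE => -[[]].
    by rewrite bE; have [] := h j jn.
  rewrite block_prob; try by move=> j; have [] := BE j.
  apply: eq_bigr => j _; have [m1 m2 m3 ->] := BE j.
  have := block_prob 0 1 (fun=> B1 j) (fun=> B2 j) (fun=> B3 j) (fun=> m1) (fun=> m2) (fun=> m3).
  rewrite big_ord1 => <-; congr (P _); apply/seteqP; split => w /=.
    by move=> /(_ 0%N isT)[].
  by move=> [[h1 h2] h3] [|//] _.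
Qed.

End blocks.

(** * Euclidean geometry of the fibres *)

Section euclidean_norm.
Context (R : realType) (n : nat).
Implicit Types x y : 'rV[R]_n.

Lemma enorm_ge0 x : 0 <= enorm x. Proof. exact: sqrtr_ge0. Qed.

Lemma sqr_enorm x : enorm x ^+ 2 = \sum_(i < n) x 0 i ^+ 2.
Proof. by rewrite sqr_sqrtr// sumr_ge0// => i _; rewrite sqr_ge0. Qed.

Lemma enorm0 : enorm (0 : 'rV[R]_n) = 0.
Proof. by rewrite /enorm big1 ?sqrtr0// => i _; rewrite mxE expr0n. Qed.

Lemma enormN x : enorm (- x) = enorm x.
Proof. by congr Num.sqrt; apply: eq_bigr => i _; rewrite mxE sqrrN. Qed.

Lemma enormC x y : enorm (x - y) = enorm (y - x).
Proof. by rewrite -enormN opprB. Qed.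

Lemma coord_le_enorm x i : `|x 0 i| <= enorm x.
Proof.
rewrite -(ler_pXn2r (n := 2))// ?nnegrE ?enorm_ge0// sqr_enorm (bigD1 i)//=.
by rewrite real_normK ?num_real// lerDl sumr_ge0// => j _; rewrite sqr_ge0.
Qed.

(** The Cauchy-Schwarz inequality, from the norm of |y| x - |x| y. *)
Lemma dot_le_enorm x y : \sum_(i < n) x 0 i * y 0 i <= enorm x * enorm y.
Proof.
set s := \sum_(i < n) _.
have enz (z : 'rV[R]_n) i : enorm z = 0 -> z 0 i = 0.
  move=> z0; apply/normr0_eq0/eqP; rewrite eq_le normr_ge0 andbT.
  by rewrite (le_trans (coord_le_enorm z i))// z0.
have [x0|x0] := eqVneq (enorm x) 0.
  by rewrite x0 mul0r /s big1// => i _; rewrite enz ?mul0r.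
have [y0|y0] := eqVneq (enorm y) 0.
  by rewrite y0 mulr0 /s big1// => i _; rewrite [y 0 i]enz ?mulr0.
have xy0 : 0 < enorm x * enorm y.
  by rewrite mulr_gt0// lt_neqAle enorm_ge0 eq_sym ?x0 ?y0.
have : 0 <= \sum_(i < n) (enorm y * x 0 i - enorm x * y 0 i) ^+ 2.
  by apply: sumr_ge0 => i _; rewrite sqr_ge0.
have -> : \sum_(i < n) (enorm y * x 0 i - enorm x * y 0 i) ^+ 2 =
    enorm y ^+ 2 * \sum_(i < n) x 0 i ^+ 2 + (- 2 * (enorm x * enorm y)) * s
    + enorm x ^+ 2 * \sum_(i < n) y 0 i ^+ 2.
  by rewrite /s !mulr_sumr -!big_split/=; apply: eq_bigr => i _; ring.
rewrite -!sqr_enorm => H.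
rewrite -subr_ge0 -(pmulr_rge0 _ xy0).
have : 0 <= 2 * (enorm x * enorm y * (enorm x * enorm y - s)).
  by apply: le_trans H _; rewrite le_eqVlt; apply/orP; left; apply/eqP; ring.
by rewrite (pmulr_rge0 _ (ltr0n _ 2)).
Qed.

Lemma enormD x y : enorm (x + y) <= enorm x + enorm y.
Proof.
rewrite -(ler_pXn2r (n := 2))// ?nnegrE ?addr_ge0 ?enorm_ge0//.
rewrite sqrrD !sqr_enorm.
have -> : \sum_(i < n) (x + y) 0 i ^+ 2 = \sum_(i < n) x 0 i ^+ 2
    + (\sum_(i < n) x 0 i * y 0 i) *+ 2 + \sum_(i < n) y 0 i ^+ 2.
  by rewrite -sumrMnl -!big_split/=; apply: eq_bigr => i _; rewrite mxE sqrrD.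
by rewrite lerD2r lerD2l lerMn2r dot_le_enorm.
Qed.

Lemma enorm_triangle x y z : enorm (x - z) <= enorm (x - y) + enorm (y - z).
Proof. by rewrite (_ : x - z = (x - y) + (y - z)) ?enormD// addrA subrK. Qed.

Lemma enorm_le_coords x e : 0 <= e -> (forall i, `|x 0 i| <= e) -> enorm x <= n%:R * e.
Proof.
move=> e0 xe; rewrite -(ler_pXn2r (n := 2))// ?nnegrE ?enorm_ge0 ?mulr_ge0// sqr_enorm.
apply: (@le_trans _ _ (\sum_(i < n) e ^+ 2)).
  by apply: ler_sum => i _; rewrite -real_normK ?num_real// lerXn2r// ?nnegrE.
rewrite sumr_const card_ord exprMn -[leLHS]mulr_natl ler_wpM2r ?exprn_ge0//.
by rewrite -natrX ler_nat; case: (n) => // m; rewrite expnS leq_pmulr// expn_gt0.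
Qed.

Lemma measurable_enorm : measurable_fun setT (@enorm R n).
Proof.
apply: (measurableT_comp (f := @Num.sqrt R)).
  by apply: continuous_measurable_fun; exact: sqrt_continuous.
apply: measurable_sum => i; apply: measurable_funX; exact: measurable_coord.
Qed.

End euclidean_norm.

Lemma measurable_subrV (R : realType) n d (T : measurableType d) (F G : T -> 'rV[R]_n) :
  measurable_fun setT F -> measurable_fun setT G -> measurable_fun setT (fun t => F t - G t).
Proof.
move=> /measurable_fun_rVP mF /measurable_fun_rVP mG; apply/measurable_fun_rVP => i.
by under eq_fun do rewrite !mxE; apply: measurable_funB.
Qed.

Lemma measurable_fun_le_set d (T : measurableType d) (R : realType) (F : T -> R) c :
  measurable_fun setT F -> measurable [set t | F t <= c].
Proof.
move=> mF; have := mF measurableT `]-oo, c]%classic (measurable_itv _).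
by rewrite setTI; congr measurable; apply/seteqP; split => t /=; rewrite in_itv.
Qed.

Section fibers.
Context (R : realType) (N p : nat).
Local Notation X := 'rV[R]_N.
Local Notation Y := 'rV[R]_p.
Variable h : X -> Y.
Hypothesis mh : measurable_fun setT h.

Lemma measurable_near_fiber y D : measurable (near_fiber h y D).
Proof.
apply: measurable_fun_le_set; apply: measurableT_comp; first exact: measurable_enorm.
exact: measurable_subrV.
Qed.

(** By uniform continuity, a cube of fixed size around any preimage of y lies in
    the fibre. *)
Lemma near_fiber_volume D : 0 < D -> unif_continuous h -> (forall y, exists x, h x = y) ->
  exists2 l : R, 0 < l & forall y, (l%:E <= lebesgue_rV R N (near_fiber h y D))%E.
Proof.
move=> D0 /unif_continuousP uc surj.
have e0 : 0 < D / p.+1%:R by rewrite divr_gt0.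
have [r /= r0 hr] := uc _ e0.
exists ((r *+ 2) ^+ N) => [|y]; first by rewrite exprn_gt0// mulrn_wgt0.
have [x0 hx0] := surj y.
have mbox : measurable [set x : X | forall i, ball (x0 0 i) r (x 0 i)].
  rewrite (_ : [set _ | _] = \bigcap_(i in [set: 'I_N])
      ((fun x : X => x 0 i) @^-1` ball (x0 0 i) r)); last first.
    by apply/seteqP; split=> [x /= xi i _|x /= xi i]; exact: xi.
  apply: fin_bigcap_measurable => // i _; rewrite -[X in measurable X]setTI.
  apply: measurable_coord => //; apply: open_measurable; exact: ball_open.
have -> : ((r *+ 2) ^+ N)%:E = lebesgue_rV R N [set x | forall i, ball (x0 0 i) r (x 0 i)].
  rewrite (lebesgue_rV_box (A := fun i => ball (x0 0 i) r)); last first.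
    by move=> i; apply: open_measurable; exact: ball_open.
  rewrite (eq_bigr (fun=> (r *+ 2)%:E)); last first.
    by move=> i _; rewrite lebesgue_measure_ball// ltW.
  by rewrite prodEFin prodr_const card_ord.
apply: le_measure; rewrite ?inE//; first exact: measurable_near_fiber.
move=> x /= xb; rewrite /near_fiber /= -hx0 enormC.
have bx : ball x0 r x by split => // i j; rewrite ord1.
have [_ hb] := hr (x0, x) bx.
apply: le_trans (enorm_le_coords _ _ _ (D / p.+1%:R) _ _) _; first exact: ltW.
  move=> i; have := hb 0 i; rewrite /ball /= !mxE => /ltW; exact.
rewrite mulrCA ger_pMr// ler_pdivrMr// mul1r ler_nat.
by [].
Qed.

End fibers.

Lemma density_lower (R : realType) p (upsilon : 'rV[R]_p -> R) D :
  (forall K : set 'rV[R]_p, compact K ->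
       (0 < ereal_inf [set (upsilon y)%:E | y in K])%E) ->
  exists2 gam : R, 0 < gam & forall u, enorm u <= D -> gam <= upsilon u.
Proof.
move=> low.
pose K : set 'rV[R]_p := [set v | forall i, `[- D, D]%classic (v ord0 i)].
have cK : compact K.
  by apply: (@rV_compact R p (fun=> `[- D, D]%classic)) => i; exact: segment_compact.
have {low cK} := low _ cK.
set I := ereal_inf _ => I0.
have IK u : enorm u <= D -> (I <= (upsilon u)%:E)%E.
  move=> uD; apply: ereal_inf_lbound; exists u => // i /=; rewrite in_itv/=.
  by have := le_trans (coord_le_enorm _ _ u i) uD; rewrite ler_norml.
case: I I0 IK => [r| |]// I0 IK.
  by exists r; [rewrite -lte_fin|move=> u /IK; rewrite lee_fin].
by exists 1 => // u /IK; rewrite leye_eq.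
Qed.

(** * The transition kernel on fibres *)

Section noise.
Context (R : realType) (N : nat).
Local Notation X := 'rV[R]_N.
Variables (psi : X -> R) (mum mup : R).
Hypothesis (mum0 : 0 < mum) (mup0 : 0 < mup).
Hypothesis q_pm : forall r, 0 <= r ->
  (0 < q_minus mum psi r)%E /\ (q_minus mum psi r <= q_plus mup psi r)%E /\
  (q_plus mup psi r < +oo)%E.

Definition qlow r := fine (q_minus mum psi r).
Definition qhigh r := fine (q_plus mup psi r).

Lemma qlowE r : 0 <= r -> q_minus mum psi r = (qlow r)%:E.
Proof.
move=> /q_pm[h1 [h2 h3]]; rewrite fineK// ge0_fin_numE ?ltW//.
exact: le_lt_trans h3.
Qed.

Lemma qhighE r : 0 <= r -> q_plus mup psi r = (qhigh r)%:E.
Proof.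
move=> /q_pm[h1 [h2 h3]]; rewrite fineK// ge0_fin_numE//.
by apply: le_trans h2; exact: ltW.
Qed.

Lemma qlow_gt0 r : 0 <= r -> 0 < qlow r.
Proof. by move=> r0; rewrite -lte_fin -qlowE//; have [] := q_pm _ r0. Qed.

Lemma qlow_le_qhigh r : 0 <= r -> qlow r <= qhigh r.
Proof. by move=> r0; rewrite -lee_fin -qlowE// -qhighE//; have [_ []] := q_pm _ r0. Qed.

Lemma qlow_le r v : enorm v <= r -> qlow r <= mum * psi v.
Proof.
move=> vr; have r0 : 0 <= r by exact: le_trans (enorm_ge0 _ _ v) vr.
rewrite -lee_fin -qlowE// /q_minus EFinM; apply: lee_wpmul2l; first by rewrite lee_fin ltW.
by apply: ereal_inf_lbound; exists v.
Qed.

Lemma qhigh_ge r v : enorm v <= r -> mup * psi v <= qhigh r.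
Proof.
move=> vr; have r0 : 0 <= r by exact: le_trans (enorm_ge0 _ _ v) vr.
rewrite -lee_fin -qhighE// /q_plus EFinM; apply: lee_wpmul2l; first by rewrite lee_fin ltW.
by apply: ereal_sup_ubound; exists v.
Qed.

Lemma qlow_anti r s : 0 <= r -> r <= s -> qlow s <= qlow r.
Proof.
move=> r0 rs; rewrite -lee_fin -!qlowE//; last exact: le_trans rs.
rewrite /q_minus; apply: lee_wpmul2l; first by rewrite lee_fin ltW.
apply: ereal_inf_le_tmp => _ [v /= vr <-]; exists v => //.
exact: le_trans rs.
Qed.

Lemma qlow_neg r : r < 0 -> q_minus mum psi r = +oo%E.
Proof.
move=> r0; rewrite /q_minus (_ : [set _ | v in _] = set0).
  by rewrite ereal_inf0 gt0_muley// lte_fin.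
apply/seteqP; split => // _ [v /= vr _].
by have := le_lt_trans (le_trans (enorm_ge0 _ _ v) vr) r0; rewrite ltxx.
Qed.

(** No vector has norm at most r when r < 0; the infimum is then infinite, and
    the conventions [fine +oo = 0] and [ln 0 = 0] give the penalty 0. *)
Definition penalty r := Num.max 0 (- ln (qlow r)).

Lemma penalty_ge0 r : 0 <= penalty r. Proof. by rewrite le_max lexx. Qed.

Lemma penalty_nd : nondecreasing_fun penalty.
Proof.
move=> r s rs; have [r0|r0] := ltP r 0.
  by rewrite /penalty {1}/qlow qlow_neg//= ln0// oppr0 maxxx le_max lexx.
rewrite /penalty ge_max le_max lexx/= le_max; apply/orP; right.
have s0 := le_trans r0 rs.
by rewrite lerN2 ler_ln ?posrE ?qlow_gt0// qlow_anti.
Qed.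

Lemma penalty_qlow r : 0 <= r -> expR (- penalty r) <= qlow r.
Proof.
move=> r0; rewrite -[leRHS]lnK ?posrE ?qlow_gt0// ler_expR lerNl.
by rewrite le_max lexx orbT.
Qed.

(** The exponential of [- lam log q^-], including its value 0 where [q^-] is
    infinite. *)
Definition qmoment (lam r : R) := if r < 0 then 0 else expR (lam * - ln (qlow r)).

Lemma qmomentE lam r : 0 < lam ->
  (qmoment lam r)%:E = expeR (lam%:E * - lne (q_minus mum psi r))%E.
Proof.
move=> l0; rewrite /qmoment; case: ifPn => [r0|].
  by rewrite qlow_neg//= mulrNy gtr0_sg// mul1e.
by rewrite -leNgt => r0; rewrite qlowE// lne_EFin ?qlow_gt0.
Qed.

Lemma qmoment_nd lam : 0 < lam -> nondecreasing_fun (qmoment lam).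
Proof.
move=> l0 r s rs; rewrite /qmoment; have [r0|r0] := ltP r 0.
  by case: ifP => // _; exact: expR_ge0.
have s0 := le_trans r0 rs; rewrite ltNge s0/= ler_expR ler_pM2l// lerN2.
by rewrite ler_ln ?posrE ?qlow_gt0// qlow_anti.
Qed.

Lemma penalty_moment lam r : 0 < lam -> expR (lam * penalty r) <= 1 + qmoment lam r.
Proof.
move=> l0; rewrite /qmoment; have [r0|r0] := ltP r 0.
  by rewrite /penalty /qlow qlow_neg//= ln0// oppr0 maxxx mulr0 expR0 addr0.
rewrite /penalty; case: (leP 0 (- ln (qlow r))) => _.
  by rewrite lerDr.
by rewrite mulr0 expR0 lerDl expR_ge0.
Qed.

Section kernel.
Variables (q : X -> X -> R) (f : X -> X) (Q : R.-pker X ~> X).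
Hypothesis mq : measurable_fun setT (fun xu : X * X => q xu.1 xu.2).
Hypothesis q0 : forall x u, 0 <= q x u.
Hypothesis QE : forall x A, measurable A ->
  (Q x A = \int[lebesgue_rV R N]_(x' in A) (q x (x' - f x))%:E)%E.
Hypothesis q_bounds : forall x u, mum * psi u <= q x u /\ q x u <= mup * psi u.

Let mqx x : measurable_fun setT (fun x' : X => (q x (x' - f x))%:E).
Proof.
apply/measurable_EFinP.
apply: (measurableT_comp (f := fun xu : X * X => q xu.1 xu.2) (g := fun x' : X => (x, x' - f x))) => //.
apply/measurable_fun_pairP; split; first exact: measurable_cst.
by apply: (@measurable_subrV R N _ X (fun x' => x') (fun=> f x)).
Qed.

Lemma kernel_lower (x : X) (E : set X) (r : R) : measurable E -> 0 <= r -> (forall x', E x' -> enorm (x' - f x) <= r) ->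
  ((qlow r)%:E * lebesgue_rV R N E <= Q x E)%E.
Proof.
move=> mE r0 Er; rewrite QE// -integral_cst//; apply: ge0_le_integral => //.
- by move=> u _; rewrite lee_fin ltW// qlow_gt0.
- exact: measurable_funTS.
- move=> x' /Er h; rewrite lee_fin; apply: le_trans (qlow_le _ _ h) _.
  by have [] := q_bounds x (x' - f x).
Qed.

Lemma kernel_upper (x : X) (E : set X) (r : R) : measurable E -> 0 <= r -> (forall x', E x' -> enorm (x' - f x) <= r) ->
  (Q x E <= (qhigh r)%:E * lebesgue_rV R N E)%E.
Proof.
move=> mE r0 Er; rewrite QE// -integral_cst//; apply: ge0_le_integral => //.
- by move=> u _; rewrite lee_fin.
- exact: measurable_funTS.
- move=> x' /Er h; rewrite lee_fin; apply: le_trans (qhigh_ge _ _ h).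
  by have [] := q_bounds x (x' - f x).
Qed.

(** On E both kernels have densities between [qlow r] and [qhigh r]. *)
Lemma kernel_ratio (x1 x2 : X) (E : set X) (r t : R) : measurable E -> 0 <= r -> t * qhigh r <= qlow r -> 0 <= t ->
  (forall x', E x' -> enorm (x' - f x1) <= r) ->
  (forall x', E x' -> enorm (x' - f x2) <= r) ->
  forall A, measurable A -> (t%:E * Q x2 (A `&` E) <= Q x1 (A `&` E))%E.
Proof.
move=> mE r0 tq t0 E1 E2 A mA.
have mAE : measurable (A `&` E) by exact: measurableI.
apply: le_trans (kernel_lower x1 _ r mAE r0 _); last by move=> x' [_ /E1].
apply: (@le_trans _ _ (t%:E * ((qhigh r)%:E * lebesgue_rV R N (A `&` E)))%E).
  by rewrite lee_wpmul2l ?lee_fin// kernel_upper// => x' [_ /E2].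
by rewrite muleA -EFinM lee_wpmul2r// lee_fin.
Qed.

End kernel.
End noise.

Section transition_radius.
Context (R : realType) (N p : nat).
Local Notation X := 'rV[R]_N.
Local Notation Y := 'rV[R]_p.
Variables (f fs : X -> X) (h hs : X -> Y) (a b0 b astar b0s bs : R).
Hypothesis a0 : 0 <= a. 
Hypothesis b_ge0 : 0 <= b.
Hypothesis as0 : 0 <= astar.
Hypothesis f_lip : forall x1 x2, enorm (f x1 - f x2) <= a * enorm (x1 - x2).
Hypothesis h_surj : forall y, exists x, h x = y.
Hypothesis h_inv : forall x1 x2, enorm (x1 - x2) <= b0 + b * enorm (h x1 - h x2).
Hypothesis fs_lip : forall x1 x2, enorm (fs x1 - fs x2) <= astar * enorm (x1 - x2).
Hypothesis hs_surj : forall y, exists x, hs x = y.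
Hypothesis hs_inv : forall x1 x2, enorm (x1 - x2) <= b0s + bs * enorm (hs x1 - hs x2).
Hypothesis f_mis : (supnorm (fun x => f x - fs x)%R < +oo)%E.
Hypothesis h_mis : (supnorm (fun x => h x - hs x)%R < +oo)%E.

Lemma le_supnorm T n (u : T -> 'rV[R]_n) x : (supnorm u < +oo)%E -> enorm (u x) <= fine (supnorm u).
Proof.
move=> uoo; have ux : ((enorm (u x))%:E <= supnorm u)%E by apply: ereal_sup_ubound; exists x.
rewrite -lee_fin fineK// ge0_fin_numE//; apply: le_trans ux.
by rewrite lee_fin enorm_ge0.
Qed.

Lemma mismatch_ge0 : 0 <= b0 -> 0 <= mismatch f fs h hs b0 b astar.
Proof.
move=> b00; rewrite /mismatch addr_ge0 ?mulr_ge0 ?addr_ge0 ?mulr_ge0//.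
- by apply: le_trans (le_supnorm _ _ _ 0 f_mis); exact: enorm_ge0.
- apply: fine_ge0; apply: le_trans (ereal_sup_ubound _); last by exists 0.
  by rewrite lee_fin enorm_ge0.
Qed.

(** Surjectivity gives points u0 and u1 whose images under h are the two
    observations.  They are close to x and x' by the inverse bound on h, and
    close to the hidden states by the inverse bounds on h and h^* together.
    The rest is a chain of triangle inequalities along x', u1, X1, f^*(X0), f(u0),
    f(x). *)
Lemma transition_radius (X0 X1 z1 : X) (e0 e1 : Y) (G D : R) (x x' : X) :
  X1 = fs X0 + z1 -> enorm z1 <= G ->
  near_fiber h (hs X0 + e0) D x -> near_fiber h (hs X1 + e1) D x' ->
  enorm (x' - f x) <= (a + 1) * b0 + (a + 1) * b * D + mismatch f fs h hs b0 b astar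
    + (1 + astar) * b0s + astar * bs * enorm e0 + bs * enorm e1 + G.
Proof.
move=> X1E zG; rewrite /near_fiber /= => xD x'D.
have H x2 : enorm (hs x2 - h x2) <= fine (supnorm (fun x => hs x - h x)).
  apply: (le_supnorm _ _ (fun x => hs x - h x)); rewrite (_ : supnorm _ = supnorm (fun x => h x - hs x))//.
  by congr ereal_sup; apply/seteqP; split => _ [x3 _ <-]; exists x3 => //; rewrite enormC.
have F x2 : enorm (f x2 - fs x2) <= fine (supnorm (fun x => f x - fs x)).
  exact: (le_supnorm _ _ (fun x => f x - fs x)).
set Hm := fine _ in H; set Fm := fine _ in F.
have state (X2 : X) (e : Y) : bs * enorm e <= bs * enorm e -> exists x2, h x2 = hs X2 + e /\
    enorm (x2 - X2) <= b0 + b * Hm + (b0s + bs * enorm e).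
  move=> _; have [x2 hx2] := h_surj (hs X2 + e); have [x3 hx3] := hs_surj (hs X2 + e).
  exists x2; split => //; apply: le_trans (enorm_triangle _ _ _ x3 _) _; apply: lerD.
    apply: le_trans (h_inv _ _) _; rewrite lerD2l ler_wpM2l//.
    by rewrite hx2 -hx3; exact: H.
  by apply: le_trans (hs_inv _ _) _; rewrite hx3 addrAC subrr add0r.
have [u0 [hu0 u0X]] := state X0 e0 (lexx _).
have [u1 [hu1 u1X]] := state X1 e1 (lexx _).
have s1 : enorm (x' - u1) <= b0 + b * D.
  by apply: le_trans (h_inv _ _) _; rewrite lerD2l ler_wpM2l// hu1.
have s5 : enorm (f u0 - f x) <= a * (b0 + b * D).
  apply: le_trans (f_lip _ _) _; rewrite ler_wpM2l//.
  by apply: le_trans (h_inv _ _) _; rewrite lerD2l ler_wpM2l// hu0 enormC.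
have s4 : enorm (fs X0 - f u0) <= astar * (b0 + b * Hm + (b0s + bs * enorm e0)) + Fm.
  apply: le_trans (enorm_triangle _ _ _ (fs u0) _) _; apply: lerD.
    by apply: le_trans (fs_lip _ _) _; rewrite ler_wpM2l// enormC.
  by rewrite enormC.
have s3 : enorm (X1 - fs X0) <= G by rewrite X1E addrAC subrr add0r.
have := enorm_triangle _ _ x' u1 (f x).
have := enorm_triangle _ _ u1 X1 (f x).
have := enorm_triangle _ _ X1 (fs X0) (f x).
have := enorm_triangle _ _ (fs X0) (f u0) (f x).
rewrite /mismatch -/Hm -/Fm.
rewrite !mulrDl !mulrDr !mul1r !mulr1 in s4 s5 *.
lra.
Qed.

End transition_radius.

(** * Pathwise bound on the total variation distance *)

Lemma double_exponent n : (2 * n.+2 <= 4 * n.+1)%N.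
Proof. by lia. Qed.

Section pathwise.
Context (R : realType) (N p : nat).
Local Notation X := 'rV[R]_N.
Local Notation Y := 'rV[R]_p.
Variables (Q : R.-pker X ~> X) (g : X -> Y -> R) (y : nat -> Y) (M : R).
Hypothesis mg : forall k, measurable_fun setT (fun x => g x (y k)).
Hypothesis g0 : forall x k, 0 <= g x (y k).
Hypothesis gM : forall x k, g x (y k) <= M.
Hypothesis M1 : 1 <= M.
Variables (C : nat -> set X) (good : pred nat) (t H : R).
Hypothesis mC : forall k, measurable (C k).
Hypotheses (t0 : 0 <= t) (t1 : t <= 1).
Hypothesis out : forall k x, ~ C k x -> g x (y k) <= expR (- H) * M.
Hypothesis minor : forall k x x', good k -> C k x -> C k x' ->
  forall A, measurable A -> (t%:E * Q x' (A `&` C k.+1) <= Q x (A `&` C k.+1))%E.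
Variables (B : nat -> set X) (pen : nat -> R) (bb gam m0 : R).
Hypothesis mB : forall k, measurable (B k).
Hypotheses (bb0 : 0 < bb) (gam0 : 0 < gam) (m00 : 0 < m0).
Hypotheses (m01 : m0 <= gam) (m02 : m0 <= bb * gam).
Hypothesis pen0 : forall k, 0 <= pen k.
Hypothesis g_low : forall k x, B k x -> gam <= g x (y k).
Hypothesis Qlow : forall k x, B k x -> ((bb * expR (- pen k))%:E <= Q x (B k.+1))%E.

(** [filter_mass_lower] in exponential form: each of the n + 1 factors is at least
    [m0 * expR (- pen j)].  The penalty of the step 0 is added for uniformity. *)
Lemma filter_mass_expR (nu : probability X R) n u : 0 < u ->
  (one_step nu Q g (y 0%N) (B 1%N) = u%:E)%E ->
  expR (n.+1%:R * ln m0 - \sum_(j < n.+1) pen j + ln u)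
   <= filter_mass _ _ _ Q g y nu n.+1 setT.
Proof.
move=> u0 uE.
have bp0 k : 0 <= bb * expR (- pen k) by rewrite mulr_ge0 ?expR_ge0// ltW.
have := filter_mass_lower _ _ _ Q g y M mg g0 gM B (fun k => bb * expR (- pen k)) gam mB bp0
   (ltW gam0) g_low nu n (fun j x _ => Qlow j x).
rewrite uE -EFinM lee_fin; apply: le_trans.
rewrite expRD lnK ?posrE// ler_wpM2r ?(ltW u0)//.
rewrite expRD expRM_natl lnK ?posrE// exprS -mulrA; apply: ler_pM => //.
- exact: ltW.
- by rewrite mulr_ge0 ?expR_ge0// exprn_ge0// ltW.
have -> : expR (- (\sum_(j < n.+1) pen j)) = expR (- pen 0%N) * \prod_(j <- iota 1 n) expR (- pen j).
  rewrite -sumrN expR_sum big_ord_recl /=; congr (_ * _).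
  have -> : iota 1 n = index_iota 1 n.+1 by rewrite /index_iota subn1.
  rewrite big_add1/= big_mkord.
  exact: eq_bigr.
rewrite mulrCA; apply: (@le_trans _ _ (m0 ^+ n * \prod_(j <- iota 1 n) expR (- pen j))).
  rewrite ler_piMl ?mulr_ge0 ?exprn_ge0 ?(ltW m00)//.
    by apply: prodr_ge0 => j _; exact: expR_ge0.
  by rewrite expR_le1 oppr_le0.
have -> : m0 ^+ n = \prod_(j <- iota 1 n) m0 by rewrite big_const_seq count_predT size_iota iter_mulr_1.
rewrite -big_split/=.
apply: ler_prod => j _; rewrite mulr_ge0 ?expR_ge0 ?(ltW m00)//=.
by rewrite mulrAC ler_wpM2r ?expR_ge0.
Qed.

(** Let E be the exponent of the error term in [filter_distance].  If E >= 0 the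
    bound follows from the distance being at most 2, and otherwise E <= lam E
    because lam <= 1. *)
Lemma tv_filter_path (nu nu' : probability X R) n s u u' lam :
  0 < u -> 0 < u' -> 0 <= lam -> lam <= 1 ->
  (one_step nu Q g (y 0%N) (B 1%N) = u%:E)%E ->
  (one_step nu' Q g (y 0%N) (B 1%N) = u'%:E)%E ->
  (tv_norm (fun A => (filter_law nu Q g y n.+1 A - filter_law nu' Q g y n.+1 A)%R)
   <= (2 * (1 - t ^+ 2) ^+ (count good (iota 0 n.+1) - 1 - s.*2)
       + 2 * expR (lam * (n.+1%:R * (4 * ln M - 2 * ln m0) - s%:R * H
                 + 2 * \sum_(j < n.+1) pen j - ln u - ln u')))%:E)%E.
Proof.
move=> u0 u'0 l0 l1 uE u'E.
set rho := 1 - t ^+ 2; set e := (count _ _ - _ - _)%N; set E := _ - ln u'.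
have rhoe : 0 <= rho ^+ e by rewrite exprn_ge0// subr_ge0 exprn_ile1.
have [E0|E0] := leP 0 E.
  apply: le_trans (tv_filter_le2 _ _ _ Q g y M mg g0 gM nu nu' n.+1) _.
  rewrite lee_fin mulr1; apply: (@le_trans _ _ (2 * expR (lam * E))); last first.
    by rewrite lerDr mulr_ge0.
  by rewrite ler_peMr// -[leLHS]expR0 ler_expR mulr_ge0.
have hZ := filter_mass_expR nu n u u0 uE.
have hZ' := filter_mass_expR nu' n u' u'0 u'E.
set z := expR _ in hZ; set z' := expR _ in hZ'.
have z0 : 0 < z by exact: expR_gt0.
have z'0 : 0 < z' by exact: expR_gt0.
have Z0 := lt_le_trans z0 hZ; have Z'0 := lt_le_trans z'0 hZ'.
apply: (@le_trans _ _ (2 * (rho ^+ e + expR E))%:E); last first.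
  by rewrite lee_fin mulrDr lerD2l ler_pM2l// ler_expR ler_niMl// ltW.
apply: (tv_filter_le _ _ _ Q g y M mg g0 gM) => A mA.
apply: le_trans (filter_distance _ _ _ Q g y M mg g0 gM C good t (expR (- H)) mC t0 t1 _ out minor
   nu nu' n.+1 s A mA Z0 Z'0) _; first exact: expR_ge0.
rewrite lerD2l.
apply: (@le_trans _ _ ((M ^+ 2) ^+ n.+2 * expR (- H) ^+ s / (z * z'))).
  rewrite ler_wpM2l//; first by rewrite mulr_ge0 ?exprn_ge0 ?expR_ge0 ?(le_trans ler01 M1).
  by rewrite lef_pV2 ?posrE ?mulr_gt0// ler_pM// ?(ltW z0) ?(ltW z'0).
have M0 : 0 < M by exact: lt_le_trans M1.
have -> : expR (- H) ^+ s = expR (- (s%:R * H)) by rewrite -expRM_natl mulrN.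
apply: (@le_trans _ _ (expR (4 * n.+1%:R * ln M) * expR (- (s%:R * H)) / (z * z'))).
  rewrite ler_wpM2r ?invr_ge0 ?mulr_ge0 ?(ltW z0) ?(ltW z'0)// ler_wpM2r ?expR_ge0//.
  rewrite -exprM -natrM expRM_natl lnK ?posrE//; apply: ler_weXn2l => //.
  exact: double_exponent.
rewrite -expRD /z /z' -expRD -expRN -expRD ler_expR /E.
by rewrite le_eqVlt; apply/orP; left; apply/eqP; ring.
Qed.

End pathwise.

(** A large observation noise spoils the two steps that it ends and begins, a
    large state noise only one. *)
Lemma bad_count (good badU badA : pred nat) n :
  (forall k, ~~ good k -> [|| badU k, badU k.+1 | badA k.+1]) ->
  (n <= count good (iota 0 n) + (count badU (iota 0 n.+1)).*2 + count badA (iota 0 n.+1))%N.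
Proof.
move=> H.
(* the noise at time n has so far spoiled a single step *)
suff : (n + badU n <= count good (iota 0 n) + (count badU (iota 0 n.+1)).*2 + count badA (iota 0 n.+1))%N.
  by apply: leq_trans; exact: leq_addr.
elim: n => [|n IH]; first by rewrite /=; lia.
rewrite -[X in count good (iota 0 X)]addn1 iotaD count_cat.
rewrite -[X in count badU (iota 0 X)]addn1 (iotaD 0 n.+1 1) count_cat.
rewrite -[X in count badA (iota 0 X)]addn1 (iotaD 0 n.+1 1) count_cat /= ?add0n ?addn0.
have := H n; move: IH; rewrite /= ?add0n.
by case: (good n); case: (badU n); case: (badU n.+1); case: (badA n.+1) => /=; lia.
Qed.

Lemma prod_bad (R : realType) (w : R) (bad : pred nat) n :
  w ^+ count bad (iota 0 n) = \prod_(j < n) (if bad j then w else 1).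
Proof.
elim: n => [|n IH]; first by rewrite big_ord0.
rewrite -[X in iota 0 X]addn1 iotaD count_cat exprD IH big_ord_recr /=; congr (_ * _).
by rewrite ?add0n addn0; case: (bad n); rewrite ?expr1 ?expr0.
Qed.

(** Every missing good step costs a factor 1 / rho.  The costs of the two kinds of
    noise are separated by x z <= x^2 + z^2; as an observation noise is counted
    twice, this leads to the power 4. *)
Lemma good_power (R : realType) (rho : R) (good badU badA : pred nat) n s :
  0 < rho -> rho <= 1 ->
  (forall k, ~~ good k -> [|| badU k, badU k.+1 | badA k.+1]) ->
  rho ^+ (count good (iota 0 n) - 1 - s.*2) <= rho ^+ (n - 1 - s.*2) *
    (\prod_(j < n.+1) (if badU j then rho ^- 4 else 1)
     + \prod_(j < n.+1) (if badA j then rho ^- 4 else 1)).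
Proof.
move=> rho0 rho1 H; rewrite -!prod_bad.
have := bad_count _ _ _ n H.
set c := count good _; set bU := count badU _; set bA := count badA _ => cb.
have r1 : 1 <= rho^-1 by rewrite invf_ge1.
set v := rho^-1 in r1 *.
have v0 : 0 < v by rewrite invr_gt0.
have -> : rho ^- 4 = v ^+ 4 by rewrite exprVn.
apply: (@le_trans _ _ (rho ^+ (n - 1 - s.*2) * v ^+ (bU.*2 + bA))).
  have -> : v ^+ (bU.*2 + bA) = (rho ^+ (bU.*2 + bA))^-1 by rewrite /v exprVn.
  rewrite ler_pdivlMr ?exprn_gt0// -exprD; apply: ler_wiXn2l => //; first exact: ltW.
  by lia.
rewrite ler_wpM2l ?exprn_ge0 ?(ltW rho0)//.
rewrite exprD; set x := v ^+ bU.*2; set z := v ^+ bA.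
have x0 : 0 <= x by rewrite exprn_ge0// ltW.
have z0 : 0 <= z by rewrite exprn_ge0// ltW.
have -> : (v ^+ 4) ^+ bU = x ^+ 2.
  by rewrite /x -!exprM -muln2 -mulnA mulnC.
have : z ^+ 2 <= (v ^+ 4) ^+ bA.
  by rewrite /z -!exprM [(bA * 2)%N]mulnC; apply: ler_weXn2l => //; rewrite leq_mul2r orbT.
nra.
Qed.

(** * Measurability and moments of the initial weights *)

Section one_step_measurability.
Context (R : realType) (N p : nat).
Local Notation X := 'rV[R]_N.
Local Notation Y := 'rV[R]_p.
Variables (q : X -> X -> R) (f : X -> X) (Q : R.-pker X ~> X) (h : X -> Y) (upsilon : Y -> R).
Hypothesis mf : measurable_fun setT f.
Hypothesis mh : measurable_fun setT h.
Hypothesis mu : measurable_fun setT upsilon.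
Hypothesis u0 : forall v, 0 <= upsilon v.
Hypothesis mq : measurable_fun setT (fun xu : X * X => q xu.1 xu.2).
Hypothesis q0 : forall x u, 0 <= q x u.
Hypothesis QE : forall x A, measurable A ->
  (Q x A = \int[lebesgue_rV R N]_(x' in A) (q x (x' - f x))%:E)%E.

(** The density of the kernel turns this into an integral over x' of a jointly
    measurable function of (x, y) and x'. *)
Lemma measurable_kernel_fiber D :
  measurable_fun setT (fun xy : X * Y => Q xy.1 (near_fiber h xy.2 D)).
Proof.
pose S : set ((X * Y) * X) := [set z | enorm (h z.2 - z.1.2) <= D].
have mS : measurable S.
  apply: measurable_fun_le_set; apply: measurableT_comp; first exact: measurable_enorm.
  apply: (@measurable_subrV R p _ ((X * Y) * X)%type (fun z => h z.2) (fun z => z.1.2)).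
    exact: measurableT_comp.
  exact: measurableT_comp.
pose F (z : (X * Y) * X) : \bar R := (q z.1.1 (z.2 - f z.1.1) * \1_S z)%:E.
have mF : measurable_fun setT F.
  apply/measurable_EFinP; apply: measurable_funM; last exact: measurable_indic.
  apply: (measurableT_comp (f := fun xu : X * X => q xu.1 xu.2)
     (g := fun z : (X * Y) * X => (z.1.1, z.2 - f z.1.1))) => //.
  have m11 : measurable_fun setT (fun z : (X * Y) * X => z.1.1).
    by apply: (measurableT_comp (f := fst) (g := fst)).
  apply/measurable_fun_pairP; split; first exact: m11.
  apply: (@measurable_subrV R N _ ((X * Y) * X)%type (fun z => z.2) (fun z => f z.1.1)).
    exact: measurable_snd.
  exact: (measurableT_comp mf m11).
have F0 z : (0 <= F z)%E by rewrite lee_fin mulr_ge0.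
have := @measurable_fun_fubini_tonelli_F _ _ _ _ _ (lebesgue_rV R N) F mF F0.
congr (measurable_fun _ _); apply/funext => -[x y]; rewrite /fubini_F /F /=.
rewrite QE; last exact: measurable_near_fiber.
rewrite [RHS]integral_mkcond; apply: eq_integral => x' _.
rewrite patchE indicE (_ : (_ \in S) = (x' \in near_fiber h y D)); last first.
  by apply/idP/idP; rewrite !inE.
by case: (_ \in _); rewrite ?mulr1 ?mulr0.
Qed.

Lemma measurable_one_step (nu : probability X R) D :
  measurable_fun setT (fun yy : Y * Y =>
    one_step nu Q (likelihood h upsilon) yy.1 (near_fiber h yy.2 D)).
Proof.
pose F (z : (Y * Y) * X) : \bar R :=
  ((upsilon (z.1.1 - h z.2))%:E * Q z.2 (near_fiber h z.1.2 D))%E.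
have mF : measurable_fun setT F.
  apply: emeasurable_funM.
    apply/measurable_EFinP; apply: measurableT_comp => //.
    apply: (@measurable_subrV R p _ ((Y * Y) * X)%type (fun z => z.1.1) (fun z => h z.2)).
      exact: measurableT_comp.
    exact: measurableT_comp.
  apply: (measurableT_comp (f := fun xy : X * Y => Q xy.1 (near_fiber h xy.2 D))
     (g := fun z : (Y * Y) * X => (z.2, z.1.2))); first exact: measurable_kernel_fiber.
  apply/measurable_fun_pairP; split; first exact: measurable_snd.
  exact: (measurableT_comp (f := snd) (g := fst)).
have F0 z : (0 <= F z)%E by rewrite mule_ge0// lee_fin.
exact: (@measurable_fun_fubini_tonelli_F _ _ _ _ _ nu F mF F0).
Qed.

End one_step_measurability.

Section initial_weight.
Context (R : realType).

(** The exponential of c times the negative part of log r. *)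
Definition initial_weight (c r : R) : \bar R :=
  if r <= 0 then +oo%E else (expR (c * Num.max (- ln r) 0))%:E.

Lemma initial_weightE c r : 0 < c ->
  initial_weight c r = expeR (c%:E * neg_part (lne r%:E))%E.
Proof.
move=> c0; rewrite /initial_weight /neg_part /=; case: ifPn => [r0|r0] /=.
  by rewrite max_l ?leey// mulry gtr0_sg// mul1e.
by rewrite -EFin_max -EFinM.
Qed.

Lemma initial_weight_ge0 c r : (0 <= initial_weight c r)%E.
Proof. by rewrite /initial_weight; case: ifP => _ //; rewrite lee_fin expR_ge0. Qed.

Lemma measurable_initial_weight c : measurable_fun setT (initial_weight c).
Proof.
apply: measurable_fun_ifT.
- apply: (measurable_fun_bool true).
  rewrite setTI (_ : _ @^-1` _ = [set r : R | r <= 0]); last by apply/seteqP; split.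
  by apply: measurable_fun_le_set.
- exact: measurable_cst.
- apply/measurable_EFinP; apply: measurableT_comp; first exact: measurable_expR.
  apply: measurable_funM => //; apply: measurable_maxr => //.
  by apply: measurableT_comp => //; exact: measurable_ln.
Qed.

Lemma initial_weight_le c c' r : c <= c' -> (initial_weight c r <= initial_weight c' r)%E.
Proof.
move=> cc'; rewrite /initial_weight; case: ifP => _ //.
by rewrite lee_fin ler_expR ler_wpM2r// le_max lexx orbT.
Qed.

Lemma amgm4 (x y z t : R) : 0 <= x -> 0 <= y -> 0 <= z -> 0 <= t ->
  x * y * z * t <= x ^+ 4 + y ^+ 4 + z ^+ 4 + t ^+ 4.
Proof.
have sq (v w : R) : 0 <= v -> 0 <= w -> v * w <= v ^+ 2 + w ^+ 2 by move=> ? ?; nra.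
move=> x0 y0 z0 t0; rewrite -mulrA.
apply: le_trans (sq (x * y) (z * t) _ _) _; rewrite ?mulr_ge0//.
rewrite !exprMn -addrA; have e4 (v : R) : v ^+ 4 = (v ^+ 2) ^+ 2 by rewrite -exprM.
by rewrite !e4; apply: lerD; apply: sq; rewrite exprn_ge0.
Qed.

(** The four factors are dependent, so their product is replaced by the sum of
    their fourth powers before any expectation is taken. *)
Lemma split_weights (lam c S S0 S1 u u' : R) : 0 <= lam -> 0 < u -> 0 < u' -> S <= S0 + S1 ->
  ((expR (lam * (c + 2 * S - ln u - ln u')))%:E <=
   (expR (lam * c))%:E * ((expR (8 * lam * S0))%:E + (expR (8 * lam * S1))%:E
      + initial_weight (4 * lam) u + initial_weight (4 * lam) u'))%E.
Proof.
move=> l0 u0 u'0 SS.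
have /negbTE un : ~~ (u <= 0) by rewrite -ltNge.
have /negbTE u'n : ~~ (u' <= 0) by rewrite -ltNge.
rewrite /initial_weight un u'n -!EFinD -EFinM lee_fin.
apply: (@le_trans _ _ (expR (lam * c) * (expR (2 * lam * S0) * expR (2 * lam * S1) *
   expR (lam * - ln u) * expR (lam * - ln u')))).
  rewrite -!expRD ler_expR.
  have : lam * (S0 + S1 - S) >= 0 by rewrite mulr_ge0// subr_ge0.
  lra.
rewrite ler_wpM2l ?expR_ge0//.
apply: le_trans (amgm4 _ _ _ _ _ _ _ _) _; rewrite ?expR_ge0// -!expRM_natl.
have w v : expR (4%:R * (lam * - ln v)) <= expR (4 * lam * Num.max (- ln v) 0).
  by rewrite ler_expR mulrA ler_wpM2l ?mulr_ge0// le_max lexx.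
rewrite !lerD// le_eqVlt; apply/orP; left; apply/eqP; congr expR; ring.
Qed.

End initial_weight.

(** * Rates *)

Lemma tail_small d (T : measurableType d) (R : realType) (P : probability T R)
    (F : T -> R) (e : R) : measurable_fun setT F -> 0 < e ->
  exists2 L, 0 <= L & forall L', L <= L' -> (P [set w | (L' < F w)%R] <= e%:E)%E.
Proof.
move=> mF e0.
have mE c : measurable [set w | c < F w].
  have := mF measurableT `]c, +oo[%classic (measurable_itv _).
  by rewrite setTI; congr measurable; apply/seteqP; split => t /=; rewrite in_itv/= andbT.
pose E n := [set w | n%:R < F w].
have cvgE : P (E n) @[n --> \oo] --> P (\bigcap_n E n).
  apply: nonincreasing_cvg_mu => //.
  - by rewrite (le_lt_trans (probability_le1 _ _)) ?ltry//; exact: mE.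
  - by move=> n; exact: mE.
  - by apply: bigcapT_measurable => n; exact: mE.
  - by move=> m n mn; apply/subsetPset => w /=; apply: le_lt_trans; rewrite ler_nat.
have cap0 : \bigcap_n E n = set0.
  apply/seteqP; split => // w /= /(_ (Num.truncn (F w)).+1 Logic.I) /=.
  by rewrite /E /= ltNge ltW// truncnS_gt.
rewrite cap0 measure0 in cvgE.
have [n Pn] : exists n, (P (E n) < e%:E)%E.
  apply: contrapT => /forallNP h.
  have : (e%:E <= limn (fun n => P (E n)))%E.
    apply: lime_ge; first by apply/cvg_ex; eexists; exact: cvgE.
    by apply: nearW => n; rewrite leNgt; apply/negP; exact: h.
  by rewrite (cvg_lim _ cvgE)// lee_fin leNgt e0.
exists n%:R => // L' nL; apply: ltW; apply: le_lt_trans Pn.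
apply: le_measure; rewrite ?inE; [exact: mE|exact: mE|].
by move=> w /=; exact: le_lt_trans.
Qed.

Lemma le_lne (R : realType) (x y : \bar R) : (x <= y)%E -> (lne x <= lne y)%E.
Proof.
move=> xy; have [x0|x0] := leP x 0%E; first by rewrite le0_lneNy// leNye.
by rewrite lee_lne// in_itv/= leey andbT ltW// (lt_le_trans x0).
Qed.

Lemma limn_esup_neg (R : realType) (u : nat -> \bar R) (K delta : R) :
  0 < K -> 0 < delta ->
  (forall n, (0 < n)%N -> (u n <= (K * expR (- (delta * n%:R)))%:E)%E) ->
  (limn_esup (fun n => (n%:R^-1)%:E * lne (u n)) < 0)%E.
Proof.
move=> K0 d0 uK.
apply: (@le_lt_trans _ _ (- (delta / 2))%:E); last by rewrite lte_fin oppr_lt0 divr_gt0.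
rewrite limn_esup_lim; apply: lime_le; first exact: is_cvg_esups.
near=> n; apply: ge_ereal_sup => _ [m /= nm <-].
have n0 : (0 < n)%N by near: n; exact: nbhs_infty_gt.
have m0 : (0 < m)%N by exact: leq_trans nm.
have mR : 0 < m%:R :> R by rewrite ltr0n.
apply: (@le_trans _ _ ((m%:R^-1)%:E * (ln K - delta * m%:R)%:E)%E).
  apply: lee_wpmul2l; first by rewrite lee_fin invr_ge0.
  apply: le_trans (le_lne _ _ _ (uK m m0)) _.
  rewrite lne_EFin ?mulr_gt0 ?expR_gt0// lnM ?posrE ?expR_gt0// expRK.
  by rewrite lexx.
rewrite -EFinM lee_fin mulrC ler_pdivrMr//.
have : ln K * 2 / delta <= m%:R.
  apply: (@le_trans _ _ n%:R); last by rewrite ler_nat.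
  by near: n; exact: nbhs_infty_ger.
rewrite ler_pdivrMr//; lra.
Unshelve. all: by end_near. Qed.

Lemma three_quarters_left n : (3 * n <= 4 * (n - 1 - (n %/ 8).*2) + 4)%N.
Proof. by lia. Qed.

Lemma lt_eight_quotient n : (n <= 8 * (n %/ 8) + 8)%N.
Proof. by lia. Qed.

(** After the loss of 2 (n / 8) steps, about 3 n / 4 factors 1 - theta remain,
    against a growth of at most (1 + theta / 8)^n. *)
Lemma rate_coupled (R : realType) (theta a1 : R) n :
  0 <= theta -> theta <= 1 -> 0 <= a1 -> a1 <= 1 + theta / 8 ->
  (1 - theta) ^+ (n - 1 - (n %/ 8).*2) * a1 ^+ n.+1 <= expR 2 * expR (- (theta / 2 * n%:R)).
Proof.
move=> th0 th1 a10 a1th.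
set j := (n - 1 - _)%N.
have jn : 3 * n%:R <= 4 * j%:R + 4 :> R.
  by have := three_quarters_left n; rewrite -/j -(ler_nat R) natrD !natrM.
have h1 : (1 - theta) ^+ j <= expR (- (theta * j%:R)).
  have -> : - (theta * j%:R) = j%:R * - theta by ring.
  rewrite expRM_natl; apply: lerXn2r; rewrite ?nnegrE ?expR_ge0//.
    by rewrite subr_ge0.
  exact: expR_ge1Dx.
have h2 : a1 ^+ n.+1 <= expR (theta / 8 * n.+1%:R).
  rewrite mulrC expRM_natl; apply: lerXn2r; rewrite ?nnegrE ?expR_ge0//.
  exact: le_trans a1th (expR_ge1Dx _).
apply: le_trans (ler_pM _ _ h1 h2) _; rewrite ?exprn_ge0 ?subr_ge0//.
rewrite -!expRD ler_expR -[n.+1%:R]natr1.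
have tn : 0 <= theta * n%:R by rewrite mulr_ge0.
have := ler_wpM2l th0 jn; lra.
Qed.

(** H is chosen so that n / 8 exits pay for the growth exp(lam k n) K1^n and leave
    e^(-n). *)
Lemma rate_weights (R : realType) (lam k K1 K0 H : R) n :
  0 < lam -> 1 <= K1 -> 0 <= K0 -> H = 8 * `|k| + 8 * (ln K1 + 1) / lam ->
  expR (lam * (n%:R * k - (n %/ 8)%:R * H)) * (K1 ^+ n + K1 ^+ n + K0)
    <= (2 + K0) * expR (lam * H) * expR (- n%:R).
Proof.
move=> l0 K11 K00 HE.
have K1p : 0 < K1 by exact: lt_le_trans K11.
have lnK1 : 0 <= ln K1 by exact: ln_ge0.
have H0 : 0 <= H.
  by rewrite HE addr_ge0 ?mulr_ge0 ?invr_ge0 ?(ltW l0) ?addr_ge0.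
have sn : n%:R <= 8 * (n %/ 8)%:R + 8 :> R.
  by have := lt_eight_quotient n; rewrite -(ler_nat R) natrD natrM.
have K1n : 1 <= K1 ^+ n by exact: exprn_ege1.
apply: (@le_trans _ _ (expR (lam * (n%:R * k - (n %/ 8)%:R * H)) * ((2 + K0) * K1 ^+ n))).
  rewrite ler_wpM2l ?expR_ge0//; nra.
rewrite mulrCA -mulrA ler_wpM2l ?addr_ge0//.
have -> : K1 ^+ n = expR (n%:R * ln K1) by rewrite expRM_natl lnK.
rewrite -!expRD ler_expR.
have lH : lam * H = 8 * lam * `|k| + 8 * (ln K1 + 1).
  by rewrite HE; field; rewrite gt_eqF.
have e1 : n%:R * (lam * H) <= 8 * ((n %/ 8)%:R * (lam * H)) + 8 * (lam * H).
  have := ler_wpM2r (mulr_ge0 (ltW l0) H0) sn; lra.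
have e2 : n%:R * (lam * k) <= n%:R * (lam * `|k|).
  by apply: ler_wpM2l; rewrite ?ler0n//; apply: ler_wpM2l; rewrite ?ler_norm// ltW.
have e3 : n%:R * (lam * H) = 8 * (n%:R * (lam * `|k|)) + 8 * (n%:R * (ln K1 + 1)).
  by rewrite lH; ring.
have -> : lam * (n%:R * k - (n %/ 8)%:R * H) = n%:R * (lam * k) - (n %/ 8)%:R * (lam * H) by ring.
nra.
Qed.

Lemma le_sum_even_odd (R : realType) (F : nat -> R) n : (forall k, 0 <= F k) ->
  \sum_(j < n) F j <= \sum_(j < n) F j.*2 + \sum_(j < n) F j.*2.+1.
Proof.
move=> F0.
have H m : \sum_(j < m.*2) F j = \sum_(j < m) F j.*2 + \sum_(j < m) F j.*2.+1.
  elim: m => [|m IH]; first by rewrite !big_ord0 addr0.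
  by rewrite doubleS !big_ord_recr/= IH; lra.
rewrite -H -addnn -(big_mkord xpredT F) -(big_mkord xpredT F).
by rewrite [leRHS](big_cat_nat (n := n)) ?leq_addr//= lerDl sumr_ge0.
Qed.

Lemma tv_norm_ge0 d (T : measurableType d) (R : realType) (xi : set T -> R) :
  (0 <= tv_norm xi)%E.
Proof.
apply: (@le_trans _ _ (\sum_(i < 1) `|xi setT|)%:E).
  by rewrite lee_fin sumr_ge0.
apply: ereal_sup_ubound; exists 1%N, (fun=> setT); split => //.
- by move=> i j _ _ _; rewrite !ord1.
- by apply/seteqP; split => // x _; exists ord0.
Qed.

Lemma bernoulli_bound d (T : measurableType d) (R : realType) (P : probability T R)
    (F : T -> R) (L w p : R) : measurable_fun setT F -> 1 <= w ->
  (P [set x | (L < F x)%R] <= p%:E)%E ->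
  (\int[P]_x (if (L < F x)%R then w else 1%R)%:E <= (1 + p * (w - 1))%:E)%E.
Proof.
move=> mF w1 Pp.
have mE : measurable [set x | L < F x].
  have := mF measurableT `]L, +oo[%classic (measurable_itv _).
  by rewrite setTI; congr measurable; apply/seteqP; split => t /=; rewrite in_itv/= andbT.
have -> : (\int[P]_x (if (L < F x)%R then w else 1%R)%:E =
   \int[P]_x (1%:E + (w - 1)%:E * (\1_[set x | (L < F x)%R] x)%:E))%E.
  apply: eq_integral => x _; rewrite indicE.
  case: ifPn => LF; first by rewrite mem_set// mule1 -EFinD addrC subrK.
  by rewrite memNset ?mule0 ?adde0//; exact/negP.
have m1 : measurable_fun setT (fun x => (\1_[set x | (L < F x)%R] x : R)%:E).
  by apply/measurable_EFinP; exact: measurable_indic.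
rewrite ge0_integralD//; last 2 first.
- by move=> x _; rewrite mule_ge0 ?lee_fin ?subr_ge0.
- exact: measurable_funeM.
rewrite integral_cst// [X in (1%:E * X)%E]probability_setT mule1 ge0_integralZl//; last first.
  by rewrite lee_fin subr_ge0.
rewrite integral_indic// setIT [leRHS]EFinD; apply: leeD2l.
rewrite [p * _]mulrC [leRHS]EFinM; apply: lee_wpmul2l => //.
by rewrite lee_fin subr_ge0.
Qed.

(** * Degenerate cases *)

(** The noise is controlled by [g_+^*] on (0, 1) only, which the uniform variables
    leave on a null set. *)
Lemma uniform_interior d (T : measurableType d) (R : realType) (P : probability T R)
    (A : nat -> {mfun T >-> R}) :
  (forall k B, measurable B -> P (A k @^-1` B) = uniform_prob (@ltr01 R) B) ->
  exists N0 : set T, [/\ measurable N0, P N0 = 0%E &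
    forall w, ~ N0 w -> forall k, 0 < A k w < 1].
Proof.
move=> AU.
pose E k := A k @^-1` (~` `]0, 1[%classic).
have mpre k B : measurable B -> measurable (A k @^-1` B).
  move=> mB; rewrite -[X in measurable X]setTI.
  have mA : measurable_fun setT (A k) by [].
  exact: mA.
have mI : measurable (`]0, 1[%classic : set R) by exact: measurable_itv.
have mCI : measurable (~` `]0, 1[%classic : set R) by apply: measurableC.
have mE k : measurable (E k) by exact: mpre.
have E0 k : P (E k) = 0%E.
  have -> : E k = ~` (A k @^-1` `]0, 1[%classic) by [].
  rewrite probability_setC; [|exact: (mpre k _ mI)].
  rewrite AU//.
  rewrite /uniform_prob (eq_integral (fun=> 1%:E)); last first.
    move=> x; rewrite inE/= in_itv/= => /andP[x0 x1].
    by rewrite /uniform_pdf (ltW x0) (ltW x1) subr0 invr1.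
  by rewrite integral_cst//= lebesgue_measure_itv/= lte_fin ltr01 mul1e -!EFinB subr0 subrr.
exists (\bigcup_k E k); split.
- exact: bigcupT_measurable.
- apply/eqP; rewrite eq_le measure_ge0 andbT.
  apply: (@le_trans _ _ (\sum_(k <oo) P (E k))%E).
    by apply: measure_sigma_subadditive; [exact: mE|exact: bigcupT_measurable|].
  by rewrite eseries0// => k _ _; exact: E0.
- move=> w nE k; apply: contrapT => h; apply: nE; exists k => //=.
Qed.

(** The state space is a single point, so the two initial distributions agree. *)
Lemma tv_dim0 (R : realType) p (Q : R.-pker 'rV[R]_0 ~> 'rV[R]_0)
    (g : 'rV[R]_0 -> 'rV[R]_p -> R) (y : nat -> 'rV[R]_p) (nu nu' : probability 'rV[R]_0 R) n :
  tv_norm (fun A => filter_law nu Q g y n A - filter_law nu' Q g y n A) = 0%E.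
Proof.
have E A : filter_law nu Q g y n A = filter_law nu' Q g y n A.
  have U B (m : probability 'rV[R]_0 R) : unnormalized_filter m Q g y n B
      = ((g 0 (y 0%N))%:E * future_integral Q g y B n 0 0)%E.
    rewrite /unnormalized_filter.
    rewrite (eq_integral (cst ((g 0 (y 0%N))%:E * future_integral Q g y B n 0 0)%E)).
      by rewrite integral_cst// [X in (_ * X)%E]probability_setT mule1.
    by move=> x _; rewrite (thinmx0 x).
  by rewrite /filter_law !U.
apply/eqP; rewrite eq_le tv_norm_ge0 andbT.
apply: ge_ereal_sup => _ [m [F [_ _ _ ->]]].
by rewrite big1// => i _; rewrite E subrr normr0.
Qed.

(** In positive dimension there are points arbitrarily far apart, which
    forces the signs of the constants. *)
Lemma dimension_signs (R : realType) (N p : nat) (f fs : 'rV[R]_N -> 'rV[R]_N)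
   (h : 'rV[R]_N -> 'rV[R]_p) (a b0 b astar : R) : (0 < N)%N ->
  (forall x1 x2, enorm (f x1 - f x2) <= a * enorm (x1 - x2)) ->
  (forall x1 x2, enorm (fs x1 - fs x2) <= astar * enorm (x1 - x2)) ->
  (forall x1 x2, enorm (x1 - x2) <= b0 + b * enorm (h x1 - h x2)) ->
  [/\ 0 <= a, 0 <= astar, 0 <= b0 & 0 < b].
Proof.
move=> N0 f_lip fs_lip h_inv.
have i0 : 'I_N by exact: (Ordinal N0).
have far c : 0 <= c -> c <= enorm (const_mx c - 0 : 'rV[R]_N).
  move=> c0; apply: le_trans (coord_le_enorm _ _ _ i0).
  by rewrite subr0 mxE ger0_norm.
have one : 0 < enorm (const_mx 1 - 0 : 'rV[R]_N) by exact: lt_le_trans (far 1 ler01).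
have lip (u : 'rV[R]_N -> 'rV[R]_N) c :
    (forall x1 x2, enorm (u x1 - u x2) <= c * enorm (x1 - x2)) -> 0 <= c.
  move=> H; have := le_trans (enorm_ge0 _ _ _) (H (const_mx 1) 0).
  by rewrite pmulr_lge0.
have b00 : 0 <= b0.
  by have := h_inv 0 0; rewrite !subrr !enorm0 mulr0 addr0.
split; [exact: lip f_lip|exact: lip fs_lip|exact: b00|].
rewrite ltNge; apply/negP => b_le0.
have := le_trans (far (b0 + 1) _) (h_inv (const_mx (b0 + 1)) 0).
have : b * enorm (h (const_mx (b0 + 1)) - h 0) <= 0 by rewrite mulr_le0_ge0 ?enorm_ge0.
move=> h1 /(_ (addr_ge0 b00 ler01)); lra.
Qed.

(** * Forgetting in expectation *)

(** An infinite initial weight makes the bound trivial. *)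
Lemma le_add_infinite (R : realType) (c x y : R) (v z u1 u2 : \bar R) :
  0 < c -> (0 <= v)%E -> (0 <= u1)%E -> (0 <= u2)%E -> u1 = +oo%E \/ u2 = +oo%E ->
  (z <= v + c%:E * (x%:E + y%:E + u1 + u2))%E.
Proof.
move=> c0 v0 u10 u20 uoo.
have -> : (x%:E + y%:E + u1 + u2 = +oo)%E.
  case: uoo u10 u20 => -> u10 u20; first by case: u2 u20.
  by case: u1 u10.
rewrite mulry gtr0_sg// mul1e addey ?leey//.
by rewrite gt_eqF// (lt_le_trans _ v0).
Qed.

Lemma sqr_quarter (R : realType) (t : R) : 0 <= t -> t <= 4^-1 -> t ^+ 2 <= 16^-1.
Proof.
move=> t0 t4; have h : 4 * t <= 1 by lra.
suff : 16 * t ^+ 2 <= 1 by move: (t ^+ 2) => v; lra.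
rewrite expr2; nra.
Qed.

(** When bad steps have probability 1 / 240, the middle term is the mean weight
    of a step.  The constant is 8 times the constant 30 in the linear bound on
    (1 - theta)^(-4). *)
Lemma tail_weight_bound (R : realType) (theta : R) : 0 <= theta -> theta <= 16^-1 ->
  1 <= (1 - theta) ^- 4 /\ 1 + 240^-1 * ((1 - theta) ^- 4 - 1) <= 1 + theta / 8.
Proof.
move=> th0 th1; suff [w1 w2] : 1 <= (1 - theta) ^- 4 /\ (1 - theta) ^- 4 <= 1 + 30 * theta.
  by split => //; move: (_ ^- 4) w2 => v v2; lra.
have p0 : 0 < 1 - theta by lra.
have w0 : 0 < (1 - theta) ^+ 4 by rewrite exprn_gt0.
split; first by rewrite -exprVn exprn_ege1// invf_ge1//; lra.
rewrite -[leLHS]mul1r ler_pdivrMr//.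
have : 1 - 4 * theta <= (1 - theta) ^+ 4.
  have -> : (1 - theta) ^+ 4 = ((1 - theta) ^+ 2) ^+ 2 by rewrite -exprM.
  have h : 1 - 2 * theta <= (1 - theta) ^+ 2 by rewrite expr2; nra.
  rewrite [leRHS]expr2; nra.
by move: (_ ^+ 4) => v hv; have := mulr_ge0 th0 th0; nra.
Qed.

(** The exponents 8 lam and 4 lam are those produced by [split_weights]. *)
Lemma exponent_choice (R : realType) (tau lam' : R) : 0 < tau -> 0 < lam' ->
  exists lam, [/\ 0 < lam, lam <= 1, 8 * lam < tau & 4 * lam <= lam'].
Proof.
move=> tau0 lam0.
have h1 : Num.min 1 (Num.min (tau / 16) (lam' / 4)) <= tau / 16 by rewrite !ge_min lexx !orbT.
have h2 : Num.min 1 (Num.min (tau / 16) (lam' / 4)) <= lam' / 4 by rewrite !ge_min lexx !orbT.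
exists (Num.min 1 (Num.min (tau / 16) (lam' / 4))).
split; [by rewrite !lt_min ltr01 !divr_gt0|by rewrite ge_min lexx|lra|lra].
Qed.

Section forgetting.
Context (R : realType) (N p : nat).
Local Notation X := 'rV[R]_N.
Local Notation Y := 'rV[R]_p.
Variables (f : X -> X) (h : X -> Y) (upsilon : Y -> R) (q : X -> X -> R) (Q : R.-pker X ~> X).
Hypothesis mf : measurable_fun setT f.
Hypothesis mh : measurable_fun setT h.
Hypothesis mups : measurable_fun setT upsilon.
Hypothesis ups0 : forall u, 0 <= upsilon u.
Hypothesis mq : measurable_fun setT (fun xu : X * X => q xu.1 xu.2).
Hypothesis q0 : forall x u, 0 <= q x u.
Hypothesis QE : forall x A, measurable A ->
  (Q x A = \int[lebesgue_rV R N]_(x' in A) (q x (x' - f x))%:E)%E.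
Variables (psi : X -> R) (mum mup : R).
Hypothesis (mum0 : 0 < mum) (mup0 : 0 < mup).
Hypothesis q_pm : forall r, 0 <= r ->
  (0 < q_minus mum psi r)%E /\ (q_minus mum psi r <= q_plus mup psi r)%E /\
  (q_plus mup psi r < +oo)%E.
Hypothesis q_bounds : forall x u, mum * psi u <= q x u /\ q x u <= mup * psi u.
Variables (fs : X -> X) (hs : X -> Y) (a b0 b astar b0s bs : R).
Hypothesis a0 : 0 <= a.
Hypothesis b00 : 0 <= b0.
Hypothesis b_ge0 : 0 <= b.
Hypothesis as0 : 0 <= astar.
Hypothesis b0s0 : 0 <= b0s.
Hypothesis bs0 : 0 <= bs.
Hypothesis f_lip : forall x1 x2, enorm (f x1 - f x2) <= a * enorm (x1 - x2).
Hypothesis h_surj : forall y, exists x, h x = y.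
Hypothesis h_inv : forall x1 x2, enorm (x1 - x2) <= b0 + b * enorm (h x1 - h x2).
Hypothesis fs_lip : forall x1 x2, enorm (fs x1 - fs x2) <= astar * enorm (x1 - x2).
Hypothesis hs_surj : forall y, exists x, hs x = y.
Hypothesis hs_inv : forall x1 x2, enorm (x1 - x2) <= b0s + bs * enorm (hs x1 - hs x2).
Hypothesis f_mis : (supnorm (fun x => f x - fs x)%R < +oo)%E.
Hypothesis h_mis : (supnorm (fun x => h x - hs x)%R < +oo)%E.
Context d (T : measurableType d) (P : probability T R).
Variables (gstar : X -> R -> X) (qstar : X -> X -> R)
  (Xs zs : nat -> {RV P >-> X}) (es Ys : nat -> {RV P >-> Y}) (As : nat -> {RV P >-> R}).
Hypothesis obs : observation_process fs hs gstar qstar Xs zs es Ys As.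
Variable gplus : R -> R.
Hypothesis mgplus : measurable_fun setT gplus.
Hypothesis gstar_bound : forall x u, 0 < u -> u < 1 -> enorm (gstar x u) <= gplus u.
Variables (nu nu' : probability X R) (Delta : R).
Hypothesis Delta0 : 0 < Delta.

Local Notation g := (likelihood h upsilon).
Local Notation kap := (mismatch f fs h hs b0 b astar).

(** A bound on the distance from x' to f(x) for x, x' in two successive fibres of
    width D, apart from the contribution of the noises. *)
Definition step_radius D := (a + 1) * b0 + (a + 1) * b * D + kap + (1 + astar) * b0s.

Definition step_radius_at c (v : Y * Y * R) :=
  c + astar * bs * enorm v.1.1 + bs * enorm v.1.2 + gplus v.2.

Definition noise_block := block d T _ Y _ R es As.

Lemma step_radius_ge0 D : 0 <= D -> 0 <= step_radius D.
Proof.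
move=> D0; have kap0 : 0 <= kap by exact: mismatch_ge0.
rewrite /step_radius; move: (mismatch _ _ _ _ _ _ _) kap0 => K K0.
by rewrite !(addr_ge0, mulr_ge0).
Qed.

Lemma path_radius w k D x x' : 0 < As k.+1 w < 1 ->
  near_fiber h (Ys k w) D x -> near_fiber h (Ys k.+1 w) D x' ->
  enorm (x' - f x) <= step_radius_at (step_radius D) (es k w, es k.+1 w, As k.+1 w).
Proof.
move=> /andP[A0 A1]; rewrite !(obs_obs obs).
move=> xD x'D; apply: (transition_radius _ _ _ f fs h hs a b0 b astar b0s bs
  a0 b_ge0 as0 f_lip h_surj h_inv fs_lip hs_surj hs_inv f_mis h_mis
  (Xs k w) (Xs k.+1 w) (zs k.+1 w) (es k w) (es k.+1 w)) => //.
  by rewrite (obs_state obs).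
by rewrite (obs_noise obs); exact: gstar_bound.
Qed.

Lemma gplus_ge0 w k : 0 < As k w < 1 -> 0 <= gplus (As k w).
Proof. by move=> /andP[A0 A1]; apply: le_trans (gstar_bound 0 _ A0 A1); exact: enorm_ge0. Qed.

Lemma one_step_fin M (m : probability X R) y0 y1 : 0 <= M -> (forall u, upsilon u <= M) ->
  one_step m Q g y0 (near_fiber h y1 Delta) \is a fin_num.
Proof.
move=> M0 upsM; have mg : measurable_fun setT (fun x => g x y0).
  by apply: (measurableT_comp (f := upsilon)) => //; apply: (@measurable_subrV R p _ X (fun=> y0) h).
rewrite ge0_fin_numE; last first.
  by apply: integral_ge0 => x _; rewrite mule_ge0// lee_fin; exact: ups0.
apply: (@le_lt_trans _ _ (\int[m]_x (cst M%:E x))%E).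
  apply: ge0_le_integral => //.
  - by move=> x _; rewrite mule_ge0// lee_fin; exact: ups0.
  - apply: emeasurable_funM; first exact/measurable_EFinP.
    by apply: (measurable_kernel Q); exact: measurable_near_fiber.
  - move=> x _; rewrite -[leRHS]mule1 lee_pmul ?lee_fin//; [exact: ups0|exact: upsM|].
    rewrite -(prob_kernel (s := Q) x); apply: le_measure; rewrite ?inE//.
    exact: measurable_near_fiber.
by rewrite integral_cst// [X in (_ * X)%E]probability_setT mule1 ltry.
Qed.

Section path.
Variables (M gam l H D1 L t lam c : R).
Hypothesis M1 : 1 <= M.
Hypothesis upsM : forall u, upsilon u <= M.
Hypothesis gam0 : 0 < gam.
Hypothesis upsgam : forall u, enorm u <= Delta -> gam <= upsilon u.
Hypothesis l0 : 0 < l.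
Hypothesis vol : forall y, (l%:E <= lebesgue_rV R N (near_fiber h y Delta))%E.
Hypothesis D10 : 0 <= D1.
Hypothesis upsD1 : forall u, D1 <= enorm u -> upsilon u < expR (- H) * M.
Hypothesis L0 : 0 <= L.
Let rb := step_radius D1 + astar * bs * L + bs * L + L.
Hypothesis t0 : 0 <= t.
Hypothesis t1 : t < 1.
Hypothesis tq : t * qhigh _ _ psi mup rb <= qlow _ _ psi mum rb.
Hypothesis lam0 : 0 < lam.
Hypothesis lam1 : lam <= 1.
Hypothesis cD : step_radius Delta <= c.

Local Notation rho := (1 - t ^+ 2).

Definition noise_cost v := expR (8 * lam * penalty _ _ psi mum (step_radius_at c v)).

Definition initial_cost (m : probability X R) w := initial_weight _ (4 * lam)
  (fine (one_step m Q g (Ys 0%N w) (near_fiber h (Ys 1%N w) Delta))).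

Lemma rho_gt0 : 0 < rho.
Proof. by rewrite subr_gt0 expr_lt1. Qed.

(** The cross product is bounded with the fibres [C] of the large width [D1], the
    normalising constants with the fibres [B] of the given width [Delta].  Bad
    steps and penalties then become products over the noises. *)
Lemma pathwise w n s : (forall k, 0 < As k w < 1) ->
  (tv_norm (fun A => (filter_law nu Q g (Ys ^~ w) n.+1 A - filter_law nu' Q g (Ys ^~ w) n.+1 A)%R)
   <= (2 * rho ^+ (n.+1 - 1 - s.*2))%:E *
        ((\prod_(j < n.+2) (if (L < enorm (es j w))%R then rho ^- 4 else 1%R))%:E
        + (\prod_(j < n.+2) (if (L < gplus (As j w))%R then rho ^- 4 else 1%R))%:E)
     + (2 * expR (lam * (n.+1%:R * (4 * ln M - 2 * ln (Num.min gam (l * gam))) - s%:R * H)))%:E *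
        ((\prod_(j < n.+1) noise_cost (noise_block 0 j w))%:E
         + (\prod_(j < n.+1) noise_cost (noise_block 1 j w))%:E
         + initial_cost nu w + initial_cost nu' w))%E.
Proof.
move=> Aw.
pose y k := Ys k w.
pose U m := fine (one_step m Q g (y 0%N) (near_fiber h (y 1%N) Delta)).
have mg k : measurable_fun setT (fun x => g x (y k)).
  apply: (measurableT_comp (f := upsilon)) => //.
  by apply: (@measurable_subrV R p _ X (fun=> y k) h).
have g0 x k : 0 <= g x (y k) by exact: ups0.
have gM x k : g x (y k) <= M by exact: upsM.
have UE (m : probability X R) : one_step m Q g (y 0%N) (near_fiber h (y 1%N) Delta) = (U m)%:E.
  by rewrite fineK// (one_step_fin M) ?(le_trans ler01 M1).
have coef0 : 0 < 2 * expR (lam * (n.+1%:R * (4 * ln M - 2 * ln (Num.min gam (l * gam))) - s%:R * H)).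
  by rewrite mulr_gt0// expR_gt0.
set coef := 2 * expR _ in coef0 *.
have prod0 o : 0 <= \prod_(j < n.+1) noise_cost (noise_block o j w).
  by apply: prodr_ge0 => j _; exact: expR_ge0.
have rho0 := rho_gt0.
have rho1 : rho <= 1 by rewrite gerBl exprn_ge0.
have bad0 (F : nat -> R) : 0 <= \prod_(j < n.+2) (if L < F j then rho ^- 4 else 1).
  by apply: prodr_ge0 => j _; case: ifP => // _; rewrite invr_ge0 exprn_ge0// ltW.
have first0 : (0 <= (2 * rho ^+ (n.+1 - 1 - s.*2))%:E *
        ((\prod_(j < n.+2) (if (L < enorm (es j w))%R then rho ^- 4 else 1%R))%:E
        + (\prod_(j < n.+2) (if (L < gplus (As j w))%R then rho ^- 4 else 1%R))%:E))%E.
  rewrite -EFinD -EFinM lee_fin; apply: mulr_ge0.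
    by rewrite mulr_ge0// exprn_ge0// ltW.
  exact: (addr_ge0 (bad0 (fun j => enorm (es j w))) (bad0 (fun j => gplus (As j w)))).
have inf_cost m : U m <= 0 -> initial_cost m w = +oo%E.
  by move=> Um; rewrite /initial_cost /initial_weight -/(U m) Um.
have [Un|Un] := leP (U nu) 0.
  apply: (le_add_infinite _ _ _ _ _ _ _ _ coef0 first0); try exact: initial_weight_ge0.
  by left; exact: inf_cost.
have [Un'|Un'] := leP (U nu') 0.
  apply: (le_add_infinite _ _ _ _ _ _ _ _ coef0 first0); try exact: initial_weight_ge0.
  by right; exact: inf_cost.
pose C k := near_fiber h (y k) D1.
pose B k := near_fiber h (y k) Delta.
pose good k := [&& enorm (es k w) <= L, enorm (es k.+1 w) <= L & gplus (As k.+1 w) <= L].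
pose pen k := penalty _ _ psi mum (step_radius_at c (es k w, es k.+1 w, As k.+1 w)).
have rb0 : 0 <= rb.
  rewrite /rb; move: (step_radius D1) (step_radius_ge0 _ D10) => r1 r10.
  by rewrite !(addr_ge0, mulr_ge0).
have mC k : measurable (C k) by exact: measurable_near_fiber.
have mB k : measurable (B k) by exact: measurable_near_fiber.
have out k x : ~ C k x -> g x (y k) <= expR (- H) * M.
  move=> /negP; rewrite -ltNge => hx; apply/ltW/upsD1.
  by rewrite enormC ltW.
have minor k x x' : good k -> C k x -> C k x' ->
    forall A, measurable A -> (t%:E * Q x' (A `&` C k.+1) <= Q x (A `&` C k.+1))%E.
  move=> /and3P[g1 g2 g3] Cx Cx'.
  have rad z : C k z -> forall z', C k.+1 z' -> enorm (z' - f z) <= rb.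
    move=> Cz z' Cz'; apply: le_trans (path_radius w k D1 z z' (Aw k.+1) Cz Cz') _.
    rewrite /step_radius_at /rb /=; apply: lerD => //; apply: lerD; last by rewrite ler_wpM2l.
    by rewrite lerD2l ler_wpM2l ?mulr_ge0.
  by apply: (kernel_ratio _ _ psi mum mup mum0 mup0 q_pm q f Q mq q0 QE q_bounds x x' (C k.+1) rb t) => //;
    [exact: rad|exact: rad].
have pen0 k : 0 <= pen k by exact: penalty_ge0.
have g_low k x : B k x -> gam <= g x (y k).
  by move=> Bx; apply: upsgam; rewrite enormC.
have Qlow k x : B k x -> ((l * expR (- pen k))%:E <= Q x (B k.+1))%E.
  move=> Bx; set v := (es k w, es k.+1 w, As k.+1 w).
  have rv x' : B k.+1 x' -> enorm (x' - f x) <= step_radius_at c v.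
    move=> Bx'; apply: le_trans (path_radius w k Delta x x' (Aw k.+1) Bx Bx') _.
    by rewrite /step_radius_at !lerD2r.
  have rv0 : 0 <= step_radius_at c v.
    have c0 : 0 <= c by apply: le_trans cD; apply: step_radius_ge0; exact: ltW.
    have G0 := gplus_ge0 w k.+1 (Aw k.+1).
    by rewrite /step_radius_at !addr_ge0 ?mulr_ge0 ?enorm_ge0.
  apply: le_trans (kernel_lower _ _ psi mum mup mum0 q_pm q f Q mq QE q_bounds x (B k.+1) (step_radius_at c v) (mB _) rv0 rv).
  rewrite mulrC EFinM; apply: lee_pmul; rewrite ?lee_fin ?expR_ge0 ?(ltW l0)//.
    exact: (penalty_qlow _ _ psi mum mup q_pm).
  exact: vol.
have m00 : 0 < Num.min gam (l * gam) by rewrite lt_min gam0 mulr_gt0.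
have m01 : Num.min gam (l * gam) <= gam by rewrite ge_min lexx.
have m02 : Num.min gam (l * gam) <= l * gam by rewrite ge_min lexx orbT.
have main := tv_filter_path _ _ _ Q g y M mg g0 gM M1 C good t H mC t0 (ltW t1) out minor B pen l gam
  (Num.min gam (l * gam)) mB l0 gam0 m00 m01 m02 pen0 g_low Qlow nu nu' n s (U nu) (U nu') lam Un Un'
  (ltW lam0) lam1 (UE nu) (UE nu').
apply: le_trans main _.
rewrite EFinD; apply: leeD.
  rewrite -EFinD -EFinM lee_fin -mulrA; apply: ler_wpM2l => //.
  apply: (good_power _ _ good (fun j => L < enorm (es j w)) (fun j => L < gplus (As j w))) => //.
  by move=> k; rewrite /good !negb_and -!ltNge.
have SS := le_sum_even_odd _ pen n.+1 pen0.
have costE o : \prod_(j < n.+1) noise_cost (noise_block o j w)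
    = expR (8 * lam * \sum_(j < n.+1) pen (o + j.*2)%N).
  by rewrite mulr_sumr expR_sum; apply: eq_bigr.
rewrite !costE /coef EFinM [X in (_ <= X * _)%E]EFinM -muleA; apply: lee_wpmul2l => //.
exact: (split_weights _ lam _ _ _ _ _ _ (ltW lam0) Un Un' SS).
Qed.

Let tail_weight (F : R) : R := if L < F then rho ^- 4 else 1.

Let tail_weight_ge0 F : 0 <= tail_weight F.
Proof. by rewrite /tail_weight; case: ifP => // _; rewrite invr_ge0 exprn_ge0// ltW// rho_gt0. Qed.

Let measurable_tail_weight : measurable_fun setT tail_weight.
Proof.
apply: measurable_fun_ifT => //.
by apply: measurable_fun_ltr => //; exact: measurable_cst.
Qed.

Lemma measurable_step_radius_at : measurable_fun setT (step_radius_at c).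
Proof.
have m11 : measurable_fun setT (fun v : Y * Y * R => v.1.1).
  by apply: (measurableT_comp (f := fst) (g := fst)).
have m12 : measurable_fun setT (fun v : Y * Y * R => v.1.2).
  by apply: (measurableT_comp (f := snd) (g := fst)).
apply: measurable_funD; last exact: measurableT_comp.
apply: measurable_funD; first apply: measurable_funD => //.
- by apply: measurable_funM => //; exact: (measurableT_comp (@measurable_enorm R p) m11).
- by apply: measurable_funM => //; exact: (measurableT_comp (@measurable_enorm R p) m12).
Qed.

Lemma measurable_noise_cost : measurable_fun setT noise_cost.
Proof.
apply: measurableT_comp; first exact: measurable_expR.
apply: measurable_funM => //.
apply: (measurableT_comp (f := penalty _ _ psi mum)); last exact: measurable_step_radius_at.
by apply: nondecreasing_measurable => //; exact: (penalty_nd _ _ psi mum mup).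
Qed.

Lemma measurable_initial_cost m : measurable_fun setT (initial_cost m).
Proof.
apply: (measurableT_comp (f := initial_weight R (4 * lam))).
  exact: measurable_initial_weight.
apply: measurableT_comp => //.
apply: (measurableT_comp (f := fun yy : Y * Y => one_step m Q g yy.1 (near_fiber h yy.2 Delta))
   (g := fun w => (Ys 0%N w, Ys 1%N w))).
  exact: (measurable_one_step _ _ _ q f).
by apply/measurable_fun_pairP; split.
Qed.

(** The random factors of [pathwise] are products over independent variables or
    blocks.  The null set on which the uniform variables leave (0, 1) is covered
    by an additional term of infinite height and zero integral. *)
Lemma expectation_bound (a1 a2 K1 K0 : R) n s :
  (\int[P]_w (tail_weight (enorm (es 0%N w)))%:E <= a1%:E)%E ->
  (\int[P]_w (tail_weight (gplus (As 0%N w)))%:E <= a2%:E)%E ->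
  (\int[P]_w (noise_cost (noise_block 0 0 w))%:E = K1%:E)%E ->
  (\int[P]_w initial_cost nu w + \int[P]_w initial_cost nu' w <= K0%:E)%E ->
  (\int[P]_w tv_norm (fun A => (filter_law nu Q g (Ys ^~ w) n.+1 A
        - filter_law nu' Q g (Ys ^~ w) n.+1 A)%R)
   <= (2 * rho ^+ (n.+1 - 1 - s.*2) * (a1 ^+ n.+2 + a2 ^+ n.+2)
     + 2 * expR (lam * (n.+1%:R * (4 * ln M - 2 * ln (Num.min gam (l * gam))) - s%:R * H))
        * (K1 ^+ n.+1 + K1 ^+ n.+1 + K0))%:E)%E.
Proof.
move=> Ea1 Ea2 EK1 EK0.
have [N0 [mN0 PN0 AN0]] := uniform_interior _ _ _ P As (obs_A_uniform obs).
set c1 := 2 * rho ^+ _; set c2 := 2 * expR _.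
have c10 : 0 <= c1 by rewrite mulr_ge0// exprn_ge0// ltW// rho_gt0.
have c20 : 0 <= c2 by rewrite mulr_ge0// expR_ge0.
pose F1 w : R := \prod_(j < n.+2) tail_weight (enorm (es j w)).
pose F2 w : R := \prod_(j < n.+2) tail_weight (gplus (As j w)).
pose F3 w : R := \prod_(j < n.+1) noise_cost (noise_block 0 j w).
pose F4 w : R := \prod_(j < n.+1) noise_cost (noise_block 1 j w).
have F10 w : 0 <= F1 w by apply: prodr_ge0.
have F20 w : 0 <= F2 w by apply: prodr_ge0.
have F30 w : 0 <= F3 w by apply: prodr_ge0 => j _; exact: expR_ge0.
have F40 w : 0 <= F4 w by apply: prodr_ge0 => j _; exact: expR_ge0.
have mte : measurable_fun setT (fun v : Y => tail_weight (enorm v)).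
  by apply: (measurableT_comp measurable_tail_weight); exact: measurable_enorm.
have mtg : measurable_fun setT (fun v : R => tail_weight (gplus v)).
  exact: (measurableT_comp measurable_tail_weight mgplus).
have mF1 : measurable_fun setT (EFin \o F1).
  apply/measurable_EFinP; apply: measurable_prod => j _.
  exact: (measurableT_comp mte).
have mF2 : measurable_fun setT (EFin \o F2).
  apply/measurable_EFinP; apply: measurable_prod => j _.
  exact: (measurableT_comp mtg).
have mF34 o : measurable_fun setT (fun w => (\prod_(j < n.+1) noise_cost (noise_block o j w))%:E).
  apply/measurable_EFinP; apply: measurable_prod => j _.
  by apply: (measurableT_comp measurable_noise_cost); exact: measurable_block.
pose bound w := ((+oo * (\1_N0 w)%:E) + (c1%:E * ((F1 w)%:E + (F2 w)%:E)
  + c2%:E * ((F3 w)%:E + (F4 w)%:E + initial_cost nu w + initial_cost nu' w)))%E.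
have i0 m w : (0 <= initial_cost m w)%E by exact: initial_weight_ge0.
have h2 w : (0 <= c1%:E * ((F1 w)%:E + (F2 w)%:E))%E.
  by rewrite -EFinD -EFinM lee_fin mulr_ge0// addr_ge0.
have h3 w : (0 <= c2%:E * ((F3 w)%:E + (F4 w)%:E + initial_cost nu w + initial_cost nu' w))%E.
  by rewrite mule_ge0 ?lee_fin// !adde_ge0 ?lee_fin.
apply: (@le_trans _ _ (\int[P]_w bound w)%E).
  apply: ge0_le_integral_lower => w; first exact: tv_norm_ge0.
  have [wN0|wN0] := boolP (w \in N0).
    rewrite /bound indicE wN0 mulr1n mule1 addye ?leey//.
    by rewrite gt_eqF// (@lt_le_trans _ _ 0%E)// adde_ge0.
  rewrite /bound indicE (negbTE wN0) mule0 add0e.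
  by apply: pathwise; apply: AN0; move: wN0; rewrite notin_setE.
have mi : measurable_fun setT (fun w => (\1_N0 w : R)%:E).
  by apply/measurable_EFinP; exact: measurable_indic.
have mI m : measurable_fun setT (initial_cost m) by exact: measurable_initial_cost.
have m2 : measurable_fun setT (fun w => c1%:E * ((F1 w)%:E + (F2 w)%:E))%E.
  by apply: measurable_funeM; exact: emeasurable_funD.
have m34 : measurable_fun setT (fun w => (F3 w)%:E + (F4 w)%:E)%E.
  by apply: emeasurable_funD; exact: mF34.
have m345 : measurable_fun setT (fun w => (F3 w)%:E + (F4 w)%:E + initial_cost nu w)%E.
  exact: emeasurable_funD.
have m3456 : measurable_fun setT (fun w => (F3 w)%:E + (F4 w)%:E + initial_cost nu w
     + initial_cost nu' w)%E.
  exact: emeasurable_funD.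
have m3 : measurable_fun setT (fun w => c2%:E * ((F3 w)%:E + (F4 w)%:E + initial_cost nu w
     + initial_cost nu' w))%E.
  exact: measurable_funeM.
have IF1 : (\int[P]_w (F1 w)%:E <= (a1 ^+ n.+2)%:E)%E.
  have e0 : (\int[P]_w (tail_weight (enorm (es 0%N w)))%:E < +oo)%E.
    by apply: le_lt_trans Ea1 _; rewrite ltry.
  have := expectation_prod_iid _ _ _ P _ _ es (fun v => tail_weight (enorm v)) n.+2
    (obs_eps_iid obs) mte (fun v => tail_weight_ge0 _) e0.
  rewrite /F1 => ->; rewrite lee_fin lerXn2r ?nnegrE//.
  - by apply: fine_ge0; apply: integral_ge0 => w _; rewrite lee_fin.
  - rewrite -lee_fin; apply: le_trans Ea1.
    by apply: integral_ge0 => w _; rewrite lee_fin.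
  - rewrite -lee_fin fineK// ge0_fin_numE//.
    by apply: integral_ge0 => w _; rewrite lee_fin.
have IF2 : (\int[P]_w (F2 w)%:E <= (a2 ^+ n.+2)%:E)%E.
  have e0 : (\int[P]_w (tail_weight (gplus (As 0%N w)))%:E < +oo)%E.
    by apply: le_lt_trans Ea2 _; rewrite ltry.
  have := expectation_prod_iid _ _ _ P _ _ As (fun v => tail_weight (gplus v)) n.+2
    (obs_A_iid obs) mtg (fun v => tail_weight_ge0 _) e0.
  rewrite /F2 => ->; rewrite lee_fin lerXn2r ?nnegrE//.
  - by apply: fine_ge0; apply: integral_ge0 => w _; rewrite lee_fin.
  - rewrite -lee_fin; apply: le_trans Ea2.
    by apply: integral_ge0 => w _; rewrite lee_fin.
  - rewrite -lee_fin fineK// ge0_fin_numE//.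
    by apply: integral_ge0 => w _; rewrite lee_fin.
have IF34 o : (\int[P]_w (\prod_(j < n.+1) noise_cost (noise_block o j w))%:E = (K1 ^+ n.+1)%:E)%E.
  have e0 : (\int[P]_w (noise_cost (noise_block 0 0 w))%:E < +oo)%E by rewrite EK1 ltry.
  have := expectation_prod_blocks _ _ _ P _ _ _ _ es As (obs_eps_iid obs) (obs_A_iid obs)
    (obs_eps_A obs) noise_cost o n.+1 measurable_noise_cost (fun v => expR_ge0 _) e0.
  by rewrite -/noise_block EK1.
rewrite ge0_integralD; try solve [exact: measurableT | exact: emeasurable_funD | exact: measurable_funeM
  | by move=> w _; exact: adde_ge0 | by move=> w _; rewrite mule_ge0// lee_fin].
rewrite ge0_integralZl//; try by move=> w _; rewrite lee_fin.
have -> : (\int[P]_w (\1_N0 w : R)%:E = 0)%E by rewrite integral_indic// setIT.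
rewrite mule0 add0e.
rewrite ge0_integralD// EFinD; apply: leeD.
  rewrite ge0_integralZl//; try solve [exact: emeasurable_funD
    | by move=> w _; rewrite -EFinD lee_fin addr_ge0].
  rewrite [leRHS]EFinM; apply: lee_wpmul2l => //.
  rewrite ge0_integralD// ?EFinD; try by move=> w _; rewrite lee_fin.
  exact: leeD.
rewrite ge0_integralZl//; try by move=> w _; rewrite !adde_ge0 ?lee_fin.
rewrite [leRHS]EFinM; apply: lee_wpmul2l => //.
have j34 w : (0 <= (F3 w)%:E + (F4 w)%:E)%E by rewrite -EFinD lee_fin addr_ge0.
have j345 w : (0 <= (F3 w)%:E + (F4 w)%:E + initial_cost nu w)%E by exact: adde_ge0.
rewrite (ge0_integralD _ measurableT (fun w _ => j345 w) m345 (fun w _ => i0 nu' w) (mI nu')).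
rewrite (ge0_integralD _ measurableT (fun w _ => j34 w) m34 (fun w _ => i0 nu w) (mI nu)).
rewrite ge0_integralD//; try solve [exact: mF34 | by move=> w _; rewrite lee_fin].
rewrite (IF34 0%N) (IF34 1%N) -addeA !EFinD.
exact: leeD.
Qed.

End path.

(** The constants are chosen in the order H, D1, L, t.  This is possible because
    the tail probability 1 / 240 that determines L does not depend on t. *)
Lemma exponential_decay (M gam l lam c K1 K0 : R) :
  1 <= M -> (forall u, upsilon u <= M) ->
  0 < gam -> (forall u, enorm u <= Delta -> gam <= upsilon u) ->
  0 < l -> (forall y, (l%:E <= lebesgue_rV R N (near_fiber h y Delta))%E) ->
  (forall e, 0 < e -> exists D, forall u, D <= enorm u -> upsilon u < e) ->
  0 < lam -> lam <= 1 -> step_radius Delta <= c ->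
  1 <= K1 -> (\int[P]_w (noise_cost lam c (noise_block 0 0 w))%:E = K1%:E)%E ->
  0 <= K0 ->
  (\int[P]_w initial_cost lam nu w + \int[P]_w initial_cost lam nu' w <= K0%:E)%E ->
  exists K delta : R, [/\ 0 < K, 0 < delta & forall n, (0 < n)%N ->
    (\int[P]_w tv_norm (fun A => (filter_law nu Q g (Ys ^~ w) n A
        - filter_law nu' Q g (Ys ^~ w) n A)%R) <= (K * expR (- (delta * n%:R)))%:E)%E].
Proof.
have double_both (x z : R) : x <= z -> 2 * (x + x) <= 4 * z by lra.
have small (x : R) : x <= 16^-1 -> x <= 1 /\ x / 2 <= 1 by split; lra.
move=> M1 upsM gam0 upsgam l0 vol ups_lim lam0 lam1 cD K11 EK1 K00 EK0.
pose k := 4 * ln M - 2 * ln (Num.min gam (l * gam)).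
(* the value required by [rate_weights] *)
pose H := 8 * `|k| + 8 * (ln K1 + 1) / lam.
have [|D ups_D] := ups_lim (expR (- H) * M).
  by rewrite mulr_gt0 ?expR_gt0// (lt_le_trans ltr01).
pose D1 := Num.max D 0.
have D10 : 0 <= D1 by rewrite le_max lexx orbT.
have ups_D1 u : D1 <= enorm u -> upsilon u < expR (- H) * M.
  by move=> Du; apply: ups_D; apply: le_trans Du; rewrite le_max lexx.
have e0 : 0 < 240^-1 :> R by rewrite invr_gt0 ltr0n.
have mes : measurable_fun setT (fun w => enorm (es 0%N w)).
  by apply: measurableT_comp => //; exact: measurable_enorm.
have mAs : measurable_fun setT (fun w => gplus (As 0%N w)) by exact: measurableT_comp.
have [L1 L10 PL1] := tail_small _ _ _ P _ _ mes e0.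
have [L2 L20 PL2] := tail_small _ _ _ P _ _ mAs e0.
pose L := Num.max L1 L2.
have L0 : 0 <= L by rewrite le_max L10.
pose rb := step_radius D1 + astar * bs * L + bs * L + L.
have rb0 : 0 <= rb.
  rewrite /rb; move: (step_radius D1) (step_radius_ge0 _ D10) => r1 r10.
  by rewrite !(addr_ge0, mulr_ge0).
have ql0 := qlow_gt0 _ _ psi mum mup q_pm _ rb0.
have qlh := qlow_le_qhigh _ _ psi mum mup q_pm _ rb0.
have qh0 := lt_le_trans ql0 qlh.
pose t := Num.min 4^-1 (qlow _ _ psi mum rb / qhigh _ _ psi mup rb).
have t0 : 0 < t by rewrite lt_min invr_gt0 ltr0n divr_gt0.
have t14 : t <= 4^-1 by rewrite ge_min lexx.
have tq : t * qhigh _ _ psi mup rb <= qlow _ _ psi mum rb.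
  by rewrite -ler_pdivlMr// ge_min lexx orbT.
have t1 : t < 1 by lra.
pose theta := t ^+ 2.
have th0 : 0 < theta by rewrite exprn_gt0.
have th1 : theta <= 16^-1 by exact: sqr_quarter (ltW t0) t14.
pose w := (1 - theta) ^- 4.
have [th_le1 th_half] := small _ th1.
have [w1 a1th] := tail_weight_bound _ theta (ltW th0) th1.
pose a1 := 1 + 240^-1 * (w - 1).
have a10 : 0 <= a1 by rewrite addr_ge0 ?mulr_ge0 ?subr_ge0 ?(ltW e0).
exists (4 * expR 2 + 2 * ((2 + K0) * expR (lam * H))), (theta / 2); split.
- by rewrite addr_gt0// mulr_gt0 ?expR_gt0// mulr_gt0 ?expR_gt0// ltr_wpDr.
- by rewrite divr_gt0.
case=> // n _.
have main := expectation_bound M gam l H D1 L t lam c M1 upsM gam0 upsgam l0 vol D10 ups_D1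
  L0 (ltW t0) t1 tq lam0 lam1 cD a1 a1 K1 K0 n (n.+1 %/ 8).
apply: le_trans (main _ _ EK1 EK0) _.
- by apply: bernoulli_bound => //; apply: PL1; rewrite le_max lexx.
- by apply: bernoulli_bound => //; apply: PL2; rewrite le_max lexx orbT.
have r1 := rate_coupled _ theta a1 n.+1 (ltW th0) th_le1 a10 a1th.
have r2 := rate_weights _ lam k K1 K0 H n.+1 lam0 K11 K00 erefl.
rewrite lee_fin [leRHS]mulrDl; apply: lerD.
  by rewrite -[2 * _ * _]mulrA mulrDr -[leRHS]mulrA; exact: double_both.
rewrite -!mulrA; apply: ler_wpM2l => //; rewrite mulrA; apply: le_trans r2 _.
rewrite !mulrA; apply: ler_wpM2l; first by rewrite !mulr_ge0 ?expR_ge0// addr_ge0.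
by rewrite ler_expR lerN2 ler_piMl.
Qed.

Lemma noise_cost_moment (lam c : R) : 0 < lam ->
  (\int[P]_w (qmoment _ _ psi mum (8 * lam) (step_radius_at c (noise_block 0 0 w)))%:E < +oo)%E ->
  exists2 K1 : R, 1 <= K1 & (\int[P]_w (noise_cost lam c (noise_block 0 0 w))%:E = K1%:E)%E.
Proof.
move=> lam0 moment; have lam8 : 0 < 8 * lam by rewrite mulr_gt0.
have mnc : measurable_fun setT (fun w => noise_cost lam c (noise_block 0 0 w)).
  by apply: (measurableT_comp (measurable_noise_cost lam c)); exact: measurable_block.
have ge1 : (1 <= \int[P]_w (noise_cost lam c (noise_block 0 0 w))%:E)%E.
  rewrite -[X in (X <= _)%E]mul1e -[X in (1 * X)%E](probability_setT P) -integral_cst//.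
  apply: ge0_le_integral_lower => w; first by rewrite lee_fin.
  by rewrite lee_fin -expR0 ler_expR mulr_ge0 ?(ltW lam8)// penalty_ge0.
have fin : (\int[P]_w (noise_cost lam c (noise_block 0 0 w))%:E \is a fin_num)%E.
  rewrite ge0_fin_numE; last by apply: le_trans ge1.
  apply: (@le_lt_trans _ _ (\int[P]_w (1%:E
     + (qmoment _ _ psi mum (8 * lam) (step_radius_at c (noise_block 0 0 w)))%:E))%E).
    apply: ge0_le_integral_lower => w; first by rewrite lee_fin expR_ge0.
    by rewrite -EFinD lee_fin; exact: penalty_moment.
  have mqm : measurable_fun setT (fun w =>
      (qmoment _ _ psi mum (8 * lam) (step_radius_at c (noise_block 0 0 w)))%:E).
    apply/measurable_EFinP; apply: (measurableT_comp (f := qmoment _ _ psi mum (8 * lam))).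
      by apply: nondecreasing_measurable => //; exact: (qmoment_nd _ _ psi mum mup).
    apply: (measurableT_comp (measurable_step_radius_at c)); exact: measurable_block.
  have qm0 r : 0 <= qmoment _ _ psi mum (8 * lam) r.
    by rewrite /qmoment; case: ifP => // _; exact: expR_ge0.
  rewrite ge0_integralD//; last by move=> w _; rewrite lee_fin.
  by rewrite integral_cst// [X in (1%:E * X)%E]probability_setT mule1 lte_add_pinfty ?ltry.
exists (fine (\int[P]_w (noise_cost lam c (noise_block 0 0 w))%:E)%E); last by rewrite fineK.
by rewrite -lee_fin fineK.
Qed.

Lemma initial_cost_moment (M lam lam' : R) (m : probability X R) :
  0 <= M -> (forall u, upsilon u <= M) -> 0 < lam -> 4 * lam <= lam' ->
  (\int[P]_w expeR (lam'%:E * neg_part (lne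
     (one_step m Q g (Ys 0%N w) (near_fiber h (Ys 1%N w) Delta)))) < +oo)%E ->
  exists2 K : R, 0 <= K & (\int[P]_w initial_cost lam m w = K%:E)%E.
Proof.
move=> M0 upsM lam0 lam4 fin.
have lam'0 : 0 < lam' by apply: lt_le_trans lam4; rewrite mulr_gt0.
have I0 : (0 <= \int[P]_w initial_cost lam m w)%E.
  by apply: integral_ge0 => w _; exact: initial_weight_ge0.
have Ioo : (\int[P]_w initial_cost lam m w < +oo)%E.
  apply: le_lt_trans fin; apply: ge0_le_integral_lower => w; first exact: initial_weight_ge0.
  apply: le_trans (initial_weight_le _ _ _ _ lam4) _.
  by rewrite initial_weightE// fineK// (one_step_fin M).
exists (fine (\int[P]_w initial_cost lam m w)%E); first exact: fine_ge0.
by rewrite fineK// ge0_fin_numE.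
Qed.

End forgetting.

Theorem mainTheorem6 (R : realType) (N p : nat) (hpN : (p <= N)%N)
    (* filtering model *)
    (f : 'rV[R]_N -> 'rV[R]_N) (h : 'rV[R]_N -> 'rV[R]_p)
    (upsilon : 'rV[R]_p -> R) (q : 'rV[R]_N -> 'rV[R]_N -> R)
    (Q : R.-pker 'rV[R]_N ~> 'rV[R]_N)
    (d0 : measure_display) (T0 : measurableType d0) (P0 : probability T0 R)
    (X zeta : nat -> {RV P0 >-> 'rV[R]_N})
    (eps Y : nat -> {RV P0 >-> 'rV[R]_p})
    (mf : measurable_fun setT f) (mh : measurable_fun setT h)
    (upsilon_density : prob_density upsilon)
    (upsilon_gt0 : forall u, 0 < upsilon u)
    (mq : measurable_fun setT
            (fun xu : 'rV[R]_N * 'rV[R]_N => q xu.1 xu.2))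
    (q_density : forall x, prob_density (q x))
    (QE : forall x A, measurable A ->
       (Q x A = \int[lebesgue_rV R N]_(x' in A) (q x (x' - f x))%:E)%E)
    (* (E1) *)
    (a b0 b : R)
    (f_lipschitz : forall x1 x2, enorm (f x1 - f x2) <= a * enorm (x1 - x2))
    (h_unif_continuous : unif_continuous h)
    (h_surjective : forall y, exists x, h x = y)
    (h_inverse : forall x1 x2,
       enorm (x1 - x2) <= b0 + b * enorm (h x1 - h x2))
    (* (E2) *)
    (upsilon_bounded : exists M, forall u, upsilon u <= M)
    (upsilon_lim : forall e, 0 < e ->
       exists M, forall u, M <= enorm u -> upsilon u < e)
    (upsilon_compact : forall K : set 'rV[R]_p, compact K ->
       (0 < ereal_inf [set (upsilon y)%:E | y in K])%E)
    (* (G) *)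
    (model : filtering_model f h upsilon q X zeta eps Y)
    (psi : 'rV[R]_N -> R) (mum mup : R)
    (psi_density : prob_density psi) (psi_gt0 : forall u, 0 < psi u)
    (mum_gt0 : 0 < mum) (mup_gt0 : 0 < mup)
    (q_bounds : forall x u, mum * psi u <= q x u /\ q x u <= mup * psi u)
    (q_pm : forall r, 0 <= r ->
       (0 < q_minus mum psi r)%E /\
       (q_minus mum psi r <= q_plus mup psi r)%E /\
       (q_plus mup psi r < +oo)%E)
    (* observation process *)
    (fstar : 'rV[R]_N -> 'rV[R]_N) (hstar : 'rV[R]_N -> 'rV[R]_p)
    (gstar : 'rV[R]_N -> R -> 'rV[R]_N) (qstar : 'rV[R]_N -> 'rV[R]_N -> R)
    (d : measure_display) (T : measurableType d) (P : probability T R)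
    (Xstar zetastar : nat -> {RV P >-> 'rV[R]_N})
    (epsstar Ystar : nat -> {RV P >-> 'rV[R]_p}) (Astar : nat -> {RV P >-> R})
    (mgstar : measurable_fun setT (fun xu : 'rV[R]_N * R => gstar xu.1 xu.2))
    (observations : observation_process fstar hstar gstar qstar
       Xstar zetastar epsstar Ystar Astar)
    (astar b0star bstar : R)
    (fstar_lipschitz : forall x1 x2,
       enorm (fstar x1 - fstar x2) <= astar * enorm (x1 - x2))
    (mhstar : measurable_fun setT hstar)
    (hstar_surjective : forall y, exists x, hstar x = y)
    (b0star_gt0 : 0 < b0star) (bstar_gt0 : 0 < bstar)
    (hstar_inverse : forall x1 x2,
       enorm (x1 - x2) <= b0star + bstar * enorm (hstar x1 - hstar x2))
    (psistar : 'rV[R]_N -> R) (mumstar mupstar : R)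
    (mqstar : measurable_fun setT
                (fun xu : 'rV[R]_N * 'rV[R]_N => qstar xu.1 xu.2))
    (qstar_density : forall x, prob_density (qstar x))
    (psistar_density : prob_density psistar)
    (mumstar_gt0 : 0 < mumstar) (mupstar_gt0 : 0 < mupstar)
    (qstar_bounds : forall x u,
       mumstar * psistar u <= qstar x u /\ qstar x u <= mupstar * psistar u)
    (* (O1) *)
    (f_mismatch : (supnorm (fun x => f x - fstar x)%R < +oo)%E)
    (h_mismatch : (supnorm (fun x => h x - hstar x)%R < +oo)%E)
    (* (O3) *)
    (gplus : R -> R) (mgplus : measurable_fun setT gplus)
    (gstar_bound : forall x u, 0 < u -> u < 1 ->
       enorm (gstar x u) <= gplus u)
    (* (O4) *)
    (Z_exp_moments : forall Delta, 0 < Delta ->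
       exists tau, 0 < tau /\
         forall lambda, 0 <= lambda -> lambda < tau ->
           lne (\int[P]_w expeR (lambda%:E *
             Zstar (q_minus mum psi) ((a + 1) * b0) ((a + 1) * b) Delta
               (mismatch f fstar h hstar b0 b astar)
               astar bstar gplus epsstar Astar 1 w))%E \is a fin_num)
    (* initial distributions *)
    (nu nu' : probability 'rV[R]_N R) (Delta : R) (Delta_gt0 : 0 < Delta)
    (initial : exists lambda, 0 < lambda /\
       (\int[P]_w expeR (lambda%:E * neg_part (lne
          (one_step nu Q (likelihood h upsilon) (Ystar 0%N w)
             (near_fiber h (Ystar 1%N w) Delta)))) < +oo)%E /\
       (\int[P]_w expeR (lambda%:E * neg_part (lne
          (one_step nu' Q (likelihood h upsilon) (Ystar 0%N w)
             (near_fiber h (Ystar 1%N w) Delta)))) < +oo)%E) :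
  (limn_esup (fun n : nat => (n%:R^-1)%:E *
     lne (\int[P]_w tv_norm (fun A : set 'rV[R]_N =>
       (filter_law nu Q (likelihood h upsilon) (Ystar ^~ w) n A -
        filter_law nu' Q (likelihood h upsilon) (Ystar ^~ w) n A)%R))) < 0)%E.
Proof.
have [mups ups0 _] := upsilon_density.
have [N0|Npos] := posnP N.
  (* on a one-point space the distance vanishes identically *)
  subst N.
  apply: (@limn_esup_neg _ _ 1 1) => // n _.
  rewrite (eq_integral (fun=> 0%E)); last by move=> w _; exact: tv_dim0.
  by rewrite integral0 lee_fin mul1r expR_ge0.
have [a0 as0 b00 b_gt0] := dimension_signs _ _ _ _ _ _ _ _ _ _ Npos f_lipschitz fstar_lipschitz h_inverse.
have b_ge0 := ltW b_gt0.
have q0 x u : 0 <= q x u by have [_ + _] := q_density x; apply.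
have obs := observations.
have [M0 upsM0] := upsilon_bounded.
pose M := Num.max 1 M0.
have M1 : 1 <= M by rewrite le_max lexx.
have upsM u : upsilon u <= M by rewrite le_max upsM0 orbT.
have [gam gam0 upsgam] := density_lower _ _ upsilon Delta upsilon_compact.
have [l l0 vol] := near_fiber_volume _ _ _ h mh _ Delta_gt0 h_unif_continuous h_surjective.
have d_gt0 : 0 < (a + 1) * b by rewrite mulr_gt0// ltr_wpDl.
(* (O4) has another constant term than [step_radius]; a larger width absorbs it *)
pose Delta' := Delta + (1 + astar) * b0star / ((a + 1) * b).
have Delta'0 : 0 < Delta'.
  by rewrite ltr_wpDr// divr_ge0 ?(ltW d_gt0)// mulr_ge0 ?(ltW b0star_gt0)// addr_ge0.
have [tau [tau0 Ztau]] := Z_exp_moments _ Delta'0.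
have [lam1 [lam10 [init init']]] := initial.
have [lam [lam0 lam_le1 lam8_tau lam4]] := exponent_choice _ _ _ tau0 lam10.
pose kap := mismatch f fstar h hstar b0 b astar.
pose c := (a + 1) * b0 + (a + 1) * b * Delta' + kap + 2 * astar * bstar.
have radius_c : step_radius R N p f h fstar hstar a b0 b astar b0star Delta <= c.
  rewrite /step_radius /c /Delta' -/kap [_ * (Delta + _)]mulrDr [_ * (_ / _)]mulrC divfK ?gt_eqF//.
  by rewrite addrAC -!addrA !lerD2l lerDl !mulr_ge0// ltW.
have [K1 K11 EK1] : exists2 K1 : R, 1 <= K1 &
    (\int[P]_w (noise_cost R N p psi mum astar bstar gplus lam c
       (noise_block R p d T P epsstar Astar 0 0 w))%:E = K1%:E)%E.
  have lam8 : 0 < 8 * lam by rewrite mulr_gt0.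
  (* the exponential moment of Z at the exponent 8 lam *)
  apply: (noise_cost_moment _ _ _ psi mum mup) => //.
  have fin : (\int[P]_w expeR ((8 * lam)%:E * Zstar (q_minus mum psi) ((a + 1) * b0) ((a + 1) * b)
      Delta' kap astar bstar gplus epsstar Astar 1 w) < +oo)%E.
    have := Ztau (8 * lam) (ltW lam8) lam8_tau.
    by case: (\int[P]_w _)%E => [r _|//|//]; rewrite ltry.
  apply: le_lt_trans fin; apply: ge0_le_integral_lower => w.
    by rewrite lee_fin /qmoment; case: ifP => // _; exact: expR_ge0.
  by rewrite (qmomentE _ _ _ _ _ mum_gt0 q_pm).
have init_moment m := initial_cost_moment R N p h upsilon Q mh mups ups0
  d T P Ystar Delta M lam lam1 m (le_trans ler01 M1) upsM lam0 lam4.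
have [K2 K20 EK2] := init_moment nu init; have [K3 K30 EK3] := init_moment nu' init'.
have decay := exponential_decay R N p f h upsilon q Q mf mh mups ups0
  mq q0 QE psi mum mup mum_gt0 mup_gt0 q_pm q_bounds fstar hstar a b0 b astar b0star bstar
  a0 b00 b_ge0 as0 (ltW b0star_gt0) (ltW bstar_gt0) f_lipschitz h_surjective h_inverse
  fstar_lipschitz hstar_surjective hstar_inverse f_mismatch h_mismatch d T P gstar qstar
  Xstar zetastar epsstar Ystar Astar obs gplus mgplus gstar_bound nu nu' Delta Delta_gt0
  M gam l lam c K1 (K2 + K3) M1 upsM gam0 upsgam l0 vol upsilon_lim lam0 lam_le1 radius_c K11 EK1 (addr_ge0 K20 K30).
have [|K [delta [K_gt0 delta_gt0 bound]]] := decay; first by rewrite EK2 EK3.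
exact: limn_esup_neg K_gt0 delta_gt0 bound.
Qed.
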